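(* Let $K$ be a (not necessarily locally compact) flag simplicial complex equipped with a CAT(0) metric $d_K$ with finitely many shapes. Then $K$ satisfies a quadratic combinatorial isoperimetric inequality.
   Context: $K$ denotes the simplicial complex, the topological space determined by it, and the metric space $(K,d_K)$. A CAT(0) metric on $K$ is a metric $d_K$ making this space a CAT(0) (geodesic) metric space. $K$ is flag if every finite set of pairwise adjacent vertices spans a simplex. $(K,d_K)$ has finitely many shapes if there are only finitely many isometry types of metrics on the simplices $\Delta$ of $K$ that are induced by restriction of $d_K$. A simplicial map $P\to K$ sends the vertex set of each simplex of $P$ to a set of vertices spanning a simplex of $K$ (collapsing is allowed). A combinatorial loop $c$ in $K$ is a sequence of vertices $(v_1,\dots,v_j)$ with $v_i$ adjacent or equal to $v_{i+1}$ for $1\le i\le j-1$ and $v_j$ adjacent or equal to $v_1$; its combinatorial length is $l_C(c)=j$. Equivalently it is a simplicial map to $K$ from a triangulation of $S^1$ with $j$ edges. The loop $c$ can be capped off with at most $n$ triangles if there is a triangulation $P$ of the closed unit disc $D^2$ into at most $n$ 2-simplices and a simplicial map $c'\colon P\to K^{(2)}$ with $c'|_{S^1}=c$, where $K^{(2)}$ is the 2-skeleton. A function $f\colon\mathbb{N}\to\mathbb{N}$ is a combinatorial isoperimetric bound for $K$ if every combinatorial loop $c$ in $K$ can be capped off with at most $f(l_C(c))$ triangles. $K$ satisfies a quadratic combinatorial isoperimetric inequality if there is a combinatorial isoperimetric bound $f$ for $K$ with $f(n)=O(n^2)$. *)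

(* Defs.v *)
From mathcomp Require Import all_boot all_order all_algebra finmap.
From mathcomp Require Import all_classical all_reals.

Set Implicit Arguments.
Unset Strict Implicit.
Unset Printing Implicit Defensive.

Import Order.TTheory GRing.Theory Num.Theory.

Local Open Scope classical_set_scope.
Local Open Scope ring_scope.

(** * Metrics on a subset [X] of a type *)

Section MetricOn.
Context {R : realType}.

Record is_metric_on (T : Type) (X : set T) (d : T -> T -> R) : Prop := {
  metric_on_ge0 : forall x y, X x -> X y -> 0 <= d x y ;
  metric_on_eq0 : forall x y, X x -> X y -> (d x y = 0 <-> x = y) ;
  metric_on_sym : forall x y, X x -> X y -> d x y = d y x ;
  metric_on_triangle : forall x y z, X x -> X y -> X z ->
    d x z <= d x y + d y z }.

Definition continuous_on (T U : Type) (X : set T) (dX : T -> T -> R)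
    (dU : U -> U -> R) (f : T -> U) : Prop :=
  forall x, X x -> forall e, 0 < e -> exists2 r, 0 < r &
    forall y, X y -> dX x y < r -> dU (f x) (f y) < e.

Definition homeomorphism_on (T U : Type) (X : set T) (dX : T -> T -> R)
    (Y : set U) (dY : U -> U -> R) (h : T -> U) : Prop :=
  [/\ set_bij X Y h, continuous_on X dX dY h &
      exists2 g : U -> T, (forall x, X x -> g (h x) = x) &
        continuous_on Y dY dX g].

Definition isometric (T U : Type) (X : set T) (dX : T -> T -> R)
    (Y : set U) (dY : U -> U -> R) : Prop :=
  exists2 phi : T -> U, set_bij X Y phi &
    forall x y, X x -> X y -> dY (phi x) (phi y) = dX x y.

(* [g], restricted to [0, d x y], is a geodesic from [x] to [y]; its values
   outside this interval are irrelevant. *)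
Definition is_geodesic (T : Type) (X : set T) (d : T -> T -> R)
    (x y : T) (g : R -> T) : Prop :=
  [/\ g 0 = x, g (d x y) = y,
      forall s, 0 <= s <= d x y -> X (g s) &
      forall s t, 0 <= s <= d x y -> 0 <= t <= d x y ->
        d (g s) (g t) = `|s - t|].

Definition geodesic_space (T : Type) (X : set T) (d : T -> T -> R) : Prop :=
  forall x y, X x -> X y -> exists g, is_geodesic X d x y g.

(* The Euclidean distance of the plane; the norm that the library puts on
   [R * R] is the sup norm. *)
Definition edist (p q : R * R) : R :=
  Num.sqrt ((p.1 - q.1) ^+ 2 + (p.2 - q.2) ^+ 2).

(* The i-th side of the triangle with vertices [a 0], [a 1], [a 2] joins [a i]
   to [a (i + 1)], indices being taken mod 3. The comparison point of a point x
   of this side is the point x' of the segment between [a' i] and [a' (i + 1)]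
   with |a' i - x'| = d (a i) x; it is pinned down by its distances to the two
   endpoints, which add up to |a' i - a' (i + 1)|. *)
Definition CAT0_inequality (T : Type) (X : set T) (d : T -> T -> R) : Prop :=
  forall (a : 'I_3 -> T) (side : 'I_3 -> R -> T) (a' : 'I_3 -> R * R),
    (forall i, X (a i)) ->
    (forall i, is_geodesic X d (a i) (a (ordS i)) (side i)) ->
    (forall i, edist (a' i) (a' (ordS i)) = d (a i) (a (ordS i))) ->
  forall (i k : 'I_3) (s t : R) (x' y' : R * R),
    0 <= s <= d (a i) (a (ordS i)) ->
    0 <= t <= d (a k) (a (ordS k)) ->
    edist (a' i) x' = s ->
    edist x' (a' (ordS i)) = d (a i) (a (ordS i)) - s ->
    edist (a' k) y' = t ->
    edist y' (a' (ordS k)) = d (a k) (a (ordS k)) - t ->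
    d (side i s) (side k t) <= edist x' y'.

Definition is_CAT0 (T : Type) (X : set T) (d : T -> T -> R) : Prop :=
  [/\ is_metric_on X d, geodesic_space X d & CAT0_inequality X d].

End MetricOn.

(** * Simplicial complexes *)

(* Every element of [V] is a vertex; a simplex is given by its vertex set. *)
Record simplicial_complex (V : choiceType) := SimplicialComplex {
  simplex :> {fset V} -> Prop ;
  simplex_neq0 : forall s, simplex s -> s != fset0 ;
  simplex_vertex : forall v, simplex [fset v]%fset ;
  simplex_face : forall s t : {fset V},
    simplex s -> (t `<=` s)%fset -> t != fset0 -> simplex t }.

Definition adjacent (V : choiceType) (K : simplicial_complex V) (v w : V) :=
  v != w /\ K [fset v; w]%fset.

Definition flag (V : choiceType) (K : simplicial_complex V) : Prop :=
  forall s : {fset V}, s != fset0 ->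
    (forall v w, v \in s -> w \in s -> v != w -> adjacent K v w) -> K s.

Definition skeleton_simplex (V : choiceType) (K : simplicial_complex V)
    (n : nat) : set {fset V} := [set s | K s /\ (#|` s| <= n.+1)%N].

Program Definition skeleton (V : choiceType) (K : simplicial_complex V)
    (n : nat) : simplicial_complex V :=
  @SimplicialComplex V (skeleton_simplex K n) _ _ _.
Next Obligation. by move=> V K n s [/simplex_neq0]. Qed.
Next Obligation.
by move=> V K n v; split; [exact: simplex_vertex | rewrite cardfs1].
Qed.
Next Obligation.
move=> V K n s t [Ks sn] ts t0; split; first exact: simplex_face ts t0.
exact: leq_trans (fsubset_leq_card ts) sn.
Qed.

Definition simplicial_map (W V : choiceType) (P : simplicial_complex W)
    (K : simplicial_complex V) (f : W -> V) : Prop :=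
  forall s, P s -> K (f @` s)%fset.

(** * The geometric realization *)

Section Realization.
Context {R : realType} {V : choiceType}.
Implicit Types (K : simplicial_complex V) (s : {fset V}).

(* A point is given by its barycentric coordinates; [finsupp x] is the vertex
   set of the open simplex containing [x]. *)
Definition bary_point : choiceType := {fsfun V -> R with 0}.

Definition realization K : set bary_point :=
  [set x | [/\ K (finsupp x), forall v, 0 <= x v &
               \sum_(v <- finsupp x) x v = 1]].

Definition closed_simplex K s : set bary_point :=
  [set x | realization K x /\ (finsupp x `<=` s)%fset].

Definition bary_dist (x y : bary_point) : R :=
  \sum_(v <- (finsupp x `|` finsupp y)%fset) `|x v - y v|.

(* When K is not locally finite its realization carries two usual topologies:
   the weak one, for which a map is continuous iff it is so on every closed
   simplex, and the coarser one given by [bary_dist]; the former is not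
   metrizable. We ask for the topology of [d] to lie between the two, which
   covers the case of a metric inducing either of them; all these conditions
   agree on a finite complex. *)
Definition compatible_metric K (d : bary_point -> bary_point -> R) : Prop :=
  (forall s, K s -> continuous_on (closed_simplex K s) bary_dist d id) /\
  continuous_on (realization K) d bary_dist id.

Definition CAT0_metric K (d : bary_point -> bary_point -> R) : Prop :=
  is_CAT0 (realization K) d /\ compatible_metric K d.

(* Every simplex is isometric, for the restrictions of [d], to one in a finite
   list. As the isometries are between metric spaces, they need not respect
   faces. *)
Definition finitely_many_shapes K (d : bary_point -> bary_point -> R) : Prop :=
  exists S : {fset {fset V}},
    forall s, K s -> exists t, [/\ t \in S, K t &
      isometric (closed_simplex K s) d (closed_simplex K t) d].

End Realization.
Arguments bary_point : clear implicits.

(** * Isoperimetric inequalities *)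

Definition unit_disc (R : realType) : set (R * R) :=
  [set p | p.1 ^+ 2 + p.2 ^+ 2 <= 1].

Definition unit_circle (R : realType) : set (R * R) :=
  [set p | p.1 ^+ 2 + p.2 ^+ 2 = 1].

Arguments unit_disc : clear implicits.
Arguments unit_circle : clear implicits.

(* [P] triangulates the closed unit disc in such a way that the unit circle is
   triangulated by the [j]-cycle with successive vertices [b 0, ..., b (j-1)].
   Compactness of the disc is what makes a finite vertex set [W] enough. *)
Definition disc_triangulation (R : realType) (W : finType)
    (P : simplicial_complex W) (j : nat) (b : 'I_j -> W) : Prop :=
  [/\ injective b, forall i, P [fset b i; b (ordS i)]%fset &
      exists2 h : bary_point R W -> R * R,
        homeomorphism_on (realization P) bary_dist (unit_disc R) edist h &
        forall x, realization P x ->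
          (unit_circle R (h x) <->
           exists i, closed_simplex P [fset b i; b (ordS i)]%fset x)].

Definition combinatorial_loop (V : choiceType) (K : simplicial_complex V)
    (j : nat) (c : 'I_j -> V) : Prop :=
  forall i, adjacent K (c i) (c (ordS i)) \/ c i = c (ordS i).

Definition capped_off (R : realType) (V : choiceType)
    (K : simplicial_complex V) (j : nat) (c : 'I_j -> V) (n : nat) : Prop :=
  exists (W : finType) (P : simplicial_complex W) (b : 'I_j -> W) (f : W -> V),
    [/\ disc_triangulation R P b,
        ([set s | P s /\ #|` s| = 3%N] #<= `I_n)%card,
        simplicial_map P (skeleton K 2) f &
        forall i, f (b i) = c i].

(* A triangulation of the circle, as a simplicial complex, has at least three
   edges, so that loops of length 1 and 2 are not simplicial maps from a
   triangulated circle; whence [3 <= j]. *)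
Definition isoperimetric_bound (R : realType) (V : choiceType)
    (K : simplicial_complex V) (f : nat -> nat) : Prop :=
  forall (j : nat) (c : 'I_j -> V), (3 <= j)%N ->
    combinatorial_loop K c -> capped_off R K c (f j).

(* The ground field [R] only serves to define the unit disc. *)
Definition quadratic_isoperimetric_inequality (R : realType) (V : choiceType)
    (K : simplicial_complex V) : Prop :=
  exists2 f : nat -> nat, isoperimetric_bound R K f &
    exists C N : nat, forall n, (N <= n)%N -> (f n <= C * n ^ 2)%N.

(* Main.v *)
(* Self-maps of a simplex arbitrarily close to the identity can avoid a boundary
   point, but by Brouwer's theorem (obtained here from Scarf's lemma on dominant
   sets) not an interior point. So an isometry between two simplices, although
   it need not respect faces, maps boundary to boundary, and the boundaries of
   all simplices are locally connected in a uniform way. By induction on the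
   dimension, a point far from the boundary of its carrier [t] is uniformly far
   from all the faces not containing [t]; following a geodesic until it leaves
   the open star of [t], one sees that a uniform ball around the point lies in
   this star. Hence the open stars of the vertices have a Lebesgue number [e]:
   each [x] has a vertex [sigma x] whose open star contains the [e]-ball of [x],
   and by flagness [sigma] maps points at mutual distance less than [e] to the
   vertices of a simplex.

   A loop of length [j] is subdivided into [m = O(j)] points with steps less
   than [e / 3] and contracted along geodesics in [m] steps; by the CAT(0)
   inequality successive loops stay [e / 3]-close, so that their labels under
   [sigma] are filled with [O(m ^ 2)] triangles. The triangulated disc is the
   cone on the [j]-cycle, subdivided stellarly inside the star of the apex, whose
   link carries the current loop: subdividing an edge replaces a label of the
   loop, subdividing a triangle inserts one. As stellar subdivisions do not
   change the realization, only a triangle has to be mapped to the round disc. *)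

(* The complex may fail to be locally compact, so compactness is used only inside one closed
   simplex, and a constant obtained there reaches all simplices through the finitely many models.
   What crosses an isometry must therefore be metric or topological: boundaries qualify although
   faces may get mixed, and even a common bound on the number of vertices of a simplex has to be
   proved. That bound makes the constants of the inductions on the dimension uniform. The quadratic
   bound comes from the [m] rings of the contraction, each costing two triangles per point. A step
   of the contraction is shorter than [e / 3] because the loop, made of [m] steps shorter than
   [e / 3], lies within [m * e / 3] of its base point. *)
Require Import Defs.
From mathcomp Require Import all_boot all_order all_algebra finmap.

Set Implicit Arguments.
Unset Strict Implicit.
Unset Printing Implicit Defensive.

(** * Scarf's lemma *)

(** Removing one element of a colliding pair does not change the image, so by cardinality [f] is
    injective on what remains; a second collision would survive the removal. *)
Lemma card_imset_pair (aT rT : finType) (f : aT -> rT) (A : {set aT}) :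
  #|A| = #|f @: A|.+1 ->
  exists a b, [/\ a \in A, b \in A, a != b, f a = f b &
    forall x y, x \in A -> y \in A -> x != y -> f x = f y ->
      (x, y) = (a, b) \/ (x, y) = (b, a)].
Proof.
move=> cA.
have /dinjectivePn [a aA [b /andP[/= ba bA] fab]] : ~~ dinjectiveb f (mem A).
  apply/negP => /dinjectiveP finj.
  by move: cA; rewrite (card_in_imset finj) => /eqP; rewrite eqn_leq ltnn andbF.
have inj (c d : aT) : c \in A -> d \in A -> c != d -> f c = f d -> {in A :\ c &, injective f}.
  move=> cA' dA cd fcd; apply/imset_injP.
  have -> : f @: (A :\ c) = f @: A.
    apply/setP => z; apply/imsetP/imsetP => [[x /setD1P[_ xA] ->]|[x xA ->]]; first by exists x.
    have [->|xc] := eqVneq x c; last by exists x; rewrite // !inE xc.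
    by exists d; rewrite // !inE eq_sym cd.
  by apply/eqP; move: cA; rewrite (cardsD1 c) cA' => -[].
exists a, b; split; rewrite // 1?eq_sym// => x y xA yA xy fxy.
have ab: a != b by rewrite eq_sym.
have no c d : c \in A -> d \in A -> c != d -> f c = f d -> x != c -> y != c -> False.
  move=> cA' dA cd fcd xc yc; have := inj c d cA' dA cd fcd x y.
  by rewrite !inE xA yA xc yc => /(_ isT isT fxy)/eqP; rewrite (negPf xy).
have nob := no b a bA aA ba (esym fab).
have [xa|xa] := eqVneq x a.
  have [yb|/nob nb] := eqVneq y b; first by left; rewrite xa yb.
  by case: nb; rewrite xa.
have [ya|ya] := eqVneq y a; last by case: (no a b aA bA ab fab).
have [xb|/nob nb] := eqVneq x b; first by right; rewrite xb ya.
by case: nb; rewrite ya.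
Qed.

Section Primitive.
Variables (U I : finType) (rk : I -> U -> nat).
Hypothesis rk_inj : forall i, injective (rk i).
Implicit Types (B C : {set U}) (x y b : U) (i k l : I).

(** Scarf's primitive sets: no point lies strictly above the minima of [B] for all the orders at
    once. *)
Definition dominant B :=
  [forall x, [exists i, [forall b in B, rk i x <= rk i b]]].

Lemma dominantP B :
  reflect (forall x, exists i, forall b, b \in B -> rk i x <= rk i b)
          (dominant B).
Proof.
apply: (iffP forallP) => [h x|h x].
  by have /existsP[i /forall_inP] := h x; exists i.
by have [i hi] := h x; apply/existsP; exists i; apply/forall_inP.
Qed.

Lemma dominantS B C : B \subset C -> dominant C -> dominant B.
Proof.
move=> sBC /dominantP h; apply/dominantP => x; have [i hi] := h x.
by exists i => b /(subsetP sBC)/hi.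
Qed.

Definition least B b0 i := [arg min_(b < b0 in B) rk i b].

Lemma leastP B b0 i : b0 \in B ->
  least B b0 i \in B /\ forall b, b \in B -> rk i (least B b0 i) <= rk i b.
Proof. by move=> b0B; rewrite /least; case: arg_minnP. Qed.

Lemma least_uniq B b0 i b : b0 \in B -> b \in B ->
  (forall b', b' \in B -> rk i b <= rk i b') -> least B b0 i = b.
Proof.
move=> /leastP-/(_ i) [lB lle] bB ble; apply: (@rk_inj i); apply/eqP.
by rewrite eqn_leq lle// ble.
Qed.

(** Dominance, tested on an element of [B] itself, gives an order for which this element is least. A
    dominant set thus has at most as many elements as there are orders. *)
Lemma dominant_surj B b0 : b0 \in B -> dominant B -> least B b0 @: setT = B.
Proof.
move=> b0B /dominantP h; apply/setP => b; apply/imsetP/idP => [[i _ ->]|bB].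
  by case: (leastP i b0B).
by have [i hi] := h b; exists i => //; rewrite (least_uniq b0B bB).
Qed.

(* A dominant set with one element less than there are orders has two orders
   [i], [j] with the same least element; it extends to a dominant set with one
   more element in exactly two ways, by the greatest element, for [i] or [j],
   of the points lying above its least elements for all the other orders. *)
Lemma dominant_two_extensions C c0 : dominant C -> #|I| = #|C|.+1 ->
  c0 \in C ->
  (forall i, exists x, forall k, k != i -> rk k c0 < rk k x) ->
  #|[set x | (x \notin C) && dominant (x |: C)]| = 2.
Proof.
move=> domC cI c0C above; have domP := dominantP _ domC.
pose m := least C c0; have mC l : m l \in C by case: (leastP l c0C).
have mle l b : b \in C -> rk l (m l) <= rk l b by case: (leastP l c0C) => _; apply.
have msurj : m @: setT = C by exact: dominant_surj.
have [|i [j [_ _ ij mij pairU]]] := @card_imset_pair _ _ m setT.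
  by rewrite msurj cardsT.
pose M k := [pred x | [forall l, (l != k) ==> (rk l (m l) < rk l x)]].
have MP k x : reflect (forall l, l != k -> rk l (m l) < rk l x) (x \in M k).
  by rewrite inE; apply: (iffP forall_inP).
have Mnon k : exists x, x \in M k.
  have [x hx] := above k; exists x; apply/MP => l lk.
  exact: leq_ltn_trans (mle _ _ c0C) (hx _ lk).
have topE k : exists2 x, x \in M k & forall y, y \in M k -> rk k y <= rk k x.
  have [x0 x0M] := Mnon k.
  by case: (@arg_maxnP _ x0 (mem (M k)) (rk k) x0M) => x xM xmax; exists x.
have [x xM xtop] := topE i; have [y yM ytop] := topE j.
have ext k t : k \in [:: i; j] -> t \in M k -> (forall y, y \in M k -> rk k y <= rk k t) ->
    (t \notin C) && dominant (t |: C).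
  move=> kij tM ttop; have /MP tgt := tM; apply/andP; split.
    apply/negP => tC; have : t \in m @: setT by rewrite msurj.
    case/imsetP=> l _ tl; have [lk|lk] := eqVneq l k; last first.
      by have := tgt l lk; rewrite tl ltnn.
    move: kij; rewrite !inE => /orP[] /eqP kE.
      by have := tgt j; rewrite tl lk kE mij ltnn eq_sym ij => /(_ isT).
    by have := tgt i; rewrite tl lk kE -mij ltnn ij => /(_ isT).
  apply/dominantP => z.
  have [zM|/MP zM] := boolP (z \in M k).
    exists k => b; rewrite !inE => /predU1P[->|bC]; first exact: ttop.
    apply: leq_trans (ttop _ zM) _; have [l hl] := domP t.
    have [lk|lk] := eqVneq l k; first by rewrite -lk hl.
    by have := tgt l lk; rewrite ltnNge hl.
  have {zM} [l lk zl] : exists2 l, l != k & rk l z <= rk l (m l).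
    apply/exists_inP; apply: contraT => /exists_inPn h; case: zM => l lk.
    by rewrite ltnNge h.
  exists l => b; rewrite !inE => /predU1P[->|bC]; apply: leq_trans zl _.
    exact: ltnW (tgt l lk).
  exact: mle.
(* A common element of [M i] and [M j] would lie strictly above the minima of [C] for every order,
   against [domC]. *)
have xy : x != y.
  apply/eqP => xy; have [l hl] := domP x; have := hl _ (mC l); rewrite leqNgt.
  have [lj|lj] := eqVneq l j; last by move: yM; rewrite -xy => /MP->.
  by move/MP: xM => ->//; rewrite lj eq_sym.
suff -> : [set x | (x \notin C) && dominant (x |: C)] = [set x; y] by rewrite cards2 xy.
apply/setP => t; rewrite !inE; apply/idP/idP; last first.
  by case/orP=> /eqP ->; [apply: (ext i)|apply: (ext j)]; rewrite // !inE eqxx ?orbT.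
(* Conversely, the minima of a dominant [t |: C] are distinct by cardinality. One of them is [t],
   for a single order [k], and the others are those of [C]; if [k] were neither [i] nor [j], these
   two orders would share their minimum. *)
case/andP=> tC domt; have c0t : c0 \in t |: C by rewrite !inE c0C orbT.
pose m' := least (t |: C) c0.
have m't l : m' l \in t |: C by case: (leastP l c0t).
have m'le l b : b \in t |: C -> rk l (m' l) <= rk l b by case: (leastP l c0t) => _; apply.
have m'surj : m' @: setT = t |: C by exact: dominant_surj.
have m'inj : injective m'.
  move=> a b e; suff /imset_injP inj : #|m' @: setT| == #|[set: I]| by apply: inj.
  by rewrite m'surj cardsT cI cardsU1 tC.
have /imsetP[k _ tk] : t \in m' @: setT by rewrite m'surj setU11.
have m'E l : l != k -> m' l = m l.
  move=> lk; have := m't l; rewrite !inE => /predU1P[m'l|m'lC].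
    by move: lk; rewrite (m'inj l k) ?eqxx// m'l tk.
  apply/esym; apply: least_uniq => // b bC.
  by apply: m'le; rewrite !inE bC orbT.
have tM : t \in M k.
  apply/MP => l lk; rewrite -m'E// ltn_neqAle m'le ?setU11// andbT.
  apply: contra lk => /eqP/(@rk_inj l) e; apply/eqP/m'inj; rewrite e; exact: tk.
have ttop z : z \in M k -> rk k z <= rk k t.
  move/MP => zM; have [l hl] := dominantP _ domt z.
  have [<-|lk] := eqVneq l k; first exact/hl/setU11.
  have := zM l lk; rewrite ltnNge hl//.
  by rewrite !inE mC orbT.
have kij : (k == i) || (k == j).
  apply: contraT; rewrite negb_or => /andP[ki kj].
  have := mij; rewrite -!m'E 1?eq_sym// => /m'inj e.
  by rewrite e eqxx in ij.
case/orP: kij => /eqP kE; subst k; apply/orP; [left|right]; apply/eqP.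
  by apply: (@rk_inj i); apply/eqP; rewrite eqn_leq xtop// ttop.
by apply: (@rk_inj j); apply/eqP; rewrite eqn_leq ytop// ttop.
Qed.

End Primitive.

Section Scarf.
Variables (T I : finType) (rk : I -> T -> nat) (col : T -> I) (x0 : T).
Hypothesis rk_inj : forall i, injective (rk i).

(* Every order [i] gets a slack element [inr i], below all the others for the
   order [i] and above all of [T] for the other orders. *)
Let U := (T + I)%type.
Let bound := (\max_i \max_x rk i x).+2.
Let urk i (u : U) : nat :=
  match u with
  | inl x => (rk i x).+1
  | inr k => if k == i then 0 else bound + enum_rank k
  end.
Let ucol (u : U) : I := match u with inl x => col x | inr k => k end.

Let rk_bound i x : (rk i x).+1 < bound.
Proof.
rewrite !ltnS; apply: leq_trans (leq_bigmax i).
exact: (@leq_bigmax _ (rk i) x).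
Qed.

Let urk_inj i : injective (urk i).
Proof.
move=> [x|k] [y|l] /=.
- by move=> [/rk_inj->].
- case: eqP => // _ e; have := rk_bound i x; rewrite e.
  by rewrite ltnNge leq_addr.
- case: eqP => // _ e; have := rk_bound i y; rewrite -e.
  by rewrite ltnNge leq_addr.
- case: eqP => [->|_]; case: eqP => [->|_] //; rewrite /bound ?addSn//.
  by move=> /eqP; rewrite !eqSS eqn_add2l => /eqP/ord_inj/enum_rank_inj->.
Qed.

(** Parity argument in the style of Sperner's lemma: a room that is not colorful has an even number
    of doors, while [slack] opens into one room and every other door into two. *)
Let room (B : {set U}) := dominant urk B && (#|B| == #|I|).
Let i0 := col x0.
Let door (C : {set U}) :=
  [&& dominant urk C, #|C|.+1 == #|I| & ucol @: C == [set~ i0]].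
Let slack : {set U} := [set inr i | i in [set~ i0]].
Let colorful (B : {set U}) := ucol @: B == setT.

Let card_I : #|[set~ i0]|.+1 = #|I|.
Proof. by rewrite cardsC1 prednK//; apply/card_gt0P; exists i0. Qed.

Let slack_door : door slack.
Proof.
apply/and3P; split.
- apply/dominantP => -[x|k].
    exists i0 => _ /imsetP[l li ->] /=; move: li; rewrite !inE => /negPf->.
    by apply: leq_trans (leq_addr _ _); exact/ltnW/rk_bound.
  by exists k => b _ /=; rewrite eqxx.
- by rewrite card_imset ?card_I// => a b [].
- by rewrite -imset_comp (eq_imset (g := id)) ?imset_id.
Qed.

Let slack_extensions : #|[set u | (u \notin slack) && dominant urk (u |: slack)]| = 1.
Proof.
have [x _ xtop] : exists2 x, true & forall y, rk i0 y <= rk i0 x.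
  by case: (@arg_maxnP _ x0 predT (rk i0) isT) => x _ h; exists x => // y; exact: h.
apply/eqP/cards1P; exists (inl x); apply/setP => -[y|k]; rewrite !inE.
- have -> /= : inl y \notin slack by apply/imsetP => -[].
  apply/dominantP/eqP => [h|[->]].
    have [l] := h (inl x); have [->|li] := eqVneq l i0.
      move=> /(_ (inl y)); rewrite setU11 => /(_ isT) /=; rewrite ltnS => xy.
      by congr inl; apply: (@rk_inj i0); apply/eqP; rewrite eqn_leq xtop.
    move=> /(_ (inr l)); rewrite !inE /= imset_f ?inE// => /(_ isT).
    by rewrite /= eqxx.
  case=> [z|k]; last by exists k => b _ /=; rewrite eqxx.
  exists i0 => b; rewrite !inE => /predU1P[->|/imsetP[l li ->]] /=.
    by rewrite ltnS xtop.
  move: li; rewrite !inE => /negPf->.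
  by apply: leq_trans (leq_addr _ _); exact/ltnW/rk_bound.
- apply/negP => /andP[kn /dominantP/(_ (inl x))[l hl]].
  have ki : k = i0.
    by apply/eqP; apply: contraNT kn => ki; apply/imsetP; exists k; rewrite ?inE.
  have : inr l \in inr k |: slack.
    rewrite inE; have [li|li] := eqVneq l i0; first by rewrite li ki inE eqxx.
    by apply/orP; right; apply/imsetP; exists l; rewrite ?inE.
  by move=> /hl /=; rewrite eqxx.
Qed.

(** Apart from [slack], a door contains some [inl x], and the slack element [inr i] lies above it
    for all orders but [i]: this is the room that [dominant_two_extensions] needs. *)
Let door_extensions C : door C -> C != slack ->
  #|[set u | (u \notin C) && dominant urk (u |: C)]| = 2.
Proof.
case/and3P=> domC /eqP cC /eqP colC Cs.
have [x xC] : exists x, inl x \in C.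
  apply/existsP; apply: contraNT Cs => /existsPn Cn; apply/eqP/setP => -[x|k].
    by rewrite (negPf (Cn x)); apply/esym/imsetP => -[].
  rewrite mem_imset ?inE; last by move=> a b [].
  apply/idP/idP => [kC|ki].
    have : k \in [set~ i0] by rewrite -colC; apply/imsetP; exists (inr k).
    by rewrite !inE.
  have : k \in ucol @: C by rewrite colC !inE.
  by case/imsetP=> -[y|l] uC ->//; have := Cn y; rewrite uC.
apply: (dominant_two_extensions urk_inj domC _ xC); first by rewrite cC.
move=> i; exists (inr i) => k ki /=; rewrite eq_sym (negPf ki).
by apply: leq_trans (leq_addr _ _); exact/rk_bound.
Qed.

(** If there is a door at all, only [i0] is missing from the colours of [B] and exactly one colour
    is repeated, once; the doors arise by removing either of its two bearers. *)
Let room_doors B : room B -> ~~ colorful B ->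
  ~~ odd #|[set u in B | door (B :\ u)]|.
Proof.
case/andP=> domB /eqP cB ncol.
have [->|[u0]] := set_0Vmem [set u in B | door (B :\ u)]; first by rewrite cards0.
rewrite inE => /andP[u0B /and3P[_ _ /eqP colB0]].
have colB : ucol @: B = [set~ i0].
  apply/setP => i; apply/idP/idP => [iB|]; last first.
    by rewrite -colB0; apply: (subsetP (imsetS _ _)); exact: subD1set.
  rewrite !inE; apply: contra ncol => /eqP ii0; rewrite /colorful eqEsubset subsetT /=.
  apply/subsetP => l _; have [->|li0] := eqVneq l i0; first by rewrite -ii0.
  have : l \in ucol @: (B :\ u0) by rewrite colB0 !inE.
  by apply: (subsetP (imsetS _ _)); exact: subD1set.
have [|a [b [aB bB ab cab pairU]]] := @card_imset_pair _ _ ucol B.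
  by rewrite colB card_I.
suff -> : [set u in B | door (B :\ u)] = [set a; b] by rewrite cards2 ab.
have rem (c d : U) : c \in B -> d \in B -> c != d -> ucol c = ucol d -> door (B :\ c).
  move=> cBB dB cd ccd; apply/and3P; split.
  - by apply: dominantS domB; exact: subD1set.
  - by rewrite -cB [X in _ == X](cardsD1 c) cBB add1n.
  - rewrite -colB; apply/eqP/setP => i; apply/imsetP/imsetP.
      by case=> u /setD1P[_ uB] ->; exists u.
    case=> u uB ->; have [->|uc] := eqVneq u c; last by exists u; rewrite // !inE uc.
    by exists d; rewrite // !inE eq_sym cd.
apply/setP => u; rewrite !inE; apply/idP/idP => [/andP[uB /and3P[_ /eqP cu /eqP colu]]|].
  apply: contraT; rewrite negb_or => /andP[ua ub].
  have : {in B :\ u &, injective ucol}.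
    apply/imset_injP; rewrite colu; apply/eqP/succn_inj.
    by rewrite card_I cu.
  move=> /(_ a b); rewrite !inE aB bB eq_sym ua eq_sym ub => /(_ isT isT cab)/eqP.
  by rewrite (negPf ab).
case/orP=> /eqP ->; first by rewrite aB (rem a b).
by rewrite bB (rem b a)// eq_sym.
Qed.

(** Incidences between rooms and doors are counted from both sides, with [B = u |: C]. *)
Let pair_swap :
  \sum_(B | room B) #|[set u in B | door (B :\ u)]| =
  \sum_(C | door C) #|[set u | (u \notin C) && dominant urk (u |: C)]|.
Proof.
under eq_bigr do rewrite -sum1dep_card.
under [RHS]eq_bigr do rewrite -sum1dep_card.
rewrite (exchange_big_dep predT)//= [RHS](exchange_big_dep predT)//=.
apply: eq_bigr => u _.
rewrite (reindex_onto (fun C => u |: C) (fun B => B :\ u)); last first.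
  by move=> B /and3P[_ uB _]; exact: setD1K.
apply: eq_bigl => C; rewrite /room /door setU11 /=.
have [uC|uC] := boolP (u \in C).
  by rewrite /= !andbF; apply/negP => /andP[_ /eqP e]; rewrite -e !inE eqxx in uC.
rewrite setU1K// eqxx andbT /= cardsU1 uC add1n.
have [domUC|] := boolP (dominant _ (u |: C)); last by rewrite !andbF.
rewrite (dominantS _ domUC) ?subsetUr//= andbT.
by case: eqP.
Qed.

Let colorful_room : exists2 B, room B & colorful B.
Proof.
apply/exists_inP; apply: contraT => /exists_inPn nocol.
have : odd (\sum_(C | door C) #|[set u | (u \notin C) && dominant urk (u |: C)]|).
  rewrite (bigD1 slack)//= slack_extensions oddD /=.
  rewrite (big_morph odd oddD (erefl : odd 0 = false)).
  by rewrite big1// => C /andP[dC Cs]; rewrite door_extensions.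
rewrite -pair_swap (big_morph odd oddD (erefl : odd 0 = false)) big1// => B rB.
by apply/negbTE/room_doors; rewrite ?nocol.
Qed.

Theorem scarf_lemma : exists (A : {set T}) (D : {set I}),
  (forall x, exists2 i, i \in D & forall a, a \in A -> rk i x <= rk i a) /\
  (forall i, i \in D -> exists2 a, a \in A & col a = i).
Proof.
have [B /andP[/dominantP domB _] /eqP colB] := colorful_room.
(* When [inr i] is in [B], its rank 0 for the order [i] lies below every [inl x], so dominance of
   the room always selects an order in [D]. A colour in [D] is borne by no slack element of [B],
   hence by an element of [T]. *)
exists [set x | inl x \in B], [set i | inr i \notin B]; split=> [x|i].
  have [i hi] := domB (inl x); exists i; last by move=> a; rewrite inE => /hi.
  by rewrite inE; apply: contraTN isT => /hi; rewrite /= eqxx.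
rewrite inE => iB; have : i \in ucol @: B by rewrite colB.
case/imsetP=> -[a|k] uB iE; first by exists a; rewrite ?inE.
by move: iB; rewrite iE /= uB.
Qed.

End Scarf.

From mathcomp Require Import all_classical all_reals.
From mathcomp Require Import topology normedtype derive ring lra.

Import Order.TTheory GRing.Theory Num.Theory.
Import numFieldNormedType.Exports.
(* [edist] has to be the distance of [Defs], not the one of the library. *)
Import Defs.

Local Open Scope fset_scope.
Local Open Scope ring_scope.

(** * The metric of barycentric coordinates *)

Section BaryDist.
Context {R : realType} {V : choiceType}.
Implicit Types (x y z : bary_point R V) (s t : {fset V}).

Lemma bary_out x v : v \notin finsupp x -> x v = 0.
Proof. exact: fsfun_dflt. Qed.

Lemma sum_finsuppE s x : finsupp x `<=` s ->
  \sum_(v <- finsupp x) x v = \sum_(v <- s) x v.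
Proof.
by move=> xs; apply: big_fset_incl => // v vs /bary_out.
Qed.

Lemma bary_distE s x y : finsupp x `<=` s -> finsupp y `<=` s ->
  bary_dist x y = \sum_(v <- s) `|x v - y v|.
Proof.
move=> xs ys; apply: big_fset_incl; first by rewrite fsubUset xs.
move=> v _; rewrite inE negb_or => /andP[/bary_out-> /bary_out->].
by rewrite subrr normr0.
Qed.

Lemma bary_dist_ge0 x y : 0 <= bary_dist x y.
Proof. exact: sumr_ge0. Qed.

Lemma bary_distxx x : bary_dist x x = 0.
Proof. by rewrite /bary_dist big1// => v _; rewrite subrr normr0. Qed.

Lemma bary_distC x y : bary_dist x y = bary_dist y x.
Proof.
by rewrite /bary_dist fsetUC; apply: eq_bigr => v _; rewrite distrC.
Qed.

Lemma bary_dist_triangle x y z :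
  bary_dist x z <= bary_dist x y + bary_dist y z.
Proof.
pose s := finsupp x `|` (finsupp y `|` finsupp z).
have xs : finsupp x `<=` s by exact: fsubsetUl.
have ys : finsupp y `<=` s by rewrite /s fsetUCA; exact: fsubsetUl.
have zs : finsupp z `<=` s by rewrite /s fsetUA; exact: fsubsetUr.
rewrite !(bary_distE (s := s))// -big_split /=; apply: ler_sum => v _.
by rewrite -[x v - z v](subrKA (y v)) ler_normD.
Qed.

Lemma bary_dist_coord x y v : `|x v - y v| <= bary_dist x y.
Proof.
have [|vn] := boolP (v \in finsupp x `|` finsupp y).
  by move=> vs; rewrite /bary_dist (big_fsetD1 v vs)/= lerDl sumr_ge0.
move: vn; rewrite inE negb_or => /andP[/bary_out-> /bary_out->].
by rewrite subrr normr0 bary_dist_ge0.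
Qed.

Lemma bary_dist_eq0 x y : bary_dist x y = 0 -> x = y.
Proof.
move=> xy; apply/fsfunP => v; apply/eqP; rewrite -subr_eq0 -normr_le0.
by rewrite -[leRHS]xy bary_dist_coord.
Qed.

Lemma bary_dist_le_card s x y e : finsupp x `<=` s -> finsupp y `<=` s ->
  (forall v, v \in s -> `|x v - y v| <= e) -> bary_dist x y <= #|` s|%:R * e.
Proof.
move=> xs ys le; rewrite (bary_distE xs ys) mulr_natl.
rewrite cardfE -sumr_const big_seq_fsetE /=.
by apply: ler_sum => v _; apply: le.
Qed.

(** Open stars are open for [bary_dist]: a coordinate cannot vanish within a distance smaller than
    its absolute value. *)
Lemma finsupp_near x : exists2 r, 0 < r &
  forall y, bary_dist x y < r -> finsupp x `<=` finsupp y.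
Proof.
suff [r r0 hr] : exists2 r : R, 0 < r & forall v, v \in finsupp x -> r <= `|x v|.
  exists r => // y xy; apply/fsubsetP => v /hr rx.
  rewrite mem_finsupp; apply: contraTN xy => /eqP yv; rewrite -leNgt.
  by apply: le_trans rx _; have := bary_dist_coord x y v; rewrite yv subr0.
suff H (l : seq V) : (forall v, v \in l -> 0 < `|x v|) ->
    exists2 r : R, 0 < r & forall v, v \in l -> r <= `|x v|.
  by apply: H => v; rewrite mem_finsupp normr_gt0.
elim: l => [|v l IH] h; first by exists 1.
have [r r0 hr] := IH (fun w wl => h w (mem_behead (wl : w \in behead (v :: l)))).
exists (Num.min r `|x v|); first by rewrite lt_min r0 h ?mem_head.
by move=> w; rewrite inE ge_min => /predU1P[->|/hr->//]; rewrite lexx orbT.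
Qed.

Definition bary_seg (t : R) x y : bary_point R V :=
  [fsfun v in finsupp x `|` finsupp y => (1 - t) * x v + t * y v].

Lemma bary_segE (t : R) x y v : bary_seg t x y v = (1 - t) * x v + t * y v.
Proof.
rewrite fsfunE; case: ifPn => //; rewrite inE negb_or.
by move=> /andP[/bary_out-> /bary_out->]; rewrite !mulr0 addr0.
Qed.

Lemma bary_seg0 x y : bary_seg 0 x y = x.
Proof. by apply/fsfunP => v; rewrite bary_segE subr0 mul1r mul0r addr0. Qed.

Lemma bary_seg1 x y : bary_seg 1 x y = y.
Proof. by apply/fsfunP => v; rewrite bary_segE subrr mul1r mul0r add0r. Qed.

Lemma finsupp_bary_seg (t : R) x y : finsupp (bary_seg t x y) `<=` finsupp x `|` finsupp y.
Proof.
apply/fsubsetP => v; rewrite mem_finsupp bary_segE; apply: contra_neqT.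
rewrite inE negb_or => /andP[/bary_out-> /bary_out->].
by rewrite !mulr0 addr0.
Qed.

Lemma bary_dist_seg (t u : R) x y :
  bary_dist (bary_seg t x y) (bary_seg u x y) = `|t - u| * bary_dist x y.
Proof.
rewrite !(bary_distE (s := finsupp x `|` finsupp y)) ?finsupp_bary_seg ?fsubsetUl ?fsubsetUr//.
rewrite mulr_sumr; apply: eq_bigr => v _; rewrite !bary_segE -normrM -normrN.
by congr `|_|; ring.
Qed.

End BaryDist.

Section ClosedSimplex.
Context {R : realType} {V : choiceType} (K : simplicial_complex V).
Implicit Types (x y z : bary_point R V) (s t : {fset V}).

Definition open_star (t : {fset V}) : set (bary_point R V) :=
  [set x | (t `<=` finsupp x)%fset]%classic.

Definition simplex_boundary s : set (bary_point R V) :=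
  [set x | closed_simplex K s x /\ finsupp x != s]%classic.

Lemma closed_simplexP s x : K s -> closed_simplex K s x <->
  [/\ finsupp x `<=` s, forall v, 0 <= x v & \sum_(v <- s) x v = 1].
Proof.
move=> Ks; split=> [[[_ x0 x1] xs]|[xs x0 x1]].
  by split=> //; rewrite -(sum_finsuppE xs).
have x1' : \sum_(v <- finsupp x) x v = 1 by rewrite (sum_finsuppE xs).
split=> //; split=> //; apply: simplex_face Ks xs _.
apply/eqP => x_0; move: x1'; rewrite x_0 big_seq_fset0 => /eqP.
by rewrite eq_sym oner_eq0.
Qed.

Lemma realization_le1 x v : realization K x -> x v <= 1.
Proof.
move=> [_ x0 <-]; have [vx|/bary_out->] := boolP (v \in finsupp x).
  by rewrite (big_fsetD1 v vx)/= lerDl sumr_ge0.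
exact: sumr_ge0.
Qed.

Lemma closed_simplex_seg s x y (t : R) : K s -> closed_simplex K s x ->
  closed_simplex K s y -> 0 <= t <= 1 -> closed_simplex K s (bary_seg t x y).
Proof.
move=> Ks /(closed_simplexP _ Ks)[xs x0 x1] /(closed_simplexP _ Ks)[ys y0 y1] /andP[t0 t1].
apply/(closed_simplexP _ Ks); split.
- by apply: fsubset_trans (finsupp_bary_seg _ _ _) _; rewrite fsubUset xs.
- by move=> v; rewrite bary_segE addr_ge0// mulr_ge0// subr_ge0.
- under eq_bigr do rewrite bary_segE.
  by rewrite big_split/= -!mulr_sumr x1 y1; ring.
Qed.

Definition bary_vertex (v : V) : bary_point R V := [fsfun w in [fset v] => 1].

Lemma bary_vertexE v w : bary_vertex v w = (w == v)%:R.
Proof. by rewrite fsfunE inE; case: eqP. Qed.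

Lemma finsupp_vertex v : finsupp (bary_vertex v) = [fset v].
Proof.
apply/fsetP => w; rewrite mem_finsupp bary_vertexE inE.
by rewrite pnatr_eq0 eqb0 negbK.
Qed.

Lemma closed_simplex_vertex v s : K s -> v \in s -> closed_simplex K s (bary_vertex v).
Proof.
move=> Ks vs; apply/(closed_simplexP _ Ks); split.
- by rewrite finsupp_vertex fsub1set.
- by move=> w; rewrite bary_vertexE.
- rewrite (big_fsetD1 v vs)/= bary_vertexE eqxx big1_fset ?addr0// => w.
  by rewrite !inE bary_vertexE => /andP[/negPf->].
Qed.

Lemma realization_vertex v : realization K (bary_vertex v).
Proof.
by case: (closed_simplex_vertex (simplex_vertex K v) (fset11 v)).
Qed.

End ClosedSimplex.

(** The extreme value theorem, applied to row vectors of coordinates, gives a minimum. The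
    compactness arguments that follow go through this bound. *)
Lemma bary_Lipschitz_pos (R : realType) (V : choiceType) (K : simplicial_complex V)
    (s : {fset V}) (F : bary_point R V -> R) : K s ->
  (forall x, closed_simplex K s x -> 0 < F x) ->
  (forall x y, closed_simplex K s x -> closed_simplex K s y ->
     F x - F y <= bary_dist x y) ->
  exists2 r, 0 < r & forall x, closed_simplex K s x -> r <= F x.
Proof.
move=> Ks F0 FL; pose n := #|` s|.
pose P (v : 'rV[R]_n) : bary_point R V :=
  [fsfun w : s => v 0 (cast_ord (esym (cardfE s)) (enum_rank w))].
pose N (x : bary_point R V) : 'rV[R]_n :=
  \row_i x (val (enum_val (cast_ord (cardfE s) i))).
have NK x : closed_simplex K s x -> P (N x) = x.
  move=> [_ xs]; apply/fsfunP => v; rewrite fsfun_ffun; case: insubP => [w _ <-|vs].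
    by rewrite /= mxE cast_ordKV enum_rankK.
  by rewrite [RHS]bary_out//; apply: contra vs; exact: fsubsetP.
have PE v (w : s) : P v (val w) = v 0 (cast_ord (esym (cardfE s)) (enum_rank w)).
  by rewrite fsfun_ffun; case: insubP => [u _ /val_inj->//|]; rewrite (valP w).
have Ps v : finsupp (P v) `<=` s by exact: finsupp_sub.
have Psum (f : V -> R -> R) v : \sum_(w <- s) f w (P v w) =
    \sum_i f (val (enum_val (cast_ord (cardfE s) i))) (v 0 i).
  rewrite big_seq_fsetE/= (reindex (fun i : 'I_n => enum_val (cast_ord (cardfE s) i)))/=.
    apply: eq_bigr => i _; rewrite PE enum_valK; congr (f _ (v _ _)).
    exact: val_inj.
  exists (fun w => cast_ord (esym (cardfE s)) (enum_rank w)) => i _.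
    by rewrite enum_valK cast_ordK.
  by rewrite cast_ordKV enum_rankK.
pose A := [set v | closed_simplex K s (P v)]%classic.
have [A0|/set0P A0] := eqVneq A set0.
  exists 1 => // x cx; have : A (N x) by rewrite /A/= NK.
  by rewrite A0.
have PL v w : bary_dist (P v) (P w) <= n%:R * `|v - w|.
  apply: (bary_dist_le_card (Ps v) (Ps w)) => u us.
  have -> : u = val (FSetSub us) by [].
  rewrite !PE; set i := cast_ord _ _.
  rewrite [leRHS]/Num.norm/= mx_normrE.
  apply/bigmax_geP; right; exists (0, i) => //=.
  by rewrite !mxE.
have cA : compact A.
  apply: (@subclosed_compact _ _ [set v : 'rV[R]_n | forall i, (`[0, 1]%classic : set R) (v
    ord0 i)]%classic).
  - have -> : A = ([set v | forall i, 0 <= v 0 i] `&` [set v | \sum_i v 0 i = 1])%classic.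
      apply/seteqP; split=> v.
        move=> /(closed_simplexP _ Ks)[_ v0]; rewrite (Psum (fun _ => id)) => v1.
        by split=> // i; have := v0 (val (enum_val (cast_ord (cardfE s) i)));
          rewrite PE enum_valK cast_ordK.
      move=> [v0 v1]; apply/(closed_simplexP _ Ks); split=> //.
        move=> w; have [ws|ws] := boolP (w \in s); last first.
          by rewrite bary_out//; apply: contra ws; exact: fsubsetP.
        have -> : w = val (FSetSub ws) by [].
        by rewrite PE.
      by rewrite (Psum (fun _ => id)).
    apply: closedI.
      rewrite [X in closed X](_ : _ = \bigcap_(i in setT) (fun v : 'rV[R]_n => v 0 i) @^-1`
        [set x | 0 <= x])%classic; last first.
        by apply/seteqP; split=> [v h i _|v h i]; [exact: h|exact: (h i I)].
      apply: closed_bigI => i _; apply: preimage_closed; last exact: closed_ge.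
      by move=> v _; exact: coord_continuous.
    apply: (@preimage_closed _ _ (fun v : 'rV[R]_n => \sum_i v 0 i) [set x | x =
      1])%classic; last exact: closed_eq.
    move=> v _; apply: (continuous_big (op := +%R)); first exact: add_continuous.
    by move=> i _; exact: coord_continuous.
  - apply: (@rV_compact R _ (fun=> (`[0, 1]%classic : set R))) => _; exact: segment_compact.
  - move=> v Av i; have /(closed_simplexP _ Ks)[_ v0 v1] := Av.
    rewrite /= in_itv/=; have := v0 (val (enum_val (cast_ord (cardfE s) i))).
    have := realization_le1 (val (enum_val (cast_ord (cardfE s) i))) (proj1 Av).
    by rewrite PE enum_valK cast_ordK => -> ->.
have [|c cA' cmin] := EVT_min_rV A0 cA (f := F \o P).
  apply/subspace_continuousP => v Av; apply/cvgrPdist_lt => e e0.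
  have FPE w : A w -> `|F (P v) - F (P w)| <= n%:R * `|v - w|.
    move=> Aw; rewrite ler_norml lerNl opprB; apply/andP; split.
      by apply: le_trans (FL _ _ Aw Av) _; rewrite bary_distC.
    exact: le_trans (FL _ _ Av Aw) _.
  have e1 : 0 < e / n.+1%:R by rewrite divr_gt0.
  have /cvgrPdist_lt/(_ _ e1) : (id @ within A (nbhs v) --> v)%classic by exact: cvg_within.
  move=> near_v; have AA : \forall w \near within A (nbhs v), A w by exact: withinT.
  near=> w; apply: le_lt_trans (FPE _ _) _; first by near: w.
  apply: (@le_lt_trans _ _ (n.+1%:R * `|v - w|)); first by rewrite ler_wpM2r// ler_nat.
  by rewrite mulrC -ltr_pdivlMr//; near: w.
rewrite inE in cA'.
exists (F (P c)); first exact: F0.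
move=> x cx; rewrite -(NK x cx); apply: cmin; rewrite inE/= /A/=.
by rewrite NK.
Unshelve. all: by end_near. Qed.

(** * Compactness and Brouwer's theorem *)

Section Compactness.
Context {R : realType} {V : choiceType} (K : simplicial_complex V).
Variable s : {fset V}.
Hypothesis Ks : K s.
Implicit Types (x y z : bary_point R V).

(** The function [sup (E x)] is positive and 1-Lipschitz in [x] even if [r] is not continuous, so it
    is bounded below; truncating [r] at 1 keeps the supremum finite. *)
Lemma lebesgue_number (r : bary_point R V -> R) :
  (forall y, closed_simplex K s y -> 0 < r y) ->
  exists2 rho, 0 < rho & forall x, closed_simplex K s x ->
    exists2 y, closed_simplex K s y & bary_dist x y + rho < r y.
Proof.
move=> r0.
pose E x := [set z | exists2 y, closed_simplex K s y & z = Num.min (r y) 1 - bary_dist x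
  y]%classic.
have Esup x : closed_simplex K s x -> has_sup (E x).
  move=> cx; split; first by exists (Num.min (r x) 1 - bary_dist x x), x.
  exists 1 => _ [y cy ->]; rewrite lerBlDr (le_trans _ (_ : 1 <= _))//.
    by rewrite ge_min lexx orbT.
  by rewrite lerDl bary_dist_ge0.
have [x cx||rho rho0 hrho] := @bary_Lipschitz_pos _ _ K s (fun x => sup (E x)) Ks.
- apply: (@lt_le_trans _ _ (Num.min (r x) 1)); first by rewrite lt_min r0//=.
  have [_ ub] := Esup x cx; apply: sup_ubound => //; exists x => //.
  by rewrite bary_distxx subr0.
- move=> x y cx cy; rewrite lerBlDr; apply: sup_le_ub; first by case: (Esup x cx).
  move=> _ [z cz ->]; rewrite lerBlDr.
  have : Num.min (r z) 1 - bary_dist y z <= sup (E y).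
    by have [_ ub] := Esup y cy; apply: sup_ubound => //; exists z.
  have := bary_dist_triangle y x z; rewrite (bary_distC y x); lra.
exists (rho / 2) => [|x cx]; first by rewrite divr_gt0.
have [_ [y cy ->] lt] := sup_adherent (divr_gt0 rho0 (ltr0n _ 2)) (Esup x cx).
exists y => //; have := hrho x cx.
have : Num.min (r y) 1 <= r y by rewrite ge_min lexx.
by move: lt; lra.
Qed.

Lemma bary_metric_on (X : set (bary_point R V)) : is_metric_on X bary_dist.
Proof.
split=> [x y _ _|x y _ _|x y _ _|x y z _ _ _].
- exact: bary_dist_ge0.
- by split=> [/bary_dist_eq0//|->]; exact: bary_distxx.
- exact: bary_distC.
- exact: bary_dist_triangle.
Qed.

Lemma unif_continuous_on (U : Type) (Y : set U) (dU : U -> U -> R)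
    (f : bary_point R V -> U) :
  is_metric_on Y dU -> (forall x, closed_simplex K s x -> Y (f x)) ->
  continuous_on (closed_simplex K s) bary_dist dU f ->
  forall e, 0 < e -> exists2 rho, 0 < rho & forall x y,
    closed_simplex K s x -> closed_simplex K s y -> bary_dist x y < rho ->
    dU (f x) (f y) < e.
Proof.
move=> mY fY cf e e0.
have /choice[r hr] (y : bary_point R V) : exists r : R, closed_simplex K s y ->
    0 < r /\ forall x, closed_simplex K s x -> bary_dist y x < r -> dU (f y) (f x) < e / 2.
  have [cy|ncy] := pselect (closed_simplex K s y); last by exists 0.
  by have [|r r0 h] := cf y cy (e / 2); [lra|exists r].
have [y cy|rho rho0 hrho] := lebesgue_number (r := r); first by case: (hr y cy).
exists rho => // x y cx cy xy; have [z cz xz] := hrho x cx; have [_ h] := hr z cz.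
have zx : dU (f z) (f x) < e / 2 by apply: h => //; rewrite bary_distC; lra.
have zy : dU (f z) (f y) < e / 2.
  apply: h => //; have := bary_dist_triangle z x y; rewrite (bary_distC z x); lra.
apply: le_lt_trans (metric_on_triangle mY (fY _ cx) (fY _ cz) (fY _ cy)) _.
rewrite (metric_on_sym mY (fY _ cx) (fY _ cz)); lra.
Qed.

(** Around [z], the radius [r z] is such that a point within [r z] for [bary_dist] is within
    [r' / 2] for [d]. A further [d]-step shorter than [r' / 2] stays in the [d]-ball of radius [r'],
    which has [bary_dist] radius [e / 2]. *)
Lemma unif_continuous_id (d : bary_point R V -> bary_point R V -> R) :
  is_metric_on (closed_simplex K s) d ->
  continuous_on (closed_simplex K s) bary_dist d id ->
  continuous_on (closed_simplex K s) d bary_dist id ->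
  forall e, 0 < e -> exists2 rho, 0 < rho & forall x y,
    closed_simplex K s x -> closed_simplex K s y -> d x y < rho ->
    bary_dist x y < e.
Proof.
move=> md cd cb e e0.
have /choice[r hr] (y : bary_point R V) : exists r : R, closed_simplex K s y ->
    [/\ 0 < r, r <= e / 2 & exists r', [/\ 0 < r', 2 * r <= r',
      (forall x, closed_simplex K s x -> bary_dist y x < r -> d y x < r' / 2) &
      forall x, closed_simplex K s x -> d y x < r' -> bary_dist y x < e / 2]].
  have [cy|ncy] := pselect (closed_simplex K s y); last by exists 0.
  have [|r' r'0 hr'] := cb y cy (e / 2); first lra.
  have [|r r0 hr] := cd y cy (r' / 2); first lra.
  exists (Num.min r (Num.min (e / 2) (r' / 2))) => _; split.
  - by rewrite !lt_min r0/=; apply/andP; split; lra.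
  - by rewrite !ge_min lexx !orbT.
  exists r'; split=> //.
  - have : Num.min r (Num.min (e / 2) (r' / 2)) <= r' / 2 by rewrite !ge_min lexx !orbT.
    lra.
  - by move=> x cx; rewrite !lt_min => /andP[yx _]; exact: hr.
have [y cy|rho rho0 hrho] := lebesgue_number (r := r); first by case: (hr y cy).
exists rho => // x y cx cy xy; have [z cz xz] := hrho x cx.
have [rz0 rze [r' [r'0 rr' h1 h2]]] := hr z cz.
have zx : bary_dist z x < r z by rewrite bary_distC; lra.
have dzx := h1 x cx zx.
have zy : bary_dist z y < e / 2.
  apply: h2 => //; have := metric_on_triangle md cz cx cy.
  have := bary_dist_ge0 x z; lra.
have := bary_dist_triangle x z y; rewrite (bary_distC x z); lra.
Qed.

End Compactness.

(** * Maps close to the identity reach interior points *)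

Section GridBrouwer.
Context {R : realType} {V : choiceType} (K : simplicial_complex V).
Variable s : {fset V}.
Hypothesis Ks : K s.
Variables (g : bary_point R V -> bary_point R V) (q : bary_point R V) (eta : R).
Hypotheses (gs : forall x, closed_simplex K s x -> closed_simplex K s (g x))
  (cq : closed_simplex K s q) (eta0 : 0 < eta)
  (g_eta : forall x, closed_simplex K s x -> bary_dist (g x) x <= eta)
  (q_eta : forall v, v \in s -> 2 * eta <= q v).

Let n := #|` s|.

Let n0 : (0 < n)%N.
Proof. by rewrite cardfs_gt0; exact: simplex_neq0 Ks. Qed.

(* Scarf's lemma on the grid of mesh [1 / N], the colour of [x] being a vertex
   [v] with [g x v <= q v]. *)
Lemma bary_surj_approx (rho e : R) : 0 < rho -> 0 < e ->
  (forall x y, closed_simplex K s x -> closed_simplex K s y ->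
     bary_dist x y < rho -> bary_dist (g x) (g y) < e) ->
  exists2 x, closed_simplex K s x & bary_dist (g x) q <= 2 * n%:R * e.
Proof.
move=> rho0 e0 gcont.
have nR0 : 0 < n%:R :> R by rewrite ltr0n.
have [N [N0 Nrho Neta]] : exists N : nat,
    [/\ (0 < N)%N, n%:R * (n%:R / N%:R) < rho & n%:R / N%:R <= eta].
  pose b := Num.min (rho / (n%:R * 2)) eta.
  have b0 : 0 < b by rewrite lt_min eta0 divr_gt0// mulr_gt0.
  have [N hN] : exists N : nat, n%:R / b < N%:R.
    by exists (Num.bound (n%:R / b)); apply: archi_boundP; rewrite divr_ge0 ?ltW.
  have N0 : 0 < N%:R :> R by apply: lt_trans hN; rewrite divr_gt0.
  have nNb : n%:R / N%:R < b by move: hN; rewrite !ltr_pdivrMr// mulrC.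
  exists N; split; first by rewrite -(ltr0n R).
    apply: (@lt_trans _ _ (n%:R * b)); first by rewrite ltr_pM2l.
    apply: (@le_lt_trans _ _ (n%:R * (rho / (n%:R * 2)))).
      by rewrite ler_pM2l// ge_min lexx.
    rewrite (_ : _ * _ = rho / 2); last by field; rewrite lt0r_neq0.
    lra.
  by apply: (le_trans (ltW nNb)); rewrite ge_min lexx orbT.
have NR0 : 0 < N%:R :> R by rewrite ltr0n.
pose tot (x : {ffun s -> 'I_N.+1}) := (\sum_i (x i : nat))%N == N.
pose T := {x : {ffun s -> 'I_N.+1} | tot x}.
pose pt (x : T) : bary_point R V := [fsfun w : s => (val x w : nat)%:R / N%:R].
have ptE x (w : s) : pt x (val w) = (val x w : nat)%:R / N%:R.
  by rewrite fsfun_ffun; case: insubP => [u _ /val_inj->//|]; rewrite (valP w).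
have pts x : closed_simplex K s (pt x).
  apply/(closed_simplexP _ Ks); split; first exact: finsupp_sub.
    move=> v; have [vs|vs] := boolP (v \in s).
      by rewrite -[v]/(val (FSetSub vs)) ptE divr_ge0.
    by rewrite bary_out//; apply: contra vs; exact/fsubsetP/finsupp_sub.
  rewrite big_seq_fsetE/=; under eq_bigr do rewrite ptE.
  by rewrite -mulr_suml -natr_sum (eqP (valP x)) divff// lt0r_neq0.
have sumE x : closed_simplex K s x -> \sum_(i : s) x (val i) = 1.
  by move=> /(closed_simplexP _ Ks)[_ _ <-]; rewrite big_seq_fsetE.
have /choice[col hcol] (x : T) : exists i : s, g (pt x) (val i) <= q (val i).
  apply: contrapT => /forallNP h.
  have [i0 i0s] : exists i0, i0 \in s by apply/fset0Pn; exact: simplex_neq0 Ks.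
  have : \sum_(i : s) q (val i) < \sum_(i : s) g (pt x) (val i).
    apply: ltr_sum => [|i _]; last by rewrite ltNge; apply/negP/h.
    by apply/hasP; exists (FSetSub i0s); rewrite ?mem_index_enum.
  by rewrite !sumE ?ltxx//; exact: gs.
(* Coordinates are compared first and ties are broken by the rank in [T], which makes each order
   strict. *)
pose rk (i : s) (x : T) := (val x i * #|{: T}| + enum_rank x)%N.
have rkE i x y : (rk i x <= rk i y)%N -> (val x i <= val y i)%N.
  rewrite /rk; apply: contraTT; rewrite -!ltnNge => lt.
  apply: (@leq_trans ((val y i).+1 * #|{: T}|)).
    by rewrite mulSn addnC ltn_add2r.
  by apply: leq_trans (leq_addr _ _); exact: leq_mul.
have rk_inj i : injective (rk i).
  move=> x y e'; have /eqP xy : (val x i == val y i :> nat).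
    by rewrite eqn_leq !rkE ?e'.
  by move: e'; rewrite /rk xy => /addnI/ord_inj/enum_rank_inj.
have [i1 i1s] : exists i1, i1 \in s by apply/fset0Pn; exact: simplex_neq0 Ks.
have x0P : (\sum_(i : s) ([ffun i : s => if i == FSetSub i1s then ord_max else ord0] :
  {ffun s -> 'I_N.+1}) i)%N == N.
  rewrite (bigD1 (FSetSub i1s))//= ffunE eqxx big1 ?addn0// => i /negPf ii.
  by rewrite ffunE ii.
pose x0 : T := exist tot _ x0P.
have [A [D [dom colD]]] := @scarf_lemma _ _ rk col x0 rk_inj.
have [i2 i2D _] := dom x0; have [a0 a0A _] := colD i2 i2D.
pose m i := val [arg min_(a < a0 in A) val a i] i : nat.
have mle i a : a \in A -> (m i <= val a i)%N.
  by rewrite /m; case: arg_minnP => // b bA bmin; exact: bmin.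
have domm (x : T) : exists2 i, i \in D & (val x i <= m i)%N.
  have [i iD hi] := dom x; exists i => //.
  by rewrite /m; case: arg_minnP => // b bA _; exact/rkE/hi.
(* Otherwise the grid point with coordinates [m i + 1] on [D], the surplus being put at [i2], would
   exceed the minima of [A] for every order in [D]. *)
have msum : (N < \sum_(i in D) (m i).+1)%N.
  rewrite ltnNge; apply/negP => le.
  pose extra := (N - \sum_(i in D) (m i).+1)%N.
  pose y (i : s) : nat := if i \in D then ((m i).+1 + (i == i2) * extra)%N else 0%N.
  have ysum : (\sum_i y i = N)%N.
    rewrite (bigID (mem D))/= [X in (_ + X)%N]big1 => [|i /negPf iD]; last by rewrite /y iD.
    rewrite (eq_bigr (fun i => ((m i).+1 + (i == i2) * extra)%N)) => [|i iD];
      last by rewrite /y iD.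
    rewrite big_split/= [X in (_ + X + _)%N](bigD1 i2)//= eqxx mul1n.
    rewrite [X in (_ + (_ + X) + _)%N]big1 => [|i /andP[_ /negPf->]]; last by rewrite mul0n.
    by rewrite /extra !addn0 subnKC.
  have yN i : (y i < N.+1)%N by rewrite ltnS -ysum (bigD1 i)//= leq_addr.
  have yP : (\sum_i ([ffun i => Ordinal (yN i)] : {ffun s -> 'I_N.+1}) i)%N == N.
    by rewrite -[X in _ == X]ysum; apply/eqP/eq_bigr => i _; rewrite ffunE.
  have [i iD] := domm (exist tot _ yP); by rewrite /= ffunE /= /y iD addSn ltnNge leq_addr.
have mD : (N < \sum_(i in D) m i + n)%N.
  apply: leq_trans msum _; rewrite (eq_bigr (fun i => (m i + 1)%N)) => [|i _];
    last by rewrite addn1.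
  by rewrite big_split/= leq_add2l sum1_card /n cardfE max_card.
(* On [D] the coordinates of [a] are at least [m i], and these minima already sum to more than
   [N - n]: fewer than [n] units are left to distribute. *)
have Abound a : a \in A -> [/\ \sum_(i in D) (val a i : nat) <= N,
     forall i, i \in D -> val a i < m i + n & forall i, i \notin D -> val a i < n]%N.
  move=> aA; have := eqP (valP a); rewrite (bigID (mem D))/= => suma.
  have lem : (\sum_(i in D) m i <= \sum_(i in D) (val a i : nat))%N.
    by apply: leq_sum => i _; exact: mle.
  split=> [|i iD|i iD].
  - by rewrite -[leqRHS]suma leq_addr.
  - have : (\sum_(k in D) (m k) + (val a i - m i) <= \sum_(k in D) (val a k : nat))%N.
      rewrite (bigD1 i)//= [leqRHS](bigD1 i)//= addnAC subnKC ?mle//.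
      by rewrite leq_add2l; apply: leq_sum => k _; exact: mle.
    have SN : (\sum_(k in D) (val a k : nat) <= N)%N by rewrite -[leqRHS]suma leq_addr.
    move=> h; have h' := leq_ltn_trans (leq_trans h SN) mD.
    by move: h'; rewrite ltn_add2l ltn_subLR ?mle.
  - have h : (val a i <= \sum_(k | k \notin D) (val a k : nat))%N.
      by rewrite (bigD1 i)//= leq_addr.
    have h' := leq_add lem h; rewrite suma in h'.
    by have := leq_ltn_trans h' mD; rewrite ltn_add2l.
have near_a0 a : a \in A -> bary_dist (pt a) (pt a0) < rho.
  move=> aA; apply: le_lt_trans Nrho.
  have [xs _] := pts a; have [_ ys] := pts a0.
  apply: bary_dist_le_card => [||v vs]; [exact: (pts a).2|exact: (pts a0).2|].
  have -> : v = val (FSetSub vs) by [].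
  rewrite !ptE -mulrBl normrM [X in _ * X]ger0_norm ?invr_ge0// ler_pM2r ?invr_gt0//.
  set i := FSetSub vs.
  have [_ h1 h2] := Abound a aA; have [_ h3 h4] := Abound a0 a0A.
  have hn : (val a i <= val a0 i + n)%N /\ (val a0 i <= val a i + n)%N.
    have close (k a' b' : nat) : (a' < k + n -> b' < k + n -> k <= a' -> k <= b' ->
        a' <= b' + n /\ b' <= a' + n)%N by
      move=> a1 b1 ka kb; split;
      [apply: leq_trans (ltnW a1) _|apply: leq_trans (ltnW b1) _]; rewrite leq_add2r.
    have [iD|iD] := boolP (i \in D).
      by apply: (close (m i)); rewrite ?h1 ?h3 ?mle.
    by apply: (close 0%N); rewrite ?h2 ?h4.
  case: hn; rewrite -!(ler_nat R) !natrD ler_norml => ? ?.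
  by apply/andP; split; lra.
(* For [i] in [D], compare with a point of [A] of colour [i], which is closer than [rho]. For the
   others the coordinate of [pt a0] is at most [eta], and [g] raises it to at most [2 * eta]. *)
have gle (i : s) : g (pt a0) (val i) <= q (val i) + e.
  have [iD|iD] := boolP (i \in D).
    have [a aA coli] := colD i iD; have := hcol a; rewrite coli => ga.
    have := gcont _ _ (pts a) (pts a0) (near_a0 a aA).
    have := bary_dist_coord (g (pt a)) (g (pt a0)) (val i).
    rewrite ler_norml => /andP[]; lra.
  have [_ _ /(_ i iD) ai] := Abound a0 a0A.
  have : pt a0 (val i) <= n%:R / N%:R.
    by rewrite ptE ler_pM2r ?invr_gt0// ler_nat ltnW.
  have := le_trans (bary_dist_coord (g (pt a0)) (pt a0) (val i)) (g_eta (pts a0)).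
  rewrite ler_norml => /andP[_].
  have := q_eta (valP i); move: Neta; lra.
exists (pt a0) => //.
rewrite (bary_distE (gs (pts a0)).2 cq.2) big_seq_fsetE/=.
(* Both points have total mass 1, so the bound [e] on the excess of [g (pt a0)] over [q] in each
   coordinate controls the deficit too. *)
apply: (@le_trans _ _ (\sum_(i : s) (q (val i) - g (pt a0) (val i) + 2 * e))).
  apply: ler_sum => i _; have := gle i; rewrite ler_norml => ?.
  by apply/andP; split; lra.
rewrite big_split/= sumrB !sumE//; last exact: gs.
rewrite subrr add0r sumr_const -cardfE -mulr_natr -/n.
by rewrite le_eqVlt; apply/orP; left; apply/eqP; rewrite /n; ring.
Qed.

(** If [q] were missed, [bary_dist (g x) q] would stay above some [k > 0], against the approximation
    with [e = k / (4 * n)]. *)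
Lemma bary_surj : continuous_on (closed_simplex K s) bary_dist bary_dist g ->
  exists2 x, closed_simplex K s x & g x = q.
Proof.
move=> cg; apply: contrapT => nx.
have gq x : closed_simplex K s x -> 0 < bary_dist (g x) q.
  move=> cx; rewrite lt_neqAle bary_dist_ge0 andbT eq_sym; apply/eqP => h.
  by apply: nx; exists x => //; exact: bary_dist_eq0.
have [k k0 hk] : exists2 k : R, 0 < k & forall x, closed_simplex K s x -> k <= bary_dist (g
  x) q.
  have /choice[r hr] (y : bary_point R V) : exists r : R, closed_simplex K s y ->
      [/\ 0 < r, r <= bary_dist (g y) q / 2 & forall x, closed_simplex K s x ->
        bary_dist y x < r -> bary_dist (g y) (g x) < bary_dist (g y) q / 2].
    have [cy|ncy] := pselect (closed_simplex K s y); last by exists 0.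
    have gy := gq y cy; have [|r r0 hr] := cg y cy (bary_dist (g y) q / 2); first lra.
    exists (Num.min r (bary_dist (g y) q / 2)) => _; split.
    - by rewrite lt_min r0/=; lra.
    - by rewrite ge_min lexx orbT.
    - by move=> x cx; rewrite lt_min => /andP[yx _]; exact: hr.
  have [y cy|rho rho0 hrho] := lebesgue_number Ks (r := r); first by case: (hr y cy).
  exists rho => // x cx; have [y cy xy] := hrho x cx; have [ry1 ry2 h] := hr y cy.
  have := h x cx; rewrite (bary_distC y x) => H; have {}H := H ltac:(lra).
  have := bary_dist_triangle (g y) (g x) q; have := bary_dist_ge0 x y; lra.
have nR0 : 0 < n%:R :> R by rewrite ltr0n.
have e0 : 0 < k / (4 * n%:R) by rewrite divr_gt0// mulr_gt0.
have [rho rho0 hrho] := unif_continuous_on Ks (bary_metric_on (V := V) _) gs cg e0.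
have [x cx] := bary_surj_approx rho0 e0 hrho.
have := hk x cx; rewrite (_ : 2 * n%:R * _ = k / 2); last by field; rewrite lt0r_neq0.
lra.
Qed.

End GridBrouwer.

(** * The Lebesgue number of the open stars *)

Lemma uniform_pos (R : realType) (T : eqType) (P : T -> R -> Prop) (l : seq T) :
  (forall x r r', P x r -> r' <= r -> P x r') ->
  (forall x, x \in l -> exists2 r, 0 < r & P x r) ->
  exists2 r, 0 < r & forall x, x \in l -> P x r.
Proof.
move=> Pm; elim: l => [|x l IH] h; first by exists 1.
have [r r0 hr] := IH (fun y yl => h y (mem_behead (yl : y \in behead (x :: l)))).
have [r' r'0 hr'] := h x (mem_head _ _).
exists (Num.min r r'); first by rewrite lt_min r0.
move=> y; rewrite inE => /predU1P[->|yl].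
  by apply: Pm hr' _; rewrite ge_min lexx orbT.
by apply: Pm (hr y yl) _; rewrite ge_min lexx.
Qed.

(** * Arcs and their first exit from an open star *)

Section Arcs.
Context {R : realType} {V : choiceType} (K : simplicial_complex V).
Implicit Types (x y z p q : bary_point R V) (s : {fset V}).

Definition arc (X : set (bary_point R V)) p q := exists c : R -> bary_point R V,
  [/\ c 0 = p, c 1 = q, forall t, 0 <= t <= 1 -> X (c t) &
      continuous_on (fun t => 0 <= t <= 1) (fun t u => `|t - u|) bary_dist c].

Lemma arc_sub (X Y : set (bary_point R V)) p q :
  (forall x, X x -> Y x) -> arc X p q -> arc Y p q.
Proof. by move=> XY [c [c0 c1 cX cc]]; exists c; split=> // t /cX/XY. Qed.

(** Take for [z] the point at the infimum of the parameters outside the star; it is outside since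
    the star is open. A slightly earlier point [z'] is still inside and, by [finsupp_near], its
    support contains that of [z]: one closed simplex holds both. *)
Lemma arc_exit (X : set (bary_point R V)) t p q : arc X p q ->
  open_star t p -> ~ open_star t q ->
  exists z z', [/\ X z, X z', ~ open_star t z, open_star t z' &
    finsupp z `<=` finsupp z'].
Proof.
move=> [c [c0 c1 cX cc]] tp tq.
pose E := [set u | 0 <= u <= 1 /\ ~ open_star t (c u)]%classic.
have E1 : E 1 by split; rewrite ?ler01 ?lexx// c1.
have lbE : lbound E 0 by move=> u [/andP[]].
have infE : has_inf E by split; [exists 1|exists 0].
have infle u : E u -> inf E <= u by move=> Eu; apply: ge_inf => //; exists 0.
have i01 : 0 <= inf E <= 1 by rewrite lb_le_inf//= ?infle//; exists 1.
have near_star u : 0 <= u <= 1 -> exists2 r, 0 < r & forall w, 0 <= w <= 1 ->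
    `|u - w| < r -> finsupp (c u) `<=` finsupp (c w).
  move=> u01; have [e e0 he] := finsupp_near (c u); have [r r0 hr] := cc u u01 e e0.
  by exists r => // w w01 uw; apply/he/hr.
have nz : ~ open_star t (c (inf E)).
  move=> zt; have [r r0 hr] := near_star _ i01.
  have [u [u01 uE] ult] := inf_adherent r0 infE.
  have iu : inf E <= u by exact: infle.
  apply: uE; apply: fsubset_trans zt (hr _ u01 _).
  by rewrite ltr_norml; apply/andP; split; lra.
have i0 : 0 < inf E.
  have /andP[i0 _] := i01; rewrite lt_neqAle i0 andbT eq_sym; apply/eqP => iE.
  by apply: nz; rewrite iE c0.
have [r r0 hr] := near_star _ i01.
pose u := Num.max 0 (inf E - r / 2).
have u01 : 0 <= u <= 1.
  by rewrite le_max lexx/= ge_max ler01/=; have /andP[_] := i01; lra.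
have ui : u < inf E by rewrite gt_max i0/=; lra.
exists (c (inf E)), (c u); split=> //; [exact: cX|exact: cX| |].
  apply: contrapT => nu; have : inf E <= u by apply: infle.
  by rewrite leNgt ui.
apply: hr => //; have : inf E - r / 2 <= u by rewrite le_max lexx orbT.
by move=> ?; rewrite ltr_norml; apply/andP; split; lra.
Qed.

Lemma arc_seg p q :
  arc [set z | exists2 t : R, 0 <= t <= 1 & z = bary_seg t p q]%classic p q.
Proof.
exists (fun t => bary_seg t p q); split.
- exact: bary_seg0.
- exact: bary_seg1.
- by move=> t t01; exists t.
move=> t t01 e e0; exists (e / (1 + bary_dist p q)).
  by rewrite divr_gt0// ltr_pwDl// bary_dist_ge0.
move=> u u01; rewrite ltr_pdivlMr ?ltr_pwDl ?bary_dist_ge0// => tu.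
rewrite bary_dist_seg; apply: le_lt_trans tu.
by rewrite ler_wpM2l// lerDr.
Qed.

Lemma bary_dist_le2 x y : realization K x -> realization K y -> bary_dist x y <= 2.
Proof.
move=> [_ x0 x1] [_ y0 y1].
pose s := finsupp x `|` finsupp y.
have xs : finsupp x `<=` s := fsubsetUl _ _.
have ys : finsupp y `<=` s := fsubsetUr _ _.
rewrite (bary_distE xs ys); apply: (@le_trans _ _ (\sum_(v <- s) (x v + y v))).
  by apply: ler_sum => v _; apply: (le_trans (ler_normB _ _)); rewrite !ger0_norm.
by rewrite big_split/= -!sum_finsuppE// x1 y1.
Qed.

End Arcs.

(** * From isometric models to a uniform ball inside an open star *)

Section Metric.
Context {R : realType} {V : choiceType} (K : simplicial_complex V).
Variable d : bary_point R V -> bary_point R V -> R.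
Hypothesis md : is_metric_on (realization K) d.
Hypothesis cbd : forall s, K s -> continuous_on (closed_simplex K s) bary_dist d id.
Hypothesis cdb : continuous_on (realization K) d bary_dist id.
Implicit Types (x y z p q : bary_point R V) (s t F : {fset V}).

Lemma finsupp_simplex x : realization K x -> K (finsupp x).
Proof. by case. Qed.

Lemma metric_closed_simplex s : is_metric_on (closed_simplex K s) d.
Proof.
case: md => h1 h2 h3 h4; split=> [x y [rx _] [ry _]|x y [rx _] [ry _]|x y [rx _] [ry _]|
  x y z [rx _] [ry _] [rz _]].
- exact: h1.
- exact: h2.
- exact: h3.
- exact: h4.
Qed.

Lemma continuous_closed_simplex s : continuous_on (closed_simplex K s) d bary_dist id.
Proof.
move=> x [rx xs] e e0; have [r r0 hr] := cdb rx e0.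
by exists r => // y [ry _]; exact: hr.
Qed.

Lemma dist_small_of_bary s e : K s -> 0 < e -> exists2 r, 0 < r &
  forall x y, closed_simplex K s x -> closed_simplex K s y ->
    bary_dist x y < r -> d x y < e.
Proof.
by move=> Ks e0; apply: (unif_continuous_on Ks (metric_closed_simplex s) _ (cbd Ks)).
Qed.

Lemma bary_small_of_dist s e : K s -> 0 < e -> exists2 r, 0 < r &
  forall x y, closed_simplex K s x -> closed_simplex K s y ->
    d x y < r -> bary_dist x y < e.
Proof.
move=> Ks; apply: (unif_continuous_id Ks (metric_closed_simplex s) (cbd Ks)).
exact: continuous_closed_simplex.
Qed.

Record simplex_isometry s t (phi psi : bary_point R V -> bary_point R V) : Prop := {
  isom_to : forall x, closed_simplex K s x -> closed_simplex K t (phi x) ;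
  isom_from : forall y, closed_simplex K t y -> closed_simplex K s (psi y) ;
  isomK : forall x, closed_simplex K s x -> psi (phi x) = x ;
  isomVK : forall y, closed_simplex K t y -> phi (psi y) = y ;
  isom_dist : forall x y, closed_simplex K s x -> closed_simplex K s y ->
    d (phi x) (phi y) = d x y }.

Lemma isometric_isometry s t :
  isometric (closed_simplex K s) d (closed_simplex K t) d ->
  exists phi psi, simplex_isometry s t phi psi.
Proof.
move=> [phi [sub inj surj] dphi].
have /choice[psi hpsi] (y : bary_point R V) : exists x, closed_simplex K t y ->
    closed_simplex K s x /\ phi x = y.
  have [cy|ncy] := pselect (closed_simplex K t y); last by exists y.
  by have [x cx xy] := surj y cy; exists x.
have subphi x : closed_simplex K s x -> closed_simplex K t (phi x).
  exact: sub.
exists phi, psi; split=> [//|y cy|x cx|y cy|//].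
- by case: (hpsi y cy).
- have [cpx px] := hpsi _ (subphi _ cx).
  by apply: inj => //; rewrite inE.
- by case: (hpsi y cy).
Qed.

Lemma simplex_isometryV s t phi psi :
  simplex_isometry s t phi psi -> simplex_isometry t s psi phi.
Proof.
move=> [h1 h2 h3 h4 h5]; split=> // x y cx cy.
by rewrite -[in RHS](h4 x)// -[in RHS](h4 y)// h5//; exact: h2.
Qed.

Lemma simplex_isometry_continuous s t phi psi : K s -> K t ->
  simplex_isometry s t phi psi ->
  continuous_on (closed_simplex K s) bary_dist bary_dist phi.
Proof.
move=> Ks Kt [h1 h2 h3 h4 h5] x cx e e0.
have [r r0 hr] := continuous_closed_simplex (h1 x cx) e0.
have [u u0 hu] := cbd Ks cx r0.
by exists u => // y cy xy; apply: hr; [exact: h1|rewrite h5//; exact: hu].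
Qed.

Definition barycentre s : bary_point R V := [fsfun v in s => (#|` s|%:R)^-1].

Lemma barycentreE s v : v \in s -> barycentre s v = (#|` s|%:R)^-1.
Proof. by move=> vs; rewrite fsfunE vs. Qed.

Lemma closed_simplex_barycentre s : K s -> closed_simplex K s (barycentre s).
Proof.
move=> Ks; have s0 : (0 < #|` s|)%N by rewrite cardfs_gt0; exact: simplex_neq0 Ks.
apply/(closed_simplexP _ Ks); split.
- exact: finsupp_sub.
- by move=> v; rewrite fsfunE; case: ifP => // _; rewrite invr_ge0.
- rewrite big_seq_fsetE/=; under eq_bigr => v _ do rewrite barycentreE ?(valP v)//.
  rewrite sumr_const -cardfE -[X in X *+ _]mulr1 -mulrnAr mulVf// pnatr_eq0 -lt0n//.
Qed.

(* A point of the boundary can be avoided by maps arbitrarily close to the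
   identity, an interior point cannot. *)
Lemma isometry_boundary s t phi psi p : K s -> K t ->
  simplex_isometry s t phi psi -> simplex_boundary K s p ->
  simplex_boundary K t (phi p).
Proof.
move=> Ks Kt iso [cp ps]; have [h1 h2 h3 h4 h5] := iso.
split; first exact: h1.
apply/eqP => qt; move/eqP: ps; apply.
have cq := h1 p cp; set q := phi p in qt cq.
have [eta eta0 heta] : exists2 eta, 0 < eta & forall v, v \in t -> 2 * eta <= q v.
  apply: (@uniform_pos _ _ (fun v eta => 2 * eta <= q v)); first by move=> v r r'; lra.
  move=> v vt; exists (q v / 2); last lra.
  rewrite divr_gt0// lt_neqAle; have [[_ q0 _] _] := cq; rewrite q0 andbT eq_sym.
  by rewrite -mem_finsupp qt.
have [r1 r10 hr1] := bary_small_of_dist Kt eta0.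
have [r2 r20 hr2] := dist_small_of_bary Ks r10.
(* Two points of the realization are at [bary_dist] at most 2, so [f] below moves points by at most
   [2 * r2 / 3]. *)
pose e := Num.min 1 (r2 / 3).
have e0 : 0 < e by rewrite lt_min ltr01/=; lra.
have e1 : e <= 1 by rewrite ge_min lexx.
have er2 : e <= r2 / 3 by rewrite ge_min lexx orbT.
(* Pushing towards the barycentre makes every support full. Transported to [t], this map moves
   points by at most [eta], so it hits the interior point [q]; hence [p] is some [f (psi y)] and has
   full support. *)
pose f x := bary_seg e x (barycentre s).
have cb := closed_simplex_barycentre Ks.
have fs x : closed_simplex K s x -> closed_simplex K s (f x).
  by move=> cx; apply: closed_simplex_seg => //; rewrite (ltW e0).
have fsupp x : closed_simplex K s x -> finsupp (f x) = s.
  move=> cx; apply/eqP; rewrite eqEfsubset (fs x cx).2/=.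
  apply/fsubsetP => v vs; rewrite mem_finsupp bary_segE lt0r_neq0//.
  have [[_ x0 _] _] := cx; rewrite barycentreE// ltr_wpDl//.
    by rewrite mulr_ge0// subr_ge0.
  rewrite mulr_gt0// invr_gt0 ltr0n cardfs_gt0; exact: simplex_neq0 Ks.
have fdist x : closed_simplex K s x -> d (f x) x < r1.
  move=> cx; apply: hr2 => //; first exact: fs.
  rewrite -[X in bary_dist _ X](bary_seg0 x (barycentre s)) bary_dist_seg subr0.
  have := bary_dist_le2 cx.1 cb.1; have := bary_dist_ge0 x (barycentre s).
  rewrite gtr0_norm// => b0 b2.
  have : e * bary_dist x (barycentre s) <= (r2 / 3) * 2.
    by apply: ler_pM => //; exact: ltW.
  lra.
have [y cy] : exists2 y, closed_simplex K t y & phi (f (psi y)) = q.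
  apply: (bary_surj Kt _ cq eta0).
  - by move=> y /h2/fs/h1.
  - move=> y cy; apply/ltW/hr1 => //; first by apply/h1/fs/h2.
    by rewrite -[X in d _ X](h4 y cy) h5; [apply/fdist/h2|apply/fs/h2|exact: h2].
  - exact: heta.
  - move=> y cy e' e'0; have cfy := fs _ (h2 _ cy).
    have [r3 r30 hr3] := simplex_isometry_continuous Ks Kt iso cfy e'0.
    have [r4 r40 hr4] := simplex_isometry_continuous Kt Ks (simplex_isometryV iso) cy r30.
    exists r4 => // z cz yz; apply: hr3; first by apply/fs/h2.
    apply: le_lt_trans (hr4 z cz yz).
    pose u := finsupp (psi y) `|` (finsupp (psi z) `|` finsupp (barycentre s)).
    rewrite !(bary_distE (s := s)) ?(fs _ (h2 _ cy)).2 ?(fs _ (h2 _ cz)).2 ?(h2 _ cy).2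
      ?(h2 _ cz).2//.
    apply: ler_sum => v _; rewrite !bary_segE.
    rewrite (_ : _ - _ = (1 - e) * (psi y v - psi z v)); last by ring.
    rewrite normrM -[leRHS]mul1r ler_wpM2r// ger0_norm ?subr_ge0//; lra.
move=> fq; rewrite -(fsupp (psi y)); last exact: h2.
by congr finsupp; rewrite -[LHS](h3 p cp) -[RHS]h3; [rewrite fq|apply/fs/h2].
Qed.

Lemma arc_isometry s t phi psi (X : set (bary_point R V)) p q : K s -> K t ->
  simplex_isometry s t phi psi -> (forall x, X x -> closed_simplex K s x) ->
  arc X p q -> arc [set z | exists2 x, X x & z = phi x]%classic (phi p) (phi q).
Proof.
move=> Ks Kt iso Xs [c [<- <- cX cc]]; exists (phi \o c); split=> // [u /cX|u u01 e e0].
  by exists (c u).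
have [r r0 hr] := simplex_isometry_continuous Ks Kt iso (Xs _ (cX _ u01)) e0.
have [r' r'0 hr'] := cc u u01 r r0.
by exists r' => // w w01 uw; apply: hr; [exact/Xs/cX|exact: hr'].
Qed.

(* Two arcs: remove from [p] a vertex at which [q] vanishes, then go to [q]. *)
Lemma boundary_arcs s e : K s -> 0 < e -> exists2 h, 0 < h &
  forall p q, simplex_boundary K s p -> simplex_boundary K s q -> d p q < h ->
  exists r, let X := [set z | simplex_boundary K s z /\ d p z < e]%classic in
    arc X p r /\ arc X r q.
Proof.
move=> Ks e0; have [rho rho0 hrho] := dist_small_of_bary Ks e0.
(* The intermediate point lies within [2 * del] of [p] and [q] within [3 * del] of it, so both arcs
   stay within [5 * del] of [p], which is less than [rho]. The bound [1 / 2] keeps [1 - p j]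
   positive. *)
pose del := Num.min (rho / 6) (1 / 2).
have del0 : 0 < del by rewrite lt_min; apply/andP; split; lra.
have del1 : del <= rho / 6 by rewrite ge_min lexx.
have del2 : del <= 1 / 2 by rewrite ge_min lexx orbT.
have [h h0 hh] := bary_small_of_dist Ks del0.
exists h => // p q [cp ps] [cq qs] /(hh p q cp cq) pq.
have [j js jq] : exists2 j, j \in s & j \notin finsupp q.
  apply/fsubsetPn; apply: contra qs => sq; rewrite eqEfsubset sq andbT.
  exact: cq.2.
have pj : p j < del.
  have := bary_dist_coord p q j; rewrite (bary_out jq) subr0.
  by move=> h'; apply: le_lt_trans (ler_norm _) (le_lt_trans h' pq).
have /(closed_simplexP _ Ks)[_ p0 p1] := cp.
pose r : bary_point R V := [fsfun v in s `\ j => p v / (1 - p j)].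
have rE v : v != j -> r v = p v / (1 - p j).
  move=> vj; rewrite fsfunE !inE vj /=; case: ifPn => // vs.
  by rewrite (bary_out (x := p)) ?mul0r//; apply: contra vs; exact/fsubsetP/cp.2.
have rj : r j = 0 by rewrite fsfunE !inE eqxx.
have pj1 : 0 < 1 - p j by lra.
have rs : finsupp r `<=` s by apply: fsubset_trans (finsupp_sub _ _ _) _; exact: fsubD1set.
have psum : \sum_(v <- s `\ j) p v = 1 - p j.
  by move: p1; rewrite (big_fsetD1 j js)/= => <-; ring.
have cr : closed_simplex K s r.
  apply/(closed_simplexP _ Ks); split=> //.
    move=> v; have [->|vj] := eqVneq v j; first by rewrite rj.
    by rewrite rE// divr_ge0// ltW.
  rewrite (big_fsetD1 j js)/= rj add0r.
  rewrite big_seq_cond (eq_bigr (fun v => p v / (1 - p j))); last first.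
    by move=> v; rewrite !inE andbT => /andP[vj _]; exact: rE.
  by rewrite -big_seq_cond -mulr_suml psum divff// lt0r_neq0.
have rp : finsupp r `<=` finsupp p.
  apply/fsubsetP => v; rewrite !mem_finsupp; apply: contra_neq => pv.
  by have [->//|vj] := eqVneq v j; rewrite rE// pv mul0r.
have pr : bary_dist p r <= 2 * del.
  rewrite (bary_distE cp.2 rs) (big_fsetD1 j js)/= rj subr0 ger0_norm//.
  rewrite big_seq_cond (eq_bigr (fun v => p v * (p j / (1 - p j)))); last first.
    move=> v; rewrite !inE andbT => /andP[vj _]; rewrite rE// distrC.
    rewrite (_ : _ - _ = p v * (p j / (1 - p j))); last by field; rewrite lt0r_neq0.
    by rewrite ger0_norm// mulr_ge0// divr_ge0// ltW.
  rewrite -big_seq_cond -mulr_suml psum mulrC divfK ?lt0r_neq0//; lra.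
(* Supports stay inside [finsupp p] on the first arc and avoid [j] on the second, so neither arc
   enters the interior. *)
exists r; split; apply: arc_sub (arc_seg _ _) => z [t t01 ->]; split.
- split; first exact: closed_simplex_seg.
  apply: contra ps => /eqP zs; rewrite eqEfsubset cp.2 -zs.
  by apply: fsubset_trans (finsupp_bary_seg _ _ _) _; rewrite fsubUset fsubset_refl.
- apply: hrho => //; first exact: closed_simplex_seg.
  rewrite -[X in bary_dist X _](bary_seg0 p r) bary_dist_seg sub0r normrN.
  have /andP[t0 t1] := t01; rewrite ger0_norm//.
  have := ler_wpM2r (bary_dist_ge0 p r) t1; rewrite mul1r; lra.
- split; first exact: closed_simplex_seg.
  apply/eqP => zs; move: js; rewrite -zs => /(fsubsetP (finsupp_bary_seg _ _ _)).
  by rewrite inE (negPf jq) orbF mem_finsupp rj eqxx.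
- apply: hrho => //; first exact: closed_simplex_seg.
  apply: le_lt_trans (bary_dist_triangle _ r _) _.
  rewrite -[X in _ + bary_dist X _](bary_seg0 r q) bary_dist_seg sub0r normrN.
  have /andP[t0 t1] := t01; rewrite ger0_norm//.
  have := ler_wpM2r (bary_dist_ge0 r q) t1; rewrite mul1r.
  have := bary_dist_triangle r p q; rewrite (bary_distC r p); lra.
Qed.

Hypothesis shapes : finitely_many_shapes K d.

(** The constant comes from the finitely many models: an isometry preserves distances and, by
    [isometry_boundary], takes boundary arcs to boundary arcs. *)
Lemma uniform_boundary_arcs e : 0 < e -> exists2 h, 0 < h &
  forall s p q, K s -> simplex_boundary K s p -> simplex_boundary K s q -> d p q < h ->
  exists r, let X := [set z | simplex_boundary K s z /\ d p z < e]%classic in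
    arc X p r /\ arc X r q.
Proof.
move=> e0; have [S hS] := shapes.
have [|t tS|h h0 hh] := @uniform_pos R _ (fun t h => forall s p q, K s -> K t ->
  isometric (closed_simplex K s) d (closed_simplex K t) d ->
  simplex_boundary K s p -> simplex_boundary K s q -> d p q < h ->
  exists r, let X := [set z | simplex_boundary K s z /\ d p z < e]%classic in
    arc X p r /\ arc X r q) S.
- move=> t r r' h r'r s p q Ks Kt iso ps qs pq.
  by apply: (h s p q) => //; exact: lt_le_trans r'r.
- have [Kt|nKt] := pselect (K t); last by exists 1.
  have [h h0 hh] := boundary_arcs Kt e0; exists h => // s p q Ks _.
  case/isometric_isometry=> phi [psi iso] ps qs pq; have [h1 h2 h3 h4 h5] := iso.
  have isoV := simplex_isometryV iso.
  have [|r [pr rq]] := hh (phi p) (phi q) (isometry_boundary Ks Kt iso ps)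
    (isometry_boundary Ks Kt iso qs).
    by rewrite h5//; [case: ps|case: qs].
  exists (psi r); rewrite -[p](h3 p ps.1) -[q](h3 q qs.1).
  set X := [set z | _ /\ _]%classic in pr rq.
  have XY z : [set z | exists2 x, X x & z = psi x]%classic z ->
      simplex_boundary K s z /\ d (psi (phi p)) z < e.
    move=> [x [xt xe] ->]; split; first exact: isometry_boundary isoV xt.
    by rewrite (isom_dist isoV)//; [apply/h1/ps.1|exact: xt.1].
  have Xt z : X z -> closed_simplex K t z by case=> -[].
  by split; apply: arc_sub XY _; apply: (arc_isometry Kt Ks isoV Xt).
exists h => // s p q Ks; have [t [tS Kt iso]] := hS s Ks.
by move=> ps qs pq; exact: (hh t tS s p q Ks Kt iso ps qs pq).
Qed.

Definition far_from_boundary (del : R) x := forall y,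
  closed_simplex K (finsupp x) y -> finsupp y != finsupp x -> del <= d x y.

(** If [x] and [z] are close points of the boundary of [s], join them in this boundary by arcs that
    stay within the radius [e] valid for smaller simplices. Where an arc leaves the open star of the
    carrier of [x], [arc_exit] gives two points in one proper face that still contains [x], against
    the induction hypothesis. *)
Lemma far_from_face_card n del : 0 < del -> exists2 e, 0 < e &
  forall s x z, K s -> (#|` s| <= n)%N -> closed_simplex K s x ->
    far_from_boundary del x -> closed_simplex K s z ->
    ~ open_star (finsupp x) z -> e <= d x z.
Proof.
move=> del0; elim: n => [|n [e e0 he]].
  exists 1 => // s x z /simplex_neq0; rewrite -cardfs_gt0 => s0.
  by rewrite leqNgt s0.
have [h h0 hh] := uniform_boundary_arcs e0.
exists (Num.min del (Num.min e h)); first by rewrite !lt_min del0 e0.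
move=> s x z Ks sn cx farx cz nz; rewrite leNgt; apply/negP.
rewrite !lt_min => /and3P[dxz _ xzh].
have zs : finsupp z != s.
  by apply/eqP => zs; apply: nz; rewrite /open_star/= zs; exact: cx.2.
have [xs|xs] := eqVneq (finsupp x) s.
  by have := farx z; rewrite xs leNgt dxz => /(_ cz zs).
have [r [pr rq]] := hh s x z Ks (conj cx xs) (conj cz zs) xzh.
set X := [set z | _ /\ _]%classic in pr rq.
have stay u v : arc X u v -> open_star (finsupp x) u -> open_star (finsupp x) v.
  move=> uv xu; apply: contrapT => xv.
  have [w [w' [[[cw _] xw] [[cw' w's] _] nw sw' ww']]] := arc_exit uv xu xv.
  move: xw; apply/negP; rewrite -leNgt.
  apply: (he (finsupp w')) => //; last by split; [exact: cw.1|].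
  - exact: finsupp_simplex cw'.1.
  - rewrite -ltnS; apply: leq_trans sn; rewrite fproper_ltn_card//.
    by rewrite fproperEneq w's cw'.2.
  - by split; [exact: cx.1|].
by apply: nz; apply: (stay _ _ rq); apply: (stay _ _ pr); exact: fsubset_refl.
Qed.

(** The carrier of a vertex has empty boundary, so a vertex is far from it vacuously, and edges are
    enough to compare two vertices. *)
Lemma vertices_apart : exists2 r, 0 < r & forall s v w, K s ->
  v \in s -> w \in s -> v != w -> r <= d (bary_vertex v) (bary_vertex w).
Proof.
have [r r0 hr] := far_from_face_card 2 ltr01; exists r => // s v w Ks vs ws vw.
have Kvw : K [fset v; w].
  apply: simplex_face Ks _ _; first by rewrite fsubUset !fsub1set vs.
  by apply/fset0Pn; exists v; rewrite !inE eqxx.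
apply: (hr [fset v; w]) => //.
- by rewrite cardfs2 vw.
- by apply: closed_simplex_vertex; rewrite ?inE ?eqxx.
- move=> y [ry]; rewrite finsupp_vertex fsubset1 => /orP[->//|y0].
  by have := simplex_neq0 (finsupp_simplex ry); rewrite (eqP y0) eqxx.
- by apply: closed_simplex_vertex; rewrite ?inE ?eqxx ?orbT.
- by rewrite /open_star/= !finsupp_vertex fsub1set inE; apply/negP.
Qed.

(** Isometric simplices are not assumed to have equally many vertices. The images in a model [t] of
    the vertices of [s] are separated by [vertices_apart]; with coordinates rounded down to
    multiples of [1 / N] they remain distinct, and there are finitely many rounded values. *)
Lemma bounded_simplex_card : exists n, forall s, K s -> (#|` s| <= n)%N.
Proof.
have [r r0 hr] := vertices_apart; have [S hS] := shapes.
have card_isometric t : exists n, forall s, K s -> K t ->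
    isometric (closed_simplex K s) d (closed_simplex K t) d -> (#|` s| <= n)%N.
  have [Kt|nKt] := pselect (K t); last by exists 0%N.
  have [rho rho0 hrho] := dist_small_of_bary Kt r0.
  have [N hN] : exists N : nat, #|` t|%:R / rho < N%:R.
    by exists (Num.bound (#|` t|%:R / rho)); apply: archi_boundP; rewrite divr_ge0// ltW.
  have N0 : 0 < N%:R :> R by apply: le_lt_trans hN; rewrite divr_ge0// ltW.
  exists #|{ffun t -> 'I_N.+1}| => s Ks _ /isometric_isometry[phi [psi [h1 h2 h3 h4 h5]]].
  have cv (v : s) : closed_simplex K s (bary_vertex (val v) : bary_point R V).
    exact: closed_simplex_vertex (valP v).
  pose code (v : s) : {ffun t -> 'I_N.+1} :=
    [ffun w => inord (Num.truncn (N%:R * phi (bary_vertex (val v)) (val w)))].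
  rewrite cardfE; apply: (@leq_card _ _ code) => v w vw.
  apply: contrapT => /eqP nvw.
  have := hr s (val v) (val w) Ks (valP v) (valP w) nvw.
  apply/negP; rewrite -ltNge -h5//.
  apply: hrho; [exact: h1|exact: h1|].
  suff le1 u : u \in t ->
      `|phi (bary_vertex (val v)) u - phi (bary_vertex (val w)) u| <= 1 / N%:R.
    have [_ vt] := h1 _ (cv v); have [_ wt] := h1 _ (cv w).
    apply: le_lt_trans (bary_dist_le_card vt wt le1) _.
    by move: hN; rewrite mulrA mulr1 !ltr_pdivrMr// mulrC.
  move=> ut; have /ffunP/(_ (FSetSub ut)) := vw; rewrite !ffunE /=.
  move=> /(congr1 (@nat_of_ord _)).
  have lt1 y : closed_simplex K t y -> (Num.truncn (N%:R * y u) < N.+1)%N.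
    move=> cy; have [[_ y0 _] _] := cy; have y1 := realization_le1 u cy.1.
    rewrite ltnS -(ler_nat R); apply: le_trans (_ : N%:R * y u <= _).
      by rewrite truncn_le mulr_ge0// ltW.
    by rewrite -[leRHS]mulr1 ler_wpM2l.
  rewrite !inordK ?lt1//; [|exact: (h1 _ (cv w))|exact: (h1 _ (cv v))].
  set a := phi _ u; set b := phi _ u => tab.
  have [[_ a0 _] _] := h1 _ (cv v); have [[_ b0 _] _] := h1 _ (cv w).
  have /andP[] := truncn_itv (mulr_ge0 (ltW N0) (a0 u)).
  have /andP[] := truncn_itv (mulr_ge0 (ltW N0) (b0 u)).
  rewrite -/a -/b tab -natr1 => b1 b2 a1 a2.
  rewrite ler_pdivlMr// -[X in _ * X]gtr0_norm// -normrM mulrBl ler_norml.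
  by apply/andP; split; lra.
suff H (l : seq {fset V}) : exists n, forall t, t \in l -> forall s, K s -> K t ->
    isometric (closed_simplex K s) d (closed_simplex K t) d -> (#|` s| <= n)%N.
  have [n hn] := H (enum_fset S).
  by exists n => s Ks; have [t [tS Kt iso]] := hS s Ks; exact: hn tS s Ks Kt iso.
elim: l => [|t l [n hn]]; first by exists 0%N.
have [n' hn'] := card_isometric t; exists (maxn n n') => u; rewrite inE.
move=> /predU1P[->|ul] s Ks Ku iso; rewrite leq_max.
  by rewrite (hn' s Ks Ku iso) orbT.
by rewrite (hn u ul s Ks Ku iso).
Qed.

Lemma far_from_face del : 0 < del -> exists2 e, 0 < e &
  forall s x z, K s -> closed_simplex K s x ->
    far_from_boundary del x -> closed_simplex K s z ->
    ~ open_star (finsupp x) z -> e <= d x z.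
Proof.
have [n hn] := bounded_simplex_card => del0.
have [e e0 he] := far_from_face_card n del0; exists e => // s x z Ks.
by apply: he => //; exact: hn.
Qed.

Hypothesis geo : geodesic_space (realization K) d.

Lemma geodesic_arc x y : realization K x -> realization K y ->
  arc [set z | realization K z /\ d x z <= d x y]%classic x y.
Proof.
move=> rx ry; have [g [g0 g1 gX gd]] := geo rx ry.
have l0 := metric_on_ge0 md rx ry.
have tl (t : R) : 0 <= t <= 1 -> 0 <= t * d x y <= d x y.
  by move=> /andP[t0 t1]; rewrite mulr_ge0//= -[leRHS]mul1r ler_wpM2r.
exists (fun t : R => g (t * d x y)); split.
- by rewrite mul0r.
- by rewrite mul1r.
- move=> t /tl tl'; split; first exact: gX.
  rewrite -{1}g0 gd//; last by rewrite lexx.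
  by rewrite sub0r normrN ger0_norm//; case/andP: tl'.
move=> t t01 e e0; have [r r0 hr] := cdb (gX _ (tl t t01)) e0.
exists (r / (1 + d x y)); first by rewrite divr_gt0// ltr_pwDl.
move=> u u01; rewrite ltr_pdivlMr ?ltr_pwDl// => tu.
apply: hr; first exact/gX/tl.
rewrite gd ?tl// -mulrBl normrM [X in _ * X]ger0_norm//.
by apply: le_lt_trans tu; rewrite ler_wpM2l// lerDr.
Qed.

(** The exit point and [x] lie in one closed simplex, because the point just before the exit still
    has the carrier of [x] in its support; [far_from_face] applies there. *)
Lemma far_from_boundary_star del : 0 < del -> exists2 e, 0 < e &
  forall x y, realization K x -> realization K y -> far_from_boundary del x ->
    d x y < e -> open_star (finsupp x) y.
Proof.
move=> del0; have [e e0 he] := far_from_face del0; exists e => // x y rx ry farx xy.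
apply: contrapT => ny.
have [|z [z' [[rz xz] [rz' _] nz sz' zz']]] := arc_exit (geodesic_arc rx ry) _ ny.
  exact: fsubset_refl.
have := he (finsupp z') x z (finsupp_simplex rz'); rewrite leNgt (le_lt_trans xz xy) => h.
by suff: false by []; apply: h.
Qed.

(** A point far from the boundary of its carrier may take any vertex of the carrier. Otherwise it
    inherits the vertex of a nearby point with smaller support, and the radius [e / 2] leaves room
    for this detour. *)
Lemma star_ball_card n : exists2 e, 0 < e & forall x, realization K x ->
  (#|` finsupp x| <= n)%N -> exists v, forall y, realization K y -> d x y < e ->
    v \in finsupp y.
Proof.
elim: n => [|n [e e0 he]].
  exists 1 => // x [/simplex_neq0]; rewrite -cardfs_gt0 => x0 _ _.
  by rewrite leqNgt x0.
have e20 : 0 < e / 2 by lra.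
have [e' e'0 he'] := far_from_boundary_star e20.
exists (Num.min (e / 2) e'); first by rewrite lt_min e20.
move=> x rx xn; have [farx|/existsNP[y /not_implyP[[ry yx] /not_implyP[yx' /negP]]]] :=
    pselect (far_from_boundary (e / 2) x).
  have [v vx] : exists v, v \in finsupp x by apply/fset0Pn;
    exact: simplex_neq0 (finsupp_simplex rx).
  exists v => y ry; rewrite lt_min => /andP[_ xy].
  exact: (fsubsetP (he' x y rx ry farx xy)).
rewrite -ltNge => xy.
have [|v hv] := he y ry.
  rewrite -ltnS; apply: leq_trans xn; apply: fproper_ltn_card.
  by rewrite fproperEneq yx'.
exists v => z rz; rewrite lt_min => /andP[xz _]; apply: hv => //.
have := metric_on_triangle md ry rx rz; rewrite (metric_on_sym md ry rx); lra.
Qed.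

Lemma star_ball : exists2 e, 0 < e & forall x, realization K x ->
  exists v, forall y, realization K y -> d x y < e -> v \in finsupp y.
Proof.
have [n hn] := bounded_simplex_card; have [e e0 he] := star_ball_card n.
by exists e => // x rx; apply: he => //; apply: hn; case: rx.
Qed.

End Metric.

(** * Geodesic cones and chains of points *)

Section Plane.
Context {R : realType}.
Implicit Types (p q : R * R).

Lemma edist_homothety (t : R) p q : 0 <= t ->
  edist (t * p.1, t * p.2) (t * q.1, t * q.2) = t * edist p q.
Proof.
move=> t0; rewrite /edist /= -!mulrBr !exprMn -mulrDr.
by rewrite sqrtrM ?sqr_ge0// sqrtr_sqr ger0_norm.
Qed.

Lemma comparison_triangle (a b c : R) : 0 <= a -> 0 <= b -> 0 <= c ->
  a <= b + c -> b <= a + c -> c <= a + b ->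
  exists p q : R * R, [/\ edist (0, 0) p = a, edist (0, 0) q = b & edist p q = c].
Proof.
move=> a0 b0 c0 abc bac cab.
have [aE|an0] := eqVneq a 0.
  exists (0, 0), (b, 0); rewrite /edist /= !subr0 !sub0r !sqrrN !expr0n /= !addr0.
  by rewrite sqrtr0 sqrtr_sqr ger0_norm// aE; split=> //; lra.
have ap : 0 < a by rewrite lt_neqAle eq_sym an0.
(* Law of cosines: with [p = (a, 0)], this is the first coordinate of [q]. *)
pose u := (a ^+ 2 + b ^+ 2 - c ^+ 2) / (2 * a).
have uE : 2 * a * u = a ^+ 2 + b ^+ 2 - c ^+ 2 by rewrite /u; field.
have ub : u ^+ 2 <= b ^+ 2.
  suff h : 0 <= (2 * a) ^+ 2 * (b ^+ 2 - u ^+ 2).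
    by move: h; rewrite pmulr_rge0 ?subr_ge0// exprn_gt0// mulr_gt0.
  (* Heron's factorisation; the factors are nonnegative by the triangle inequalities. *)
  rewrite (_ : _ * _ = (c ^+ 2 - (a - b) ^+ 2) * ((a + b) ^+ 2 - c ^+ 2)).
    apply: mulr_ge0; rewrite subr_sqr; apply: mulr_ge0; lra.
  rewrite mulrBr -!exprMn uE; ring.
exists (a, 0), (u, Num.sqrt (b ^+ 2 - u ^+ 2)); rewrite /edist /=; split.
- by rewrite !sub0r !sqrrN expr0n addr0 sqrtr_sqr ger0_norm.
- by rewrite !sub0r !sqrrN sqr_sqrtr ?subr_ge0// addrC subrK sqrtr_sqr ger0_norm.
- rewrite sub0r sqrrN sqr_sqrtr ?subr_ge0// (_ : _ + _ = c ^+ 2).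
    by rewrite sqrtr_sqr ger0_norm.
  by rewrite sqrrB -(mulr_natr (a * u)) (mulrC (a * u)) mulrA uE; ring.
Qed.

End Plane.

Section Cone.
Context {R : realType} {T : Type} (X : set T) (d : T -> T -> R).
Hypothesis cat : is_CAT0 X d.

Let md : is_metric_on X d. Proof. by case: cat. Qed.

Lemma geodesic_rev x y g : is_geodesic X d x y g -> d y x = d x y ->
  is_geodesic X d y x (fun t => g (d x y - t)).
Proof.
move=> [g0 g1 gX gd] yx; split; rewrite ?yx.
- by rewrite subr0.
- by rewrite subrr.
- by move=> s /andP[s0 s1]; apply: gX; apply/andP; split; lra.
- move=> s t /andP[s0 s1] /andP[t0 t1]; rewrite gd; try by apply/andP; split; lra.
  by rewrite distrC; congr `|_|; ring.
Qed.

(* The comparison points on the sides issued from [x0] are obtained from the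
   other two vertices of the comparison triangle by the same homothety. *)
Lemma geodesic_convex x0 x y gx gy t : X x0 -> X x -> X y -> 0 <= t <= 1 ->
  is_geodesic X d x0 x gx -> is_geodesic X d x0 y gy ->
  d (gx (t * d x0 x)) (gy (t * d x0 y)) <= t * d x y.
Proof.
move=> X0 Xx Xy /andP[t0 t1] geox geoy; have [_ geo cat0] := cat.
have [h geoh] := geo x y Xx Xy.
have [m0 m1 ms mt] := md.
have tri := mt x0 y x X0 Xy Xx; have tri1 := mt x0 x y X0 Xx Xy.
have tri2 := mt x x0 y Xx X0 Xy.
rewrite (ms y x)// in tri; rewrite (ms x x0)// in tri2.
have [p [q [p1 q1 pq]]] :=
  comparison_triangle (m0 _ _ X0 Xx) (m0 _ _ X0 Xy) (m0 _ _ Xx Xy) tri tri1 tri2.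
pose a (i : 'I_3) := nth x0 [:: x0; x; y] i.
(* Sides run cyclically, so the third one goes from [y] back to [x0]; this is why its parameter
   below is [(1 - t) * d x0 y]. *)
pose side (i : 'I_3) := nth gx [:: gx; h; (fun u => gy (d x0 y - u))] i.
pose a' (i : 'I_3) := nth (0, 0) [:: (0, 0); p; q] i.
have edC (u v : R * R) : edist u v = edist v u.
  by rewrite /edist -(sqrrN (u.1 - v.1)) -(sqrrN (u.2 - v.2)) !opprB.
have dx0 := m0 _ _ X0 Xx; have dy0 := m0 _ _ X0 Xy.
have tp : edist (0, 0) (t * p.1, t * p.2) = t * d x0 x.
  by rewrite -p1 -(edist_homothety _ _ t0) /= !mulr0.
have tq : edist (0, 0) (t * q.1, t * q.2) = t * d x0 y.
  by rewrite -q1 -(edist_homothety _ _ t0) /= !mulr0.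
have line (u : R * R) : edist (t * u.1, t * u.2) u = (1 - t) * edist (0, 0) u.
  have t1' : 0 <= 1 - t by lra.
  rewrite -(edist_homothety _ _ t1') /edist /= !mulr0 !sub0r !sqrrN;
    congr (Num.sqrt (_ + _)); ring.
have := cat0 a side a' _ _ _ (inord 0) (inord 2) (t * d x0 x) ((1 - t) * d x0 y)
   (t * p.1, t * p.2) (t * q.1, t * q.2).
rewrite /side /a /a' /= !inordK //= edist_homothety// pq.
rewrite (_ : d x0 y - (1 - t) * d x0 y = t * d x0 y); last by ring.
rewrite (ms y x0)//; apply.
- by case=> [[|[|[|//]]] ?].
- case=> [[|[|[|//]]] ?] //=.
  by apply: geodesic_rev => //; exact: ms.
- by case=> [[|[|[|//]]] ?] //=; rewrite ?(edC q) ?(ms y) ?(ms x y).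
- by rewrite mulr_ge0//= -[leRHS]mul1r ler_wpM2r.
- by rewrite mulr_ge0 ?subr_ge0//= -[leRHS]mul1r ler_wpM2r//; lra.
- exact: tp.
- rewrite line p1; ring.
- by rewrite edC line q1.
- rewrite edC tq; ring.
Qed.

Lemma geodesic_cone x0 : X x0 -> exists cone : T -> R -> T,
  [/\ forall x, X x -> cone x 0 = x0 /\ cone x 1 = x,
      forall x t, X x -> 0 <= t <= 1 -> X (cone x t),
      forall x s t, X x -> 0 <= s <= 1 -> 0 <= t <= 1 ->
        d (cone x s) (cone x t) = `|s - t| * d x0 x &
      forall x y t, X x -> X y -> 0 <= t <= 1 ->
        d (cone x t) (cone y t) <= t * d x y].
Proof.
move=> X0; have [_ geo _] := cat.
have /choice[g hg] (x : T) : exists g, X x -> is_geodesic X d x0 x g.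
  have [Xx|nXx] := pselect (X x); last by exists (fun=> x).
  by have [g gg] := geo x0 x X0 Xx; exists g.
have tl x (t : R) : X x -> 0 <= t <= 1 -> 0 <= t * d x0 x <= d x0 x.
  move=> Xx /andP[t0 t1]; have := metric_on_ge0 md X0 Xx => d0.
  by rewrite mulr_ge0//= -[leRHS]mul1r ler_wpM2r.
exists (fun x (t : R) => g x (t * d x0 x)); split.
- by move=> x Xx; have [g0 g1 _ _] := hg x Xx; rewrite mul0r mul1r.
- by move=> x t Xx t01; have [_ _ gX _] := hg x Xx; apply/gX/tl.
- move=> x s t Xx s01 t01; have [_ _ _ gd] := hg x Xx.
  by rewrite gd ?tl// -mulrBl normrM (ger0_norm (metric_on_ge0 md X0 Xx)).
- by move=> x y t Xx Xy t01; apply: geodesic_convex => //; exact: hg.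
Qed.

End Cone.

Section Chains.
Context {R : realType} {V : choiceType} (K : simplicial_complex V).
Variable d : bary_point R V -> bary_point R V -> R.
Hypothesis md : is_metric_on (realization K) d.
Hypothesis cbd : forall s, K s -> continuous_on (closed_simplex K s) bary_dist d id.
Hypothesis cdb : continuous_on (realization K) d bary_dist id.
Hypothesis shapes : finitely_many_shapes K d.

(** A geodesic might leave the simplex, whereas the labels along the chain have to be vertices of
    [s]. The chain is the image of a barycentric segment of the model, whose uniform continuity
    fixes [M] independently of [s]. *)
Lemma simplex_chains e : 0 < e -> exists M : nat, forall s x y, K s ->
  closed_simplex K s x -> closed_simplex K s y -> exists p : nat -> bary_point R V,
    [/\ p 0%N = x, p M.+1 = y, forall i, (i <= M.+1)%N -> closed_simplex K s (p i) &
        forall i, (i < M.+1)%N -> d (p i) (p i.+1) < e].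
Proof.
move=> e0; have [S hS] := shapes.
suff H (l : seq {fset V}) : exists M0, forall t, t \in l -> forall M s x y, (M0 <= M)%N ->
    K s -> K t -> isometric (closed_simplex K s) d (closed_simplex K t) d ->
    closed_simplex K s x -> closed_simplex K s y -> exists p : nat -> bary_point R V,
    [/\ p 0%N = x, p M.+1 = y, forall i, (i <= M.+1)%N -> closed_simplex K s (p i) &
        forall i, (i < M.+1)%N -> d (p i) (p i.+1) < e].
  have [M hM] := H (enum_fset S); exists M => s x y Ks cx cy.
  by have [t [tS Kt iso]] := hS s Ks; exact: (hM t tS M s x y).
elim: l => [|t l [M0 hM0]]; first by exists 0%N.
suff [M1 hM1] : exists M1, forall M s x y, (M1 <= M)%N ->
    K s -> K t -> isometric (closed_simplex K s) d (closed_simplex K t) d ->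
    closed_simplex K s x -> closed_simplex K s y -> exists p : nat -> bary_point R V,
    [/\ p 0%N = x, p M.+1 = y, forall i, (i <= M.+1)%N -> closed_simplex K s (p i) &
        forall i, (i < M.+1)%N -> d (p i) (p i.+1) < e].
  exists (maxn M0 M1) => u; rewrite inE => /predU1P[->|ul] M s x y;
    rewrite geq_max => /andP[h0 h1].
    exact: hM1.
  exact: (hM0 u ul).
have [Kt|nKt] := pselect (K t); last by exists 0%N.
have [rho rho0 hrho] := dist_small_of_bary md cbd Kt e0.
exists (Num.bound (2 / rho)) => M s x y M1M Ks _ /isometric_isometry[phi [psi [h1 h2 h3 h4
  h5]]] cx cy.
have Mgt0 : 0 < M.+1%:R :> R by rewrite ltr0n.
have Mrho : 2 / M.+1%:R < rho.
  rewrite ltr_pdivrMr// mulrC -ltr_pdivrMr//; apply: lt_trans (archi_boundP _) _.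
    by rewrite divr_ge0// ltW.
  by rewrite ltr_nat.
pose f (i : nat) := bary_seg (i%:R / M.+1%:R) (phi x) (phi y).
have cf i : (i <= M.+1)%N -> closed_simplex K t (f i).
  move=> iM; apply: closed_simplex_seg; [exact: Kt|exact: h1|exact: h1|].
  by rewrite divr_ge0//= ler_pdivrMr// mul1r ler_nat.
exists (psi \o f); split=> /=.
- by rewrite /f mul0r bary_seg0 h3.
- by rewrite /f divff ?lt0r_neq0// bary_seg1 h3.
- by move=> i iM; apply/h2/cf.
move=> i iM; have ci := cf i (ltnW iM); have ci1 := cf i.+1 iM.
rewrite -h5 ?h4//; try exact: h2.
apply: hrho => //; apply: le_lt_trans Mrho; rewrite bary_dist_seg.
rewrite -mulrBl -[i.+1]addn1 natrD opprD addNKr normrM normrN1 mul1r.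
rewrite ger0_norm ?invr_ge0// mulrC ler_pM2r ?invr_gt0//.
exact: bary_dist_le2 (h1 _ cx).1 (h1 _ cy).1.
Qed.

End Chains.

(** * Stellar subdivisions *)

Lemma continuous_lipschitz (R : realType) (T U : Type) (X : set T) (dX : T -> T -> R)
    (dU : U -> U -> R) (f : T -> U) (C : R) : 0 < C ->
  (forall x y, X x -> X y -> dU (f x) (f y) <= C * dX x y) ->
  continuous_on X dX dU f.
Proof.
move=> C0 h x Xx e e0; exists (e / C); first by rewrite divr_gt0.
move=> y Xy; rewrite ltr_pdivlMr// mulrC; exact: le_lt_trans (h x y Xx Xy).
Qed.

Section FinPoint.
Context {R : realType} {W : finType}.
Implicit Types (x y : bary_point R W).

Lemma finsupp_sumE x : \sum_(v <- finsupp x) x v = \sum_v x v.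
Proof.
rewrite big_uniq ?fset_uniq//= [RHS](bigID (mem (finsupp x)))/=.
by rewrite [X in _ + X]big1 ?addr0// => v /bary_out.
Qed.

Lemma bary_dist_fin x y : bary_dist x y = \sum_v `|x v - y v|.
Proof.
rewrite /bary_dist big_uniq ?fset_uniq//= [RHS](bigID (mem (finsupp x `|` finsupp y)))/=.
rewrite [X in _ + X]big1 ?addr0// => v; rewrite inE negb_or.
by move=> /andP[/bary_out-> /bary_out->]; rewrite subrr normr0.
Qed.

Definition fin_point (h : W -> R) : bary_point R W :=
  [fsfun v in [fset w in enum W] => h v].

Lemma fin_pointE h v : fin_point h v = h v.
Proof. by rewrite fsfunE !inE mem_enum. Qed.

End FinPoint.

Section Stellar.
Context {R : realType} {W : finType} (P : simplicial_complex W).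
Variable s : {fset W}.
Hypotheses (Ps : P s) (s1 : (1 < #|` s|)%N).
Implicit Types (t : {fset option W}) (x : bary_point R (option W)) (y z : bary_point R W).

Definition somes t : {fset W} := [fset v in enum W | Some v \in t].

Lemma in_somes t v : (v \in somes t) = (Some v \in t).
Proof. by rewrite !inE mem_enum. Qed.

Lemma somes_sub t t' : t `<=` t' -> somes t `<=` somes t'.
Proof. by move/fsubsetP => tt'; apply/fsubsetP => v; rewrite !in_somes => /tt'. Qed.

(* The subdivision has one more vertex, [None], at the barycentre of [s];
   [collapse t] is the smallest simplex of [P] containing its simplex [t]. *)
Definition collapse t : {fset W} :=
  if None \in t then somes t `|` s else somes t.

Lemma somes_collapse t : somes t `<=` collapse t.
Proof. by rewrite /collapse; case: ifP => _; rewrite ?fsubsetUl ?fsubset_refl. Qed.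

Lemma collapse_sub t t' : t `<=` t' -> collapse t `<=` collapse t'.
Proof.
move=> tt'; have stt' := somes_sub tt'; rewrite /collapse.
case: ifPn => [Nt|_]; first by rewrite (fsubsetP tt' _ Nt) fsetUSS ?fsubset_refl.
by case: ifP => // _; apply: fsubset_trans stt' (fsubsetUl _ _).
Qed.

Lemma collapse_eq0 t : (collapse t == fset0) = (t == fset0).
Proof.
apply/eqP/eqP => [t0|->]; last first.
  by rewrite /collapse inE; apply/fsetP => v; rewrite in_somes !inE.
apply/fsetP => -[v|]; rewrite inE; apply/negP => h.
  by have := fsubsetP (somes_collapse t) v; rewrite t0 in_somes h inE => /(_ isT).
have : s `<=` collapse t by rewrite /collapse h fsubsetUr.
by rewrite t0 fsubset0 => /eqP s0; move: s1; rewrite s0 cardfs0.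
Qed.

Definition stellar_simplex t : Prop :=
  [/\ t != fset0, ~~ (s `<=` somes t) & P (collapse t)].

Program Definition stellar : simplicial_complex (option W) :=
  @SimplicialComplex _ stellar_simplex _ _ _.
Next Obligation. by move=> t []. Qed.
Next Obligation.
move=> v; split; first by apply/fset0Pn; exists v; rewrite inE.
  apply/negP => /fsubset_leq_card; rewrite leqNgt => /negP; apply.
  apply: leq_ltn_trans s1; case: v => [v|].
    by rewrite (_ : somes _ = [fset v]) ?cardfs1//; apply/fsetP => w; rewrite in_somes !inE.
  by rewrite (_ : somes _ = fset0) ?cardfs0//; apply/fsetP => w; rewrite in_somes !inE.
case: v => [v|]; rewrite /collapse !inE/=.
  rewrite (_ : somes _ = [fset v]); first exact: simplex_vertex.
  by apply/fsetP => w; rewrite in_somes !inE.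
by rewrite (_ : somes _ = fset0) ?fset0U//; apply/fsetP => w; rewrite in_somes !inE.
Qed.
Next Obligation.
move=> t' t [_ nt' Pt'] tt' t0; split=> //.
  by apply: contra nt' => /fsubset_trans; apply; exact: somes_sub.
by apply: simplex_face Pt' (collapse_sub tt') _; rewrite collapse_eq0.
Qed.

(** The affine extension that sends [None] to the barycentre of [s]. *)
Definition stellar_down (x : bary_point R (option W)) : bary_point R W :=
  fin_point (fun v => x (Some v) + (v \in s)%:R * (x None / #|` s|%:R)).

Let v0s : {v | v \in s}.
Proof.
by apply/sigW/fset0Pn; rewrite -cardfs_gt0 ltnW.
Qed.
Let v0 := sval v0s.

Definition min_on (y : bary_point R W) : R := y [arg min_(v < v0 in s) y v]%O.

Lemma min_onP y : (exists2 v, v \in s & min_on y = y v) /\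
  forall v, v \in s -> min_on y <= y v.
Proof.
rewrite /min_on; case: arg_minP => [|v vs vmin]; first exact: (svalP v0s).
by split; [exists v|].
Qed.

(** A simplex of the subdivision misses some vertex of [s], at which the only mass comes from the
    barycentre. The weight of [None] is therefore read off the least coordinate on [s]. *)
Definition stellar_up (y : bary_point R W) : bary_point R (option W) :=
  fin_point (fun o => if o is Some v then y v - (v \in s)%:R * min_on y
                      else #|` s|%:R * min_on y).

Let card0 : 0 < #|` s|%:R :> R.
Proof. by rewrite ltr0n ltnW. Qed.

Lemma sum_option (F : option W -> R) : \sum_o F o = F None + \sum_v F (Some v).
Proof.
rewrite (bigD1 None)//=; congr (_ + _).
rewrite (reindex_omap Some id)//=; last by case.
by apply: eq_bigl => v; rewrite eqxx.
Qed.

Lemma sum_s (a : R) : \sum_(v : W) (v \in s)%:R * a = #|` s|%:R * a.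
Proof.
rewrite -mulr_suml; congr (_ * _).
rewrite (bigID (mem s))/= [X in _ + X]big1 ?addr0; last by move=> v /negPf->.
rewrite (eq_bigr (fun=> 1)) => [|v ->//]; rewrite sumr_const; congr (_%:R).
by rewrite -(card_uniqP (fset_uniq s)); apply: eq_card.
Qed.

Lemma finsupp_stellar_down x : (forall o, 0 <= x o) ->
  finsupp (stellar_down x) = collapse (finsupp x).
Proof.
move=> x0; apply/fsetP => v; rewrite mem_finsupp fin_pointE.
have d0 : 0 <= (v \in s)%:R * (x None / #|` s|%:R) by rewrite mulr_ge0// divr_ge0.
rewrite paddr_eq0// negb_and /collapse (fun_if (fun A : {fset W} => v \in A)) inE in_somes.
rewrite !mem_finsupp mulf_eq0 negb_or mulf_eq0 negb_or invr_eq0 (lt0r_neq0 card0) andbT.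
rewrite pnatr_eq0 eqb0 negbK; case: (x None != 0); first by rewrite andbT.
by rewrite andbF orbF.
Qed.

Lemma stellar_down_realization x : realization stellar x -> realization P (stellar_down x).
Proof.
move=> [[_ _ Px] x0 x1]; split; first by rewrite finsupp_stellar_down.
  by move=> v; rewrite fin_pointE addr_ge0// mulr_ge0// divr_ge0.
rewrite finsupp_sumE; under eq_bigr do rewrite fin_pointE.
rewrite big_split/= sum_s mulrC divfK ?lt0r_neq0// addrC -sum_option.
by rewrite -finsupp_sumE.
Qed.

Lemma min_on_ge0 y : (forall v, 0 <= y v) -> 0 <= min_on y.
Proof. by move=> y0; have [[v _ ->] _] := min_onP y. Qed.

Lemma stellar_up_ge0 y : (forall v, 0 <= y v) -> forall o, 0 <= stellar_up y o.
Proof.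
move=> y0 [v|]; rewrite fin_pointE; last by rewrite mulr_ge0// min_on_ge0.
have [vs|vs] := boolP (v \in s); last by rewrite mul0r subr0.
by rewrite mul1r subr_ge0; apply: (min_onP y).2.
Qed.

Lemma stellar_upK y : stellar_down (stellar_up y) = y.
Proof.
apply/fsfunP => v; rewrite !fin_pointE mulrC [_ * min_on y]mulrC -mulrA.
by rewrite divff ?lt0r_neq0// mulr1 [min_on y * _]mulrC subrK.
Qed.

Lemma min_on_stellar_down x : realization stellar x ->
  min_on (stellar_down x) = x None / #|` s|%:R.
Proof.
move=> [[_ ns _] x0 _]; have /fsubsetPn[v vs vx] := ns; have {}vx : x (Some v) = 0.
  by apply: bary_out; rewrite -in_somes.
have [[w ws ->] wmin] := min_onP (stellar_down x).
apply/eqP; rewrite eq_le; apply/andP; split.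
  by have := wmin v vs; rewrite !fin_pointE vs ws vx !mul1r add0r.
by rewrite fin_pointE ws mul1r lerDr.
Qed.

Lemma stellar_downK x : realization stellar x -> stellar_up (stellar_down x) = x.
Proof.
move=> rx; apply/fsfunP => -[v|]; rewrite fin_pointE min_on_stellar_down//.
  by rewrite fin_pointE addrK.
by rewrite mulrC divfK ?lt0r_neq0.
Qed.

Lemma stellar_up_realization y : realization P y -> realization stellar (stellar_up y).
Proof.
move=> [Py y0 y1]; have u0 := stellar_up_ge0 y0.
have cE : collapse (finsupp (stellar_up y)) = finsupp y.
  by rewrite -finsupp_stellar_down// stellar_upK.
split=> //; last first.
  rewrite finsupp_sumE sum_option; under eq_bigr do rewrite fin_pointE.
  by rewrite fin_pointE sumrB sum_s addrC subrK -finsupp_sumE.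
split; last by rewrite cE.
  by rewrite -collapse_eq0 cE; exact: simplex_neq0 Py.
have [[v vs mv] _] := min_onP y; apply/fsubsetPn; exists v => //.
by rewrite in_somes mem_finsupp negbK fin_pointE vs mul1r mv subrr.
Qed.

Lemma min_on_lipschitz y z : `|min_on y - min_on z| <= bary_dist y z.
Proof.
suff h (a b : bary_point R W) : min_on a - min_on b <= bary_dist a b.
  by rewrite ler_norml lerNl opprB h bary_distC h.
have [[v vs ->] _] := min_onP b; have [_ /(_ v vs) le] := min_onP a.
apply: le_trans (bary_dist_coord a b v); apply: le_trans (ler_norm _).
by rewrite lerB.
Qed.

Lemma stellar_down_lipschitz x (y : bary_point R (option W)) :
  bary_dist (stellar_down x) (stellar_down y) <= bary_dist x y.
Proof.
rewrite !bary_dist_fin sum_option.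
apply: (@le_trans _ _ (\sum_v (`|x (Some v) - y (Some v)| +
    (v \in s)%:R * (`|x None - y None| / #|` s|%:R)))).
  apply: ler_sum => v _; rewrite !fin_pointE.
  rewrite (_ : _ - _ = (x (Some v) - y (Some v)) +
    (v \in s)%:R * ((x None - y None) / #|` s|%:R)); last by ring.
  apply: le_trans (ler_normD _ _) _; rewrite lerD2l !normrM normr_nat.
  by rewrite [X in _ * (_ * X)]gtr0_norm// invr_gt0.
by rewrite big_split/= sum_s mulrC divfK ?lt0r_neq0// addrC.
Qed.

Lemma stellar_up_lipschitz (x y : bary_point R W) :
  bary_dist (stellar_up x) (stellar_up y) <= (1 + 2 * #|` s|%:R) * bary_dist x y.
Proof.
rewrite [leLHS]bary_dist_fin sum_option !fin_pointE.
apply: (@le_trans _ _ (#|` s|%:R * bary_dist x y + \sum_v (`|x v - y v| +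
    (v \in s)%:R * bary_dist x y))).
  apply: lerD.
    by rewrite -mulrBr normrM normr_nat ler_pM2l// min_on_lipschitz.
  apply: ler_sum => v _; rewrite !fin_pointE.
  rewrite (_ : _ - _ = (x v - y v) - (v \in s)%:R * (min_on x - min_on y)); last by ring.
  apply: le_trans (ler_normB _ _) _; rewrite lerD2l normrM normr_nat.
  by rewrite ler_wpM2l// min_on_lipschitz.
by rewrite big_split/= sum_s -bary_dist_fin; lra.
Qed.

Lemma stellar_homeomorphism (Y : set (R * R)) (dY : R * R -> R * R -> R)
    (h : bary_point R W -> R * R) :
  homeomorphism_on (realization P) bary_dist Y dY h ->
  homeomorphism_on (realization stellar) bary_dist Y dY (h \o stellar_down).
Proof.
move=> [[hf hi hs] ch [g gK cg]]; split.
- split=> [x /stellar_down_realization/hf//|x x'|y /hs[z rz <-]].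
  + rewrite !inE => rx ry /= e; rewrite -(stellar_downK rx) -(stellar_downK ry).
    congr stellar_up; apply: hi e; rewrite inE; exact: stellar_down_realization.
  + exists (stellar_up z); first exact: stellar_up_realization.
    by rewrite /= stellar_upK.
- move=> x rx e e0; have [r r0 hr] := ch _ (stellar_down_realization rx) e e0.
  exists r => // y ry xy; apply: hr; first exact: stellar_down_realization.
  exact: le_lt_trans (stellar_down_lipschitz _ _) xy.
exists (stellar_up \o g) => [x rx|y Yy e e0] /=.
  by rewrite gK ?stellar_downK//; exact: stellar_down_realization.
have C0 : 0 < 1 + 2 * #|` s|%:R :> R by rewrite ltr_pwDl// mulr_ge0.
have [r r0 hr] := cg y Yy (e / (1 + 2 * #|` s|%:R)) (divr_gt0 e0 C0).
exists r => // z Yz yz; apply: le_lt_trans (stellar_up_lipschitz _ _) _.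
by rewrite mulrC -ltr_pdivlMr//; exact: hr.
Qed.

End Stellar.

(** * The round disc as a triangle *)

Section Radial.
Context {R : realType}.
Implicit Types (u v w p q : R * R).

Definition norm1 u : R := `|u.1| + `|u.2|.

Lemma edist_le_norm1 p q : edist p q <= norm1 (p.1 - q.1, p.2 - q.2).
Proof.
rewrite /edist /norm1 /=; move: (p.1 - q.1) (p.2 - q.2) => a b.
rewrite -[leRHS]ger0_norm ?addr_ge0// -sqrtr_sqr ler_wsqrtr//.
rewrite sqrrD !real_normK ?num_real//.
have : 0 <= `|a| * `|b| by rewrite mulr_ge0.
by rewrite -mulr_natl; lra.
Qed.

Lemma norm1_le_edist p q : norm1 (p.1 - q.1, p.2 - q.2) <= 2 * edist p q.
Proof.
rewrite /edist /norm1 /=; move: (p.1 - q.1) (p.2 - q.2) => a b.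
have ha : `|a| <= Num.sqrt (a ^+ 2 + b ^+ 2).
  by rewrite -sqrtr_sqr ler_wsqrtr// lerDl sqr_ge0.
have hb : `|b| <= Num.sqrt (a ^+ 2 + b ^+ 2).
  by rewrite -sqrtr_sqr ler_wsqrtr// lerDr sqr_ge0.
lra.
Qed.

(** A Minkowski functional that is comparable to the norm and Lipschitz, with one constant [c] for
    both. *)
Record gauge (c : R) (A : R * R -> R) : Prop := {
  gaugeZ : forall k u, 0 <= k -> A (k * u.1, k * u.2) = k * A u ;
  gauge_ge : forall u, norm1 u <= c * A u ;
  gauge_lip : forall u v, `|A u - A v| <= c * norm1 (u.1 - v.1, u.2 - v.2) }.

(** Preserves each ray from the origin and carries the level sets of [A] to those of [B]. At the
    origin the quotient is [0 / 0], but it multiplies zero coordinates. *)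
Definition radial (A B : R * R -> R) u : R * R := (A u / B u * u.1, A u / B u * u.2).

Variables (c : R) (A B : R * R -> R).
Hypotheses (c0 : 0 < c) (gA : gauge c A) (gB : gauge c B).

Lemma gauge_ge0 D u : gauge c D -> 0 <= D u.
Proof.
move=> gD; rewrite -(pmulr_rge0 _ c0); apply: le_trans (gauge_ge gD u).
by rewrite addr_ge0.
Qed.

Lemma gauge0 D : gauge c D -> D (0, 0) = 0.
Proof. by move=> gD; have := gaugeZ gD (0, 0) (lexx 0); rewrite /= !mul0r. Qed.

Lemma gauge_le D u : gauge c D -> D u <= c * norm1 u.
Proof.
move=> gD; have := gauge_lip gD u (0, 0); rewrite gauge0// !subr0 -surjective_pairing.
by apply: le_trans; exact: ler_norm.
Qed.

Lemma gauge_eq0 D u : gauge c D -> D u = 0 -> u = (0, 0).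
Proof.
move=> gD Du; have := gauge_ge gD u; rewrite Du mulr0 /norm1.
have := normr_ge0 u.1; have := normr_ge0 u.2 => h1 h2 h3.
have /normr0_eq0 u1 : `|u.1| = 0 by lra.
have /normr0_eq0 u2 : `|u.2| = 0 by lra.
by rewrite [u]surjective_pairing u1 u2.
Qed.

Lemma gauge_gt0 D u : gauge c D -> u <> (0, 0) -> 0 < D u.
Proof.
move=> gD u0; rewrite lt_neqAle gauge_ge0// andbT eq_sym.
by apply/eqP => /gauge_eq0-/(_ gD).
Qed.

Lemma radial0 : radial A B (0, 0) = (0, 0).
Proof. by rewrite /radial /= !mulr0. Qed.

Lemma gauge_radial u : B (radial A B u) = A u.
Proof.
have [->|u0] := pselect (u = (0, 0)); first by rewrite radial0 !gauge0.
rewrite /radial (gaugeZ gB) ?divr_ge0 ?gauge_ge0// divfK//.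
by rewrite lt0r_neq0// gauge_gt0.
Qed.

Lemma radial_lip : exists2 L, 0 < L & forall u v,
  norm1 ((radial A B u).1 - (radial A B v).1, (radial A B u).2 - (radial A B v).2) <=
  L * norm1 (u.1 - v.1, u.2 - v.2).
Proof.
have ratio u : 0 <= A u / B u <= c ^+ 2.
  rewrite divr_ge0 ?gauge_ge0//=.
  have [->|u0] := pselect (u = (0, 0)); first by rewrite !gauge0// mul0r sqr_ge0.
  rewrite ler_pdivrMr ?gauge_gt0//; apply: le_trans (gauge_le _ gA) _.
  by rewrite expr2 -mulrA ler_pM2l// gauge_ge.
have n1Z (k : R) w : norm1 (k * w.1, k * w.2) = `|k| * norm1 w.
  by rewrite /norm1 /= !normrM mulrDr.
have n1D w w' : norm1 (w.1 + w'.1, w.2 + w'.2) <= norm1 w + norm1 w'.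
  rewrite /norm1 /=; have := ler_normD w.1 w'.1; have := ler_normD w.2 w'.2; lra.
have n10 w : 0 <= norm1 w by rewrite addr_ge0.
have c20 : 0 < c ^+ 2 by rewrite exprn_gt0.
have cc0 : 0 < c * (c ^+ 2 * c + c) by rewrite mulr_gt0// addr_gt0// mulr_gt0.
exists (c ^+ 2 + c * (c ^+ 2 * c + c)); first by rewrite addr_gt0.
move=> u v; set D := norm1 (u.1 - v.1, u.2 - v.2); have D0 : 0 <= D by exact: n10.
have [uE|u0] := pselect (u = (0, 0)).
  have -> : D = norm1 v by rewrite /D uE /norm1 /= !sub0r !normrN.
  rewrite uE radial0 !sub0r /radial /=.
  rewrite (_ : norm1 _ = norm1 (A v / B v * v.1, A v / B v * v.2));
    last by rewrite /norm1 /= !normrN.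
  rewrite n1Z; have /andP[r0 rc] := ratio v; rewrite ger0_norm//.
  apply: ler_wpM2r => //; lra.
set a := A u / B u; set b := A v / B v.
have -> : ((radial A B u).1 - (radial A B v).1, (radial A B u).2 - (radial A B v).2) =
  (a * (u.1 - v.1) + (a - b) * v.1, a * (u.2 - v.2) + (a - b) * v.2).
  by rewrite /radial /= -/a -/b; congr (_, _); ring.
apply: le_trans (n1D (a * (u.1 - v.1), a * (u.2 - v.2)) ((a - b) * v.1, (a - b) * v.2)) _.
rewrite (n1Z a (u.1 - v.1, u.2 - v.2)) n1Z -/D mulrDl; apply: lerD.
  by have /andP[r0 rc] := ratio u; rewrite ger0_norm// ler_wpM2r.
apply: (@le_trans _ _ (`|a - b| * (c * B v))); first by rewrite ler_wpM2l// gauge_ge.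
rewrite mulrCA -mulrA ler_pM2l//.
have [->|v0] := pselect (v = (0, 0)).
  by rewrite gauge0// mulr0 mulr_ge0// ltW// addr_gt0// mulr_gt0.
have Bv := gauge_gt0 gB v0; have Bu := gauge_gt0 gB u0.
rewrite -[X in _ * X]gtr0_norm// -normrM.
(* No quotient is differenced in this form: the gauges are Lipschitz and [a] is at most [c ^+ 2]. *)
have -> : (a - b) * B v = a * (B v - B u) + (A u - A v).
  by rewrite /a /b; field; rewrite !lt0r_neq0.
apply: le_trans (ler_normD _ _) _; rewrite mulrDl; apply: lerD; last exact: gauge_lip.
rewrite normrM -mulrA; apply: ler_pM => //.
  by have /andP[r0 rc] := ratio u; rewrite ger0_norm.
by rewrite distrC; exact: gauge_lip.
Qed.

End Radial.

Lemma radialK (R : realType) (c : R) (A B : R * R -> R) (u : R * R) :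
  0 < c -> gauge c A -> gauge c B -> radial B A (radial A B u) = u.
Proof.
move=> c0 gA gB; have [->|u0] := pselect (u = (0, 0)); first by rewrite !radial0.
have Au := gauge_gt0 c0 gA u0; have Bu := gauge_gt0 c0 gB u0.
rewrite {1}/radial (gauge_radial c0 gA gB).
have -> : A (radial A B u) = A u / B u * A u by rewrite /radial (gaugeZ gA)// divr_ge0// ltW.
rewrite /radial [RHS]surjective_pairing /=.
by congr (_, _); field; rewrite !lt0r_neq0.
Qed.

Section TriangleDisc.
Context {R : realType}.
Implicit Types (x y : bary_point R 'I_3) (u v w : R * R).

Definition euclid_gauge u : R := edist u (0, 0).

Lemma gauge_euclid : gauge 4 euclid_gauge.
Proof.
have E0 u : 0 <= euclid_gauge u by exact: sqrtr_ge0.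
split.
- move=> k u k0; rewrite /euclid_gauge /edist /= !subr0 !exprMn -mulrDr.
  by rewrite sqrtrM ?sqr_ge0// sqrtr_sqr ger0_norm.
- move=> u; have := norm1_le_edist u (0, 0); rewrite !subr0 -surjective_pairing.
  have := E0 u; rewrite /euclid_gauge; lra.
- move=> u v; set D := norm1 _; have D0 : 0 <= D by rewrite addr_ge0.
  suff h : `|euclid_gauge u - euclid_gauge v| <= D by lra.
  have coord w : `|w.1| <= euclid_gauge w /\ `|w.2| <= euclid_gauge w.
    rewrite /euclid_gauge /edist !subr0; split; rewrite -sqrtr_sqr ler_wsqrtr//.
      by rewrite lerDl sqr_ge0.
    by rewrite lerDr sqr_ge0.
  have sq w : euclid_gauge w ^+ 2 = w.1 ^+ 2 + w.2 ^+ 2.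
    by rewrite /euclid_gauge /edist !subr0 sqr_sqrtr// addr_ge0// sqr_ge0.
  have [s0|s0] := eqVneq (euclid_gauge u + euclid_gauge v) 0.
    have := E0 u; have := E0 v => h1 h2.
    by rewrite (_ : _ - _ = 0) ?normr0//; lra.
  have sp : 0 < euclid_gauge u + euclid_gauge v by rewrite lt_neqAle eq_sym s0 addr_ge0.
  rewrite -(ler_pM2r sp) -[X in _ * X <= _](gtr0_norm sp) -normrM -subr_sqr !sq.
  have -> : u.1 ^+ 2 + u.2 ^+ 2 - (v.1 ^+ 2 + v.2 ^+ 2) =
    (u.1 - v.1) * (u.1 + v.1) + (u.2 - v.2) * (u.2 + v.2) by ring.
  apply: le_trans (ler_normD _ _) _; rewrite !normrM /D /norm1 mulrDl /=.
  have [u1 u2] := coord u; have [v1 v2] := coord v.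
  apply: lerD; apply: ler_wpM2l => //; apply: le_trans (ler_normD _ _) _; lra.
Qed.

(* This is [1 - 3 * m], [m] being the least barycentric coordinate of the point
   that [proj] below maps to [u]. *)
Definition triangle_gauge u : R :=
  Num.max (u.1 + u.2) (Num.max (u.2 - 2 * u.1) (u.1 - 2 * u.2)).

Lemma triangle_gaugeP u g : triangle_gauge u <= g <->
  [/\ u.1 + u.2 <= g, u.2 - 2 * u.1 <= g & u.1 - 2 * u.2 <= g].
Proof.
by rewrite /triangle_gauge !ge_max; split=> [/and3P[]|[-> -> ->]].
Qed.

Lemma gauge_triangle : gauge 4 triangle_gauge.
Proof.
split.
- move=> k u k0; rewrite /triangle_gauge /= !maxr_pMr//.
  by rewrite mulrDr !mulrBr !(mulrCA k 2).
- move=> u; have /triangle_gaugeP[] := lexx (triangle_gauge u).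
  set g := triangle_gauge u; rewrite /norm1 => h1 h2 h3.
  have a1 : `|u.1| <= 2 * g by rewrite ler_norml; apply/andP; split; lra.
  have a2 : `|u.2| <= 2 * g by rewrite ler_norml; apply/andP; split; lra.
  lra.
- move=> u v; suff h w w' : triangle_gauge w <= triangle_gauge w' + 4 * norm1 (w.1 - w'.1,
  w.2 - w'.2).
    rewrite ler_norml lerNl opprB; have := h u v; have := h v u.
    rewrite /norm1 /= (distrC v.1) (distrC v.2) => h1 h2.
    by apply/andP; split; lra.
  have /triangle_gaugeP[h1 h2 h3] := lexx (triangle_gauge w').
  have := ler_norm (w.1 - w'.1); have := ler_norm (w.2 - w'.2).
  have := ler_norm (w'.1 - w.1); have := ler_norm (w'.2 - w.2).
  rewrite (distrC w'.1) (distrC w'.2).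
  rewrite /norm1 /=; set a := `|w.1 - w'.1|; set b := `|w.2 - w'.2| => n1 n2 n3 n4.
  apply/triangle_gaugeP; split; lra.
Qed.

Program Definition full_simplex (W : choiceType) : simplicial_complex W :=
  @SimplicialComplex W (fun s => s != fset0) _ _ _.
Next Obligation. by []. Qed.
Next Obligation. by move=> W v; apply/fset0Pn; exists v; rewrite inE. Qed.
Next Obligation. by []. Qed.

Let i0 : 'I_3 := Ordinal (isT : 0 < 3)%N.
Let i1 : 'I_3 := Ordinal (isT : 1 < 3)%N.
Let i2 : 'I_3 := Ordinal (isT : 2 < 3)%N.

Let ord3P (i : 'I_3) : [\/ i = i0, i = i1 | i = i2].
Proof.
by case: i => [[|[|[|//]]] ?]; [apply: Or31|apply: Or32|apply: Or33]; exact: val_inj.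
Qed.

Let sum3 (f : 'I_3 -> R) : \sum_i f i = f i0 + f i1 + f i2.
Proof.
rewrite !big_ord_recl big_ord0 addr0 addrA.
by congr (f _ + f _ + f _); exact: val_inj.
Qed.

(** The barycentre goes to the origin, which makes the boundary of the triangle a level set of a
    gauge. *)
Let proj x : R * R := (x i0 - x i2, x i1 - x i2).

Let lift u : bary_point R 'I_3 := fin_point (fun i => match val i with
  | 0%N => 1 / 3 + (2 * u.1 - u.2) / 3
  | 1%N => 1 / 3 + (2 * u.2 - u.1) / 3
  | _ => 1 / 3 - (u.1 + u.2) / 3 end).

Let liftE u : [/\ lift u i0 = 1 / 3 + (2 * u.1 - u.2) / 3,
  lift u i1 = 1 / 3 + (2 * u.2 - u.1) / 3 & lift u i2 = 1 / 3 - (u.1 + u.2) / 3].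
Proof. by split; rewrite fin_pointE. Qed.

Let rea3 x : realization (full_simplex 'I_3) x <->
  (forall i, 0 <= x i) /\ x i0 + x i1 + x i2 = 1.
Proof.
split=> [[_ x0]|[x0 x1]]; first by rewrite finsupp_sumE sum3.
have x1' : \sum_(v <- finsupp x) x v = 1 by rewrite finsupp_sumE sum3.
split=> //=; apply/eqP => xs; move: x1'; rewrite xs big_seq_fset0 => /eqP.
by rewrite eq_sym oner_eq0.
Qed.

Let proj_lift u : proj (lift u) = u.
Proof.
have [h0 h1 h2] := liftE u.
by rewrite /proj h0 h1 h2 [RHS]surjective_pairing; congr (_, _); lra.
Qed.

Let lift_proj x : realization (full_simplex 'I_3) x -> lift (proj x) = x.
Proof.
move=> /rea3[_ x1]; have [h0 h1 h2] := liftE (proj x).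
by apply/fsfunP => i; case: (ord3P i) => ->; rewrite ?h0 ?h1 ?h2 /proj /=; lra.
Qed.

Let gauge_proj x : realization (full_simplex 'I_3) x -> triangle_gauge (proj x) <= 1.
Proof.
move=> /rea3[x0 x1]; have := x0 i0; have := x0 i1; have := x0 i2 => h2 h1 h0.
by apply/triangle_gaugeP; rewrite /proj /=; split; lra.
Qed.

Let lift_real u : triangle_gauge u <= 1 -> realization (full_simplex 'I_3) (lift u).
Proof.
move=> /triangle_gaugeP[g1 g2 g3]; have [h0 h1 h2] := liftE u.
apply/rea3; rewrite h0 h1 h2; split; last by lra.
by move=> i; case: (ord3P i) => ->; rewrite ?h0 ?h1 ?h2; lra.
Qed.

Let gauge_proj1 x : realization (full_simplex 'I_3) x ->
  triangle_gauge (proj x) = 1 <-> exists i, x i = 0.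
Proof.
move=> rx; have le1 := gauge_proj rx; have /rea3[x0 x1] := rx.
split=> [g1|[i xi]].
  apply: contrapT => /forallNP nx.
  have pos i : 0 < x i by rewrite lt_neqAle x0 andbT eq_sym; apply/eqP/nx.
  have := pos i0; have := pos i1; have := pos i2 => h2 h1 h0.
  move: g1; rewrite /triangle_gauge /proj /= => /eqP; apply/negP.
  by rewrite lt_eqF// !gt_max; apply/and3P; split; lra.
apply/eqP; rewrite eq_le le1 /= leNgt; apply/negP => lt.
have /triangle_gaugeP[g1 g2 g3] := lexx (triangle_gauge (proj x)).
move: g1 g2 g3 lt xi; set g := triangle_gauge _; rewrite /proj /= => g1 g2 g3 lt.
by case: (ord3P i) => -> xi; lra.
Qed.

Let disc u : unit_disc R u <-> euclid_gauge u <= 1.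
Proof.
rewrite /unit_disc /euclid_gauge /edist /= !subr0; split=> h.
  by rewrite -(sqrtr1 R) ler_wsqrtr.
rewrite -(@sqr_sqrtr _ (_ + _)) ?addr_ge0 ?sqr_ge0//.
by rewrite -(expr1n R 2) lerXn2r ?nnegrE ?sqrtr_ge0// ler01.
Qed.

Let circle u : unit_circle R u <-> euclid_gauge u = 1.
Proof.
rewrite /unit_circle /euclid_gauge /edist /= !subr0; split=> [->|h].
  by rewrite sqrtr1.
by rewrite -(@sqr_sqrtr _ (_ + _)) ?addr_ge0 ?sqr_ge0// h expr1n.
Qed.

Let lift_lip a b : bary_dist (lift a) (lift b) <= 4 * norm1 (a.1 - b.1, a.2 - b.2).
Proof.
rewrite bary_dist_fin sum3.
have [-> -> ->] := liftE a; have [-> -> ->] := liftE b; rewrite /norm1 /=.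
rewrite (_ : 1 / 3 + (2 * a.1 - a.2) / 3 - _ = (2 * (a.1 - b.1) - (a.2 - b.2)) / 3);
  last by field.
rewrite (_ : 1 / 3 + (2 * a.2 - a.1) / 3 - _ = (2 * (a.2 - b.2) - (a.1 - b.1)) / 3);
  last by field.
rewrite (_ : 1 / 3 - (a.1 + a.2) / 3 - _ = - ((a.1 - b.1) + (a.2 - b.2)) / 3); last by field.
rewrite !normrM normrN (ger0_norm (x := 3^-1)) ?invr_ge0//.
move: (a.1 - b.1) (a.2 - b.2) => p q.
have := ler_normB (2 * p) q; have := ler_normB (2 * q) p; have := ler_normD p q.
rewrite !normrM (ger0_norm (x := 2))//.
have := normr_ge0 p; have := normr_ge0 q; lra.
Qed.

Lemma triangle_disc : disc_triangulation R (full_simplex 'I_3) (id : 'I_3 -> 'I_3).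
Proof.
have c0 : 0 < 4 :> R by [].
have gT := gauge_triangle; have gE := gauge_euclid.
split=> [//|i /=|]; first by apply/fset0Pn; exists i; rewrite !inE eqxx.
pose h x := radial triangle_gauge euclid_gauge (proj x).
pose g w := lift (radial euclid_gauge triangle_gauge w).
have hE x : euclid_gauge (h x) = triangle_gauge (proj x) by exact: gauge_radial c0 gT gE _.
have gK x : realization (full_simplex 'I_3) x -> g (h x) = x.
  by move=> rx; rewrite /g /h (radialK _ c0 gT gE) lift_proj.
exists h; first split; first split.
- by move=> x rx; apply/disc; rewrite hE; exact: gauge_proj.
- by move=> x y; rewrite !inE => rx ry hxy; rewrite -(gK x)// hxy gK.
- move=> w /disc w1; exists (g w).
    by apply: lift_real; rewrite (gauge_radial c0 gE gT).
  by rewrite /h /g proj_lift (radialK _ c0 gE gT).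
- have [L L0 hL] := radial_lip c0 gT gE.
  apply: (@continuous_lipschitz _ _ _ _ _ _ _ (L * 2)); first by rewrite mulr_gt0.
  move=> x y _ _; apply: le_trans (edist_le_norm1 _ _) _; apply: le_trans (hL _ _) _.
  rewrite -mulrA ler_pM2l// /norm1 /proj /= bary_dist_fin sum3.
  have := ler_normB (x i0 - y i0) (x i2 - y i2); have := ler_normB (x i1 - y i1) (x i2 - y i2).
  rewrite (_ : x i0 - x i2 - _ = x i0 - y i0 - (x i2 - y i2)); last by ring.
  rewrite (_ : x i1 - x i2 - _ = x i1 - y i1 - (x i2 - y i2)); last by ring.
  have := normr_ge0 (x i0 - y i0); have := normr_ge0 (x i1 - y i1); lra.
- exists g => //; have [L L0 hL] := radial_lip c0 gE gT.
  apply: (@continuous_lipschitz _ _ _ _ _ _ _ (4 * L * 2)); first by rewrite !mulr_gt0.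
  move=> u v _ _; apply: le_trans (lift_lip _ _) _.
  rewrite -!mulrA ler_pM2l//; apply: le_trans (hL _ _) _.
  by rewrite ler_pM2l//; exact: norm1_le_edist.
move=> x rx; rewrite circle hE gauge_proj1//; split=> [[i xi]|[i [_ /fsubsetP xs]]].
  (* The edge opposite to the vertex [i] is the one that starts at [ordS i]. *)
  exists (ordS i); split=> //; apply/fsubsetP => j.
  rewrite mem_finsupp !inE; apply: contraR; rewrite negb_or => /andP[j1 j2].
  suff -> : j = i by rewrite xi.
  by move: j1 j2; case: (ord3P i) => ->; case: (ord3P j) => ->.
exists (ordS (ordS i)); apply: bary_out; apply/negP => /xs.
by rewrite !inE; case: (ord3P i) => ->.
Qed.

End TriangleDisc.

Local Open Scope nat_scope.

(** * Fillings of a loop with an open star *)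

Section Steps.
Context {T : eqType}.
Implicit Types (x y : T) (p w : seq T) (e : T * T).

Fixpoint steps x p := if p is y :: q then (x, y) :: steps y q else [::].

Definition cyc_steps w := if w is x :: p then steps x (rcons p x) else [::].

Lemma steps_rcons x p y : steps x (rcons p y) = rcons (steps x p) (last x p, y).
Proof. by elim: p x => //= z p IH x; rewrite IH. Qed.

Lemma steps_mem x p e : e \in steps x p -> e.1 \in x :: p /\ e.2 \in p.
Proof.
elim: p x => //= z p IH x; rewrite in_cons => /predU1P[->|/IH[h1 h2]] /=.
  by rewrite !inE !eqxx.
by split; [rewrite h1 orbT|rewrite in_cons h2 orbT].
Qed.

Lemma in_cyc_steps x p e :
  (e \in cyc_steps (x :: p)) = (e \in steps x p) || (e == (last x p, x)).
Proof. by rewrite /= steps_rcons mem_rcons inE orbC. Qed.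

Lemma cyc_steps_rot w : cyc_steps (rot 1 w) =i cyc_steps w.
Proof.
case: w => [|x [|y p]] // e; rewrite rot1_cons.
rewrite !in_cyc_steps /= steps_rcons mem_rcons last_rcons !inE.
by rewrite orbC orbA orbAC.
Qed.

(** By uniqueness [x] occurs only in the first step, and this step does not reach the last vertex
    when [p] has two entries or more. *)
Lemma steps_not_closing x p e : uniq (x :: p) -> (1 < size p)%N ->
  e \in steps x p -> ~ (x \in [:: e.1; e.2] /\ last x p \in [:: e.1; e.2]).
Proof.
case: p => [|y [|z q]] // /= /andP[xn /andP[yn _]] _.
have ln : last z q \in z :: q by rewrite mem_last.
have lx : last z q != x by apply: contraNneq xn => <-; rewrite inE ln orbT.
have ly : last z q != y by apply: contraNneq yn => <-.
rewrite inE => /predU1P[-> /=|ye] [].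
  by rewrite !inE (negPf lx) (negPf ly).
have /steps_mem[e1 e2] : e \in steps y (z :: q) by [].
have e2' : e.2 \in y :: z :: q by rewrite inE e2 orbT.
by rewrite !inE => /orP[] /eqP xe; move: xn; rewrite xe ?e1 ?e2'.
Qed.

End Steps.

Lemma steps_map (T U : eqType) (f : T -> U) x p :
  steps (f x) (map f p) = [seq (f e.1, f e.2) | e <- steps x p].
Proof. by elim: p x => //= y p IH x; rewrite IH. Qed.

Lemma somes_imfset (W : finType) (t : {fset option W}) (s : {fset W}) :
  None \notin t -> somes t `<=` s -> t `<=` [fset Some v | v in s].
Proof.
move=> nt ts; apply/fsubsetP => -[v|] vt; last by rewrite vt in nt.
by apply: in_imfset; apply: (fsubsetP ts); rewrite in_somes.
Qed.

Ltac eq_cases v := repeat match goal with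
  |- context [v == ?a] => case: (v == a) end; done.

Section StellarDisc.
Variable R : realType.

(** The disc map is precomposed with [stellar_down], which turns the carrier of a point into its
    collapse. Only the boundary faces before and after remain to be compared, and this is
    combinatorial. *)
Lemma stellar_disc (W : finType) (P : simplicial_complex W) (s : {fset W})
    (Ps : P s) (s1 : (1 < #|` s|)%N) j (b : 'I_j -> W) j' (b' : 'I_j' -> option W) :
  disc_triangulation R P b -> injective b' ->
  (forall i, stellar Ps s1 [fset b' i; b' (ordS i)]) ->
  (forall t, stellar Ps s1 t ->
    (exists i, collapse s t `<=` [fset b i; b (ordS i)]) <->
    (exists i, t `<=` [fset b' i; b' (ordS i)])) ->
  disc_triangulation R (stellar Ps s1) b'.
Proof.
move=> [_ _ [h hh hb]] b'i b'e hbb; split=> //.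
exists (h \o stellar_down s); first exact: stellar_homeomorphism.
move=> x rx; have [Kx x0 _] := rx.
have dE := finsupp_stellar_down s1 x0.
have rd := stellar_down_realization rx.
have e1 : (exists i, closed_simplex P [fset b i; b (ordS i)] (stellar_down s x)) <->
    exists i, collapse s (finsupp x) `<=` [fset b i; b (ordS i)].
  by split=> -[i]; [move=> [_]; rewrite dE; exists i|exists i; split; rewrite ?dE].
have e2 : (exists i, closed_simplex (stellar Ps s1) [fset b' i; b' (ordS i)] x) <->
    exists i, finsupp x `<=` [fset b' i; b' (ordS i)].
  by split=> -[i]; [move=> [_]; exists i|exists i; split].
by rewrite /= hb// e1 e2; exact: hbb.
Qed.

(** The star of [o] is a cone over the polygon [w], so [w] lists the link of [o] in cyclic order. *)
Record fan (W : finType) (P : simplicial_complex W) (o : W) (w : seq W) : Prop := {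
  fan_uniq : uniq (o :: w) ;
  fan_size : (2 < size w)%N ;
  fan_in : forall s, P s -> o \in s ->
    exists2 e, e \in cyc_steps w & s `<=` [fset o; e.1; e.2] ;
  fan_simplex : forall e, e \in cyc_steps w -> P [fset o; e.1; e.2] }.

Lemma fan_rot (W : finType) (P : simplicial_complex W) o w :
  fan P o w -> fan P o (rot 1 w).
Proof.
move=> [h1 h2 h3 h4]; split.
- by move: h1; rewrite /= rot_uniq mem_rot.
- by rewrite size_rot.
- by move=> s Ps /(h3 s Ps)[e ew se]; exists e => //; rewrite cyc_steps_rot.
- by move=> e; rewrite cyc_steps_rot; exact: h4.
Qed.

Lemma stellar_fan_face (W : finType) (P : simplicial_complex W) (s : {fset W})
    (Ps : P s) (s1 : (1 < #|` s|)%N) o w t :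
  fan P o w -> stellar Ps s1 t -> Some o \in t ->
  exists e, [/\ e \in cyc_steps w, collapse s t `<=` [fset o; e.1; e.2],
    forall v, Some v \in t -> v \in [:: o; e.1; e.2] &
    None \in t -> {subset s <= [:: o; e.1; e.2]}].
Proof.
move=> fP [_ _ Pt] ot.
have [e ew te] := fan_in fP Pt (fsubsetP (somes_collapse s t) _ (etrans (in_somes _ _) ot)).
exists e; split=> // [v vt|nt v vs].
  have := fsubsetP te v (fsubsetP (somes_collapse s t) _ (etrans (in_somes _ _) vt)).
  by rewrite !inE orbA.
have := fsubsetP te v; rewrite /collapse nt !inE vs orbT => /(_ isT).
by rewrite orbA.
Qed.

Lemma in_collapse (W : finType) (s : {fset W}) t v :
  (v \in collapse s t) = (Some v \in t) || ((None \in t) && (v \in s)).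
Proof. by rewrite /collapse; case: ifP => _; rewrite ?in_fsetU in_somes ?orbF. Qed.

Lemma eq_Some (W : eqType) (v w : W) : (Some v == Some w) = (v == w).
Proof. by []. Qed.

Lemma uniq_Some (W : eqType) (o : W) w :
  uniq (o :: w) -> uniq [:: Some o, None & map Some w].
Proof.
have sinj : injective (@Some W) by move=> a b [].
rewrite !cons_uniq in_cons (mem_map sinj) (map_inj_uniq sinj) /= => /andP[-> ->].
by rewrite andbT; apply/mapP => -[].
Qed.

(** Once the edge from [o] to [y] is starred, no simplex contains both ends: [y] leaves the link and
    the new vertex takes its place between the two neighbours. *)
Lemma fan_replace (W : finType) (P : simplicial_complex W) o y p
    (Ps : P [fset o; y]) (s1 : (1 < #|` [fset o; y]|)%N) :
  fan P o (y :: p) -> fan (stellar Ps s1) (Some o) (None :: map Some p).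
Proof.
move=> fP; have [] := fP; case: p fP => [|z p] // fP.
rewrite [uniq _]/= => /and3P[on yn up] pz fin fs.
have {}up : uniq (z :: p) by [].
have yo : y != o by apply: contraNneq on => ->; rewrite mem_head.
have yz : y != z by apply: contraNneq yn => ->; rewrite mem_head.
have ln : last z p \in z :: p by rewrite mem_last.
have yl : y != last z p by apply: contraNneq yn => ->.
have notin e : e \in steps z p -> y \notin [:: e.1; e.2].
  move/steps_mem=> [e1 e2]; rewrite !inE negb_or.
  by apply/andP; split; apply: contraNneq yn => ->; rewrite // inE e2 orbT.
have cycE e : e \in cyc_steps (None :: map Some (z :: p)) ->
    [\/ e = (None, Some z), e = (Some (last z p), None) |
      exists2 e', e' \in steps z p & e = (Some e'.1, Some e'.2)].
  rewrite in_cyc_steps /= last_map steps_map inE -orbA.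
  case/or3P=> [/eqP->|/mapP[e' e'p ->]|/eqP->]; first by apply: Or31.
    by apply: Or33; exists e'.
  exact: Or32.
have cyc1 : (None, Some z) \in cyc_steps (None :: map Some (z :: p)).
  by rewrite in_cyc_steps /= mem_head.
have cyc2 : (Some (last z p), None) \in cyc_steps (None :: map Some (z :: p)).
  by rewrite in_cyc_steps /= last_map eqxx orbT.
have cyc3 e : e \in steps z p -> (Some e.1, Some e.2) \in cyc_steps (None :: map Some (z :: p)).
  move=> ep; rewrite in_cyc_steps /= steps_map inE; apply/orP; left; apply/orP; right.
  exact: (map_f (fun e => (Some e.1, Some e.2))).
split.
- apply: uniq_Some; rewrite cons_uniq up andbT.
  by move: on; rewrite in_cons negb_or => /andP[].
- by move: pz; rewrite /= size_map.
- move=> t st ot; have [e [ew te tv tn]] := stellar_fan_face fP st ot.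
  have yt : Some y \notin t.
    have [_ nst _] := st; apply: contra nst => yt; apply/fsubsetP => v.
    by rewrite in_somes !inE => /orP[] /eqP->.
  move: ew; rewrite in_cyc_steps /= inE -orbA => /or3P[/eqP ee|ep|/eqP ee].
  + exists (None, Some z) => //; apply/fsubsetP => -[v|] vt; last by rewrite !inE eqxx orbT.
    have := tv v vt; rewrite ee !inE /= => /or3P[]/eqP vE; rewrite vE ?eqxx ?orbT//.
    by rewrite -vE vt in yt.
  + exists (Some e.1, Some e.2); first exact: cyc3.
    apply/fsubsetP => -[v /tv|/tn sy]; first by rewrite !inE orbA.
    have := sy y; rewrite !inE eqxx orbT => /(_ isT).
    by rewrite (negPf yo) /=; have := notin e ep; rewrite !inE => /negPf->.
  + exists (Some (last z p), None) => //; apply/fsubsetP => -[v|] vt;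
    last by rewrite !inE eqxx orbT.
    have := tv v vt; rewrite ee !inE /= => /or3P[]/eqP vE; rewrite vE ?eqxx ?orbT//.
    by rewrite -vE vt in yt.
- have base t e : e \in cyc_steps (y :: z :: p) -> Some o \in t -> y \notin somes t ->
      collapse [fset o; y] t `<=` [fset o; e.1; e.2] -> stellar Ps s1 t.
    move=> ew ot yt te; split.
    + by apply/fset0Pn; exists (Some o).
    + by apply/fsubsetPn; exists y => //; rewrite !inE eqxx orbT.
    + apply: simplex_face (fs _ ew) te _.
      apply/fset0Pn; exists o; apply: (fsubsetP (somes_collapse _ _)).
      by rewrite in_somes.
  move=> e /cycE[->|->|[e' ep ->]] /=.
  + apply: (base _ (y, z)).
    * by rewrite in_cyc_steps /= mem_head.
    * by rewrite !inE eqxx.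
    * by rewrite in_somes !inE !eq_Some orbF negb_or yo yz.
    * by apply/fsubsetP => v; rewrite in_collapse !inE !eq_Some /=; eq_cases v.
  + apply: (base _ (last z p, y)).
    * by rewrite in_cyc_steps eqxx orbT.
    * by rewrite !inE eqxx.
    * by rewrite in_somes !inE !eq_Some orbF negb_or yo yl.
    * by apply/fsubsetP => v; rewrite in_collapse !inE !eq_Some /=; eq_cases v.
  + apply: (base _ e').
    * by rewrite in_cyc_steps /= in_cons ep orbT.
    * by rewrite !inE eqxx.
    * by have := notin e' ep; rewrite in_somes !inE !eq_Some (negPf yo).
    * by apply/fsubsetP => v; rewrite in_collapse !inE !eq_Some /= ?orbF.
Qed.

(** Two cases in one: [s] may be the triangle on [o], [y] and the last vertex, to lengthen the link
    inside the disc, or its edge opposite to [o], to lengthen the boundary of a cone. *)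
Lemma fan_insert (W : finType) (P : simplicial_complex W) o y p s
    (Ps : P s) (s1 : (1 < #|` s|)%N) :
  y \in s -> last y p \in s -> s `<=` [fset o; y; last y p] ->
  fan P o (y :: p) -> fan (stellar Ps s1) (Some o) (None :: map Some (y :: p)).
Proof.
move=> ys ls sS fP; have [uw pz fin fs] := fP.
have /= /and3P[on yn up] := uw; have {}up : uniq (y :: p) by rewrite cons_uniq yn.
have yo : y != o by apply: contraNneq on => ->; rewrite mem_head.
have lo : last y p != o by apply: contraNneq on => <-; rewrite mem_last.
have ly : last y p != y.
  apply: contraNneq yn => {1}<-; move: pz; case: (p) => // a q _.
  by rewrite /= mem_last.
have notin e : e \in steps y p -> ~~ ((y \in [:: e.1; e.2]) && (last y p \in [:: e.1; e.2])).
  by move=> ep; apply/negP => /andP; apply: steps_not_closing ep.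
have cycE e : e \in cyc_steps (None :: map Some (y :: p)) ->
    [\/ e = (None, Some y), e = (Some (last y p), None) |
      exists2 e', e' \in steps y p & e = (Some e'.1, Some e'.2)].
  rewrite in_cyc_steps /= last_map steps_map inE -orbA.
  case/or3P=> [/eqP->|/mapP[e' e'p ->]|/eqP->]; first by apply: Or31.
    by apply: Or33; exists e'.
  exact: Or32.
have cyc1 : (None, Some y) \in cyc_steps (None :: map Some (y :: p)).
  by rewrite in_cyc_steps /= mem_head.
have cyc2 : (Some (last y p), None) \in cyc_steps (None :: map Some (y :: p)).
  by rewrite in_cyc_steps /= last_map eqxx orbT.
have cyc3 e : e \in steps y p -> (Some e.1, Some e.2) \in cyc_steps (None :: map Some (y :: p)).
  move=> ep; rewrite in_cyc_steps /= steps_map inE; apply/orP; left; apply/orP; right.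
  exact: (map_f (fun e => (Some e.1, Some e.2))).
split.
- exact: (@uniq_Some _ o (y :: p)) uw.
- by rewrite /= size_map ltnW.
- move=> t st ot; have [e [ew te tv tn]] := stellar_fan_face fP st ot.
  have missing : (Some y \notin t) || (Some (last y p) \notin t).
    have [_ nst _] := st; rewrite -negb_and; apply: contra nst => /andP[yt lt].
    apply/fsubsetP => v /(fsubsetP sS); rewrite in_somes !inE -orbA.
    by case/or3P=> /eqP->.
  move: ew; rewrite in_cyc_steps => /orP[ep|/eqP ee].
    exists (Some e.1, Some e.2); first exact: cyc3.
    apply/fsubsetP => -[v /tv|/tn sub]; first by rewrite !inE orbA.
    have := notin e ep; have := sub y ys; have := sub _ ls.
    by rewrite !inE (negPf yo) (negPf lo) /= => -> ->.
  case/orP: missing => ny.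
    exists (Some (last y p), None) => //; apply/fsubsetP => -[v|] vt;
      last by rewrite !inE eqxx orbT.
    have := tv v vt; rewrite ee !inE /= => /or3P[]/eqP vE; rewrite ?vE ?eqxx ?orbT//.
    by rewrite -vE vt in ny.
  exists (None, Some y) => //; apply/fsubsetP => -[v|] vt; last by rewrite !inE eqxx orbT.
  have := tv v vt; rewrite ee !inE /= => /or3P[]/eqP vE; rewrite ?vE ?eqxx ?orbT//.
  by rewrite -vE vt in ny.
- have base t e : e \in cyc_steps (y :: p) -> Some o \in t ->
      (y \notin somes t) || (last y p \notin somes t) ->
      collapse s t `<=` [fset o; e.1; e.2] -> stellar Ps s1 t.
    move=> ew ot yt te; split.
    + by apply/fset0Pn; exists (Some o).
    + by case/orP: yt => yt; apply/fsubsetPn; [exists y|exists (last y p)].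
    + apply: simplex_face (fs _ ew) te _.
      apply/fset0Pn; exists o; apply: (fsubsetP (somes_collapse _ _)).
      by rewrite in_somes.
  have closing : (last y p, y) \in cyc_steps (y :: p) by rewrite in_cyc_steps eqxx orbT.
  have sS' v : v \in s -> [|| v == o, v == y | v == last y p].
    by move=> /(fsubsetP sS); rewrite !inE orbA.
  move=> e /cycE[->|->|[e' ep ->]] /=.
  + apply: (base _ _ closing).
    * by rewrite !inE eqxx.
    * by rewrite !in_somes !inE !eq_Some !orbF !negb_or lo ly orbT.
    * apply/fsubsetP => v; rewrite in_collapse !inE !eq_Some /=.
      by have := sS' v; case: (v \in s) => [/(_ isT)|_]; eq_cases v.
  + apply: (base _ _ closing).
    * by rewrite !inE eqxx.
    * by rewrite !in_somes !inE !eq_Some !orbF !negb_or yo eq_sym ly.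
    * apply/fsubsetP => v; rewrite in_collapse !inE !eq_Some /=.
      by have := sS' v; case: (v \in s) => [/(_ isT)|_]; eq_cases v.
  + apply: (base _ e').
    * by rewrite in_cyc_steps ep.
    * by rewrite !inE eqxx.
    * have := notin e' ep; rewrite !in_somes !inE !eq_Some (negPf yo) (negPf lo) /=.
      by rewrite negb_and.
    * by apply/fsubsetP => v; rewrite in_collapse !inE !eq_Some /= ?orbF.
Qed.

End StellarDisc.

Lemma cardfs3_le (T : choiceType) (u v w : T) : #|` [fset u; v; w]| <= 3.
Proof.
rewrite !cardfsU !cardfs1; apply: leq_trans (leq_subr _ _) _.
by rewrite addn1 ltnS leq_subr.
Qed.

(** * Labelled discs and moves on the loop around the open star *)

Section OpenFilling.
Variable R : realType.
Variables (V : choiceType) (K : simplicial_complex V).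

Lemma skeleton_triangle (T : choiceType) (f : T -> V) (t : {fset T}) u v w :
  K [fset u; v; w] -> t != fset0 -> (forall x, x \in t -> f x \in [fset u; v; w]) ->
  skeleton K 2 (f @` t).
Proof.
move=> Kuvw t0 tuvw.
have sub : f @` t `<=` [fset u; v; w].
  by apply/fsubsetP => _ /imfsetP[x xt ->]; exact: tuvw.
split.
  apply: simplex_face Kuvw sub _; have /fset0Pn[x xt] := t0.
  by apply/fset0Pn; exists (f x); exact: in_imfset.
exact: leq_trans (fsubset_leq_card sub) (cardfs3_le _ _ _).
Qed.

(* The triangles of the star of [o] are not labelled yet: [l] is the loop of
   the labels of the link of [o], and [n] bounds the number of the other
   triangles. *)
Definition open_filling j (c : 'I_j -> V) (l : seq V) (n : nat) : Prop :=
  exists (W : finType) (P : simplicial_complex W) (b : 'I_j -> W) (o : W)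
    (w : seq W) (f : W -> V) (L : seq {fset W}),
  [/\ disc_triangulation R P b, fan P o w, map f w = l & forall i, f (b i) = c i] /\
  [/\ forall i, b i != o,
      forall s, P s -> o \notin s -> skeleton K 2 (f @` s),
      (size L <= n)%N &
      forall s, P s -> o \notin s -> #|` s| = 3 -> s \in L].

Variables (j : nat) (c : 'I_j -> V).

Lemma open_filling_rot l n : open_filling c l n -> open_filling c (rot 1 l) n.
Proof.
move=> [W [P [b [o [w [f [L [[h1 h2 h3 h4] h]]]]]]]].
exists W, P, b, o, (rot 1 w), f, L; split=> //; split=> //; first exact: fan_rot.
by rewrite map_rot h3.
Qed.

Section Step.
Variables (W : finType) (P : simplicial_complex W) (b : 'I_j -> W) (o : W).
Variables (f : W -> V) (s : {fset W}) (Ps : P s) (s1 : (1 < #|` s|)%N) (k : V).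

Definition label_option (v : option W) : V := if v is Some v then f v else k.

(** The starred simplex contains [o], which is off the boundary cycle, so no boundary face is
    subdivided. *)
Lemma stellar_star_disc : o \in s -> (forall i, b i != o) ->
  disc_triangulation R P b -> disc_triangulation R (stellar Ps s1) (Some \o b).
Proof.
move=> os bo Pb; have [bi Pe _] := Pb.
have somesE i : somes [fset Some (b i); Some (b (ordS i))] = [fset b i; b (ordS i)].
  by apply/fsetP => v; rewrite in_somes !inE !eq_Some.
apply: (stellar_disc Pb).
- by move=> x y [/bi].
- move=> i; split=> /=.
  + by apply/fset0Pn; exists (Some (b i)); rewrite !inE eqxx.
  + by rewrite somesE; apply/fsubsetPn; exists o; rewrite // !inE !(eq_sym o) negb_or !bo.
  + rewrite (_ : collapse s _ = [fset b i; b (ordS i)])//; apply/fsetP => v.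
    by rewrite in_collapse !inE !eq_Some /= orbF.
move=> t _; split=> -[i /fsubsetP ti]; exists i; apply/fsubsetP.
  move=> [v|] vt /=; first by have := ti v; rewrite in_collapse vt !inE !eq_Some => /(_ isT).
  have := ti o; rewrite in_collapse vt os orbT !inE !(eq_sym o) => /(_ isT).
  by rewrite (negPf (bo _)) (negPf (bo _)).
move=> v; rewrite in_collapse => /orP[/ti|/andP[/ti]] /=; rewrite !inE ?eq_Some//.
Qed.

(** Simplices without [None] and [o] are old ones, with their old labels. Only those containing the
    new vertex but not [o] have to be labelled, and their triangles are listed in [L']. *)
Lemma open_filling_stellar w w' L L' n :
  disc_triangulation R P b -> fan P o w -> (forall i, f (b i) = c i) ->
  (forall i, b i != o) ->
  (forall s, P s -> o \notin s -> skeleton K 2 (f @` s)) ->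
  (size L <= n)%N -> (forall s, P s -> o \notin s -> #|` s| = 3 -> s \in L) ->
  o \in s -> fan (stellar Ps s1) (Some o) w' ->
  (forall t, stellar Ps s1 t -> Some o \notin t -> None \in t ->
    exists y z, [/\ K [fset k; f y; f z], t `<=` [fset None; Some y; Some z] &
      [fset None; Some y; Some z] \in L']) ->
  open_filling c (map label_option w') (n + size L').
Proof.
move=> Pb fP fb bo fK Ln LP os fP' new.
exists (option W), (stellar Ps s1), (Some \o b), (Some o), w', label_option.
exists ([seq [fset Some v | v in s] | s : {fset W} <- L] ++ L').
have oldP t : stellar Ps s1 t -> Some o \notin t -> None \notin t ->
    [/\ P (somes t), o \notin somes t & t = [fset Some v | v in somes t]].
  move=> [_ _ Pt] ot nt; split.
  + by move: Pt; rewrite /collapse (negPf nt).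
  + by rewrite in_somes.
  + apply/eqP; rewrite eqEfsubset somes_imfset// ?fsubset_refl//.
    by apply/fsubsetP => _ /imfsetP[v /= vt ->]; rewrite -in_somes.
split; split=> //; first exact: stellar_star_disc.
- move=> t st ot; have [nt|nt] := boolP (None \in t); last first.
    have [Pt ot' tE] := oldP t st ot nt; rewrite tE -imfset_comp.
    exact: fK.
  have [y [z [Kyz tyz _]]] := new t st ot nt.
  apply: skeleton_triangle Kyz _ _; first by case: st.
  by move=> v /(fsubsetP tyz); rewrite !inE -orbA => /or3P[]/eqP->; rewrite /= eqxx ?orbT.
- by rewrite size_cat size_map leq_add2r.
- move=> t st ot t3; rewrite mem_cat; have [nt|nt] := boolP (None \in t); last first.
    have [Pt ot' tE] := oldP t st ot nt; apply/orP; left; rewrite tE.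
    by apply: map_f; apply: LP => //; move: t3; rewrite {1}tE card_imfset.
  have [y [z [Kyz tyz L'yz]]] := new t st ot nt.
  suff -> : t = [fset None; Some y; Some z] by rewrite L'yz orbT.
  apply/eqP; rewrite eqEfcard tyz t3.
  exact: cardfs3_le.
Qed.

End Step.

(** The vertex pushed out of the link keeps its label [u]; it spans one new triangle with [None] and
    each of its two former neighbours. *)
Lemma open_filling_replace u v l k n : open_filling c (u :: v :: l) n ->
  K [fset k; u; v] -> K [fset k; u; last v l] ->
  open_filling c (k :: v :: l) (n + 2).
Proof.
move=> [W [P [b [o [w [f [L [[Pb fP fw fb] [bo fK Ln LP]]]]]]]]] Kv Kl.
case: w fP fw => [|y [|z p]] // fP [fy fz fp].
have [uw pz fin fs] := fP; have yo : y != o.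
  by move: uw => /= /andP[on _]; apply: contraNneq on => ->; rewrite mem_head.
have s1 : (1 < #|` [fset o; y]|)%N by rewrite cardfs2 eq_sym yo.
have e1 : (y, z) \in cyc_steps [:: y, z & p] by rewrite in_cyc_steps mem_head.
have e2 : (last z p, y) \in cyc_steps [:: y, z & p] by rewrite in_cyc_steps eqxx orbT.
have Ps : P [fset o; y].
  apply: simplex_face (fs _ e1) _ _; last by apply/fset0Pn; exists o; rewrite !inE eqxx.
  by apply/fsubsetP => a; rewrite !inE => ->.
have -> : k :: v :: l = map (label_option f k) (None :: map Some (z :: p)).
  by rewrite /= -map_comp /= fz -fp.
apply: (open_filling_stellar (L' := [:: [fset None; Some y; Some z]; [fset None; Some y;
  Some (last z p)]]) Pb fP fb bo fK Ln LP _ (fan_replace Ps s1 fP)).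
  by rewrite !inE eqxx.
move=> t st ot nt; have [_ nst Pt] := st.
have oc : o \in collapse [fset o; y] t by rewrite in_collapse nt !inE eqxx orbT.
have yc : y \in collapse [fset o; y] t by rewrite in_collapse nt !inE eqxx !orbT.
have [e ew /fsubsetP te] := fin _ Pt oc.
have sub a : e = (a, y) \/ e = (y, a) -> t `<=` [fset None; Some y; Some a].
  move=> ee; apply/fsubsetP => -[x|] xt; last by rewrite !inE eqxx.
  have xo : x != o by apply: contraNneq ot => <-.
  have := te x; rewrite in_collapse xt => /(_ isT).
  by case: ee => ->; rewrite !inE !eq_Some (negPf xo) /=; eq_cases x.
have fl : f (last z p) = last v l by rewrite -fz -fp last_map.
move: ew; rewrite in_cyc_steps [steps _ _]/= in_cons -orbA => /or3P[/eqP ee|ep|/eqP ee].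
- exists y, z; rewrite fy fz; split; rewrite ?mem_head//.
  by apply: sub; right.
- have [e1' e2'] := steps_mem ep; have e2'' : e.2 \in z :: p by rewrite in_cons e2' orbT.
  have yn : y \notin z :: p by move: uw; rewrite /= => /and3P[].
  have := te y yc; rewrite !inE (negPf yo) /= => /orP[] /eqP yE.
    by rewrite yE e1' in yn.
  by rewrite yE e2'' in yn.
- exists y, (last z p); rewrite fy fl; split; rewrite ?in_cons ?eqxx ?orbT//.
  by apply: sub; left.
Qed.

(** Of the three pieces of the starred triangle, just the one opposite to [o] leaves the star. *)
Lemma open_filling_insert u l k n : open_filling c (u :: l) n ->
  K [fset k; u; last u l] -> open_filling c (k :: u :: l) (n + 1).
Proof.
move=> [W [P [b [o [w [f [L [[Pb fP fw fb] [bo fK Ln LP]]]]]]]]] Kl.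
case: w fP fw => [|y p] // fP [fy fp].
have [uw pz fin fs] := fP; have yo : y != o.
  by move: uw => /= /andP[on _]; apply: contraNneq on => ->; rewrite mem_head.
have [on up] : o \notin y :: p /\ uniq (y :: p) by move: uw => /= /andP[].
have lo : last y p != o by apply: contraNneq on => <-; rewrite mem_last.
pose s := [fset o; y; last y p].
have s1 : (1 < #|` s|)%N.
  apply: (@leq_trans #|` [fset o; y]|); first by rewrite cardfs2 eq_sym yo.
  by apply: fsubset_leq_card; apply/fsubsetP => a; rewrite !inE => ->.
have e2 : (last y p, y) \in cyc_steps (y :: p) by rewrite in_cyc_steps eqxx orbT.
have Ps : P s.
  rewrite (_ : s = [fset o; last y p; y]); first exact: fs e2.
  by apply/fsetP => a; rewrite !inE /= orbAC.
have -> : k :: u :: l = map (label_option f k) (None :: map Some (y :: p)).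
  by rewrite /= -map_comp /= fy -fp.
have fP' : fan (stellar Ps s1) (Some o) (None :: map Some (y :: p)).
  by apply: fan_insert; rewrite ?fsubset_refl// !inE eqxx ?orbT.
apply: (open_filling_stellar (L' := [:: [fset None; Some y;
  Some (last y p)]]) Pb fP fb bo fK Ln LP _ fP').
  by rewrite !inE eqxx.
move=> t st ot nt; have [_ nst Pt] := st.
have cs a : a \in s -> a \in collapse s t by move=> as_; rewrite in_collapse nt as_ orbT.
have oc : o \in collapse s t by apply: cs; rewrite !inE eqxx.
have [e ew /fsubsetP te] := fin _ Pt oc.
exists y, (last y p); rewrite fy -(last_map f) fy fp; split; rewrite ?mem_head//.
move: ew; rewrite in_cyc_steps => /orP[ep|/eqP ee].
  exfalso; apply: (steps_not_closing up _ ep) => //.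
  have := te y (cs _ _); rewrite !inE eqxx orbT => /(_ isT); rewrite (negPf yo) /= => ->.
  by have := te (last y p) (cs _ _); rewrite !inE eqxx !orbT => /(_ isT); rewrite (negPf lo).
apply/fsubsetP => -[x|] xt; last by rewrite !inE eqxx.
have xo : x != o by apply: contraNneq ot => <-.
have := te x; rewrite in_collapse xt ee => /(_ isT).
by rewrite !inE !eq_Some (negPf xo) /=; eq_cases x.
Qed.

Lemma open_filling_close l n k : open_filling c l n ->
  (forall e, e \in cyc_steps l -> K [fset k; e.1; e.2]) ->
  capped_off R K c (n + size l).
Proof.
move=> [W [P [b [o [w [f [L [[Pb fP fw fb] [bo fK Ln LP]]]]]]]]] Kl.
have [_ _ fin fs] := fP.
pose g v := if v == o then k else f v.
exists W, P, b, g; split=> //; last by move=> i; rewrite /g (negPf (bo i)).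
- pose LL := L ++ [seq [fset o; e.1; e.2] | e <- cyc_steps w].
  have sizeLL : (size LL <= n + size l)%N.
    rewrite size_cat size_map -fw size_map leq_add//.
    by case: (w) => //= x p; rewrite steps_rcons size_rcons; elim: p x => //= ? ? IH ?;
      exact: IH.
  have LLP s : P s -> #|` s| = 3 -> s \in LL.
    move=> Ps s3; rewrite mem_cat; have [os|os] := boolP (o \in s); last by rewrite LP.
    have [e ew se] := fin s Ps os; apply/orP; right; apply/mapP; exists e => //.
    apply/eqP; rewrite eqEfcard se s3.
    exact: cardfs3_le.
  set A := [set s | _]%classic.
  (* Triangles are counted by their position in the list [LL], which embeds them into an initial
     segment. *)
  have inj : {in A &, injective (index^~ LL)}.
    move=> s s'; rewrite !inE => -[Ps s3] [Ps' s3'] e.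
    by rewrite -(nth_index s (LLP s Ps s3)) e nth_index// LLP.
  rewrite -(card_le_eql (inj_card_eq inj)); apply: subset_card_le => _ [s [Ps s3] <-] /=.
  by apply: leq_trans sizeLL; rewrite index_mem LLP.
- move=> s Ps; have [os|os] := boolP (o \in s); last first.
    have -> : g @` s = f @` s.
      apply: eq_in_imfset => // v vs; rewrite /g; case: eqP => // vo.
      by move: os; rewrite -vo vs.
    exact: fK.
  have [e ew se] := fin s Ps os.
  have [e1 e2] : e.1 \in w /\ e.2 \in w.
    case: (w) ew => // x p; rewrite in_cyc_steps => /orP[/steps_mem[-> h]|/eqP->] /=.
      by rewrite in_cons h orbT.
    by rewrite mem_head mem_last.
  have on : o \notin w by case: fP => /= /andP[].
  have go v : v \in w -> g v = f v.
    by move=> vw; rewrite /g; case: eqP => // vo; move: on; rewrite -vo vw.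
  apply: (skeleton_triangle (u := k) (v := f e.1) (w := f e.2)).
  + apply: (Kl (f e.1, f e.2)); rewrite -fw; case: (w) ew => // x p.
    rewrite /= -map_rcons steps_map => ew.
    exact: (map_f (fun e => (f e.1, f e.2)) ew).
  + exact: simplex_neq0 Ps.
  + move=> v /(fsubsetP se); rewrite !inE -orbA => /or3P[]/eqP->.
    * by rewrite /g eqxx eqxx.
    * by rewrite go// eqxx orbT.
    * by rewrite go// eqxx !orbT.
Qed.

End OpenFilling.

(** * The disc as a cone on a cycle *)

Section ConeDisc.
Variable R : realType.

Definition cone_disc j : Prop :=
  exists (W : finType) (P : simplicial_complex W) (b : 'I_j -> W) (o : W),
  [/\ disc_triangulation R P b, fan P o (codom b) &
      forall s, P s -> o \notin s -> exists i, s `<=` [fset b i; b (ordS i)]].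

(** The full triangle is starred at its centre: the boundary is unchanged and the new vertex is the
    apex. *)
Lemma cone_disc3 : cone_disc 3.
Proof.
pose s : {fset 'I_3} := [fset i in enum 'I_3].
have sall i : i \in s by rewrite !inE mem_enum.
have s1 : 1 < #|` s|.
  have sub : [fset ord0; ord_max] `<=` s by apply/fsubsetP => i _.
  by apply: leq_trans (fsubset_leq_card sub); rewrite cardfs2.
have Ps : full_simplex 'I_3 s by apply/fset0Pn; exists ord0.
have ord3 (i k : 'I_3) : [|| k == i, k == ordS i | k == ordS (ordS i)].
  by case: i => [[|[|[|//]]] ?]; case: k => [[|[|[|//]]] ?].
have ordS3 (i : 'I_3) : ordS (ordS i) \notin [:: i; ordS i].
  by case: i => [[|[|[|//]]] ?].
have miss t : stellar Ps s1 t -> exists i, Some (ordS (ordS i)) \notin t.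
  move=> [_ /fsubsetPn[k _ kt] _]; exists (ordS k).
  by move: kt; rewrite in_somes; case: k => [[|[|[|//]]] ?]; congr (~~ (Some _ \in t));
    exact: val_inj.
have missP (t : {fset option 'I_3}) (i : 'I_3) : Some (ordS (ordS i)) \notin t -> forall v,
  Some v \in t -> (v == i) || (v == ordS i).
  move=> it v vt; have := ord3 i v; rewrite orbA => /orP[//|/eqP vi].
  by rewrite -vi vt in it.
have full t : t != fset0 -> ~~ (s `<=` somes t) -> stellar Ps s1 t.
  by move=> t0 st; split=> //=; rewrite collapse_eq0.
have edge i : stellar Ps s1 [fset Some i; Some (ordS i)].
  apply: full; first by apply/fset0Pn; exists (Some i); rewrite !inE eqxx.
  by apply/fsubsetPn; exists (ordS (ordS i)); rewrite // in_somes; have := ordS3 i;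
    rewrite !inE !eq_Some.
have enum3 : enum 'I_3 = [:: ord0; ordS ord0; ordS (ordS ord0)].
  by apply: (inj_map val_inj); rewrite val_enum_ord.
have cycE (e : option 'I_3 * option 'I_3) :
    e \in cyc_steps (codom (@Some 'I_3)) <-> exists i, e = (Some i, Some (ordS i)).
  rewrite codomE enum3 /= !inE; split.
    case/or3P=> /eqP->; [exists ord0|exists (ordS ord0)|exists (ordS (ordS ord0))] => //.
    by congr (_, Some _); exact: val_inj.
  case=> i ->; case: i => [[|[|[|//]]] ?]; apply/or3P;
    [apply: Or31|apply: Or32|apply: Or33]; apply/eqP; congr (Some _, Some _); exact: val_inj.
exists (option 'I_3), (stellar Ps s1), (@Some 'I_3), None; split.
- apply: (stellar_disc (triangle_disc (R := R))); first by move=> ? ? [].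
    exact: edge.
  move=> t st; split=> -[i /fsubsetP ti]; exists i; apply/fsubsetP.
    move=> [v|] vt; first by have := ti v; rewrite in_collapse vt !inE !eq_Some => /(_ isT).
    have := ti (ordS (ordS i)); rewrite in_collapse vt sall orbT => /(_ isT).
    by have := ordS3 i; rewrite !inE => /negPf->.
  move=> v; rewrite in_collapse => /orP[/ti|/andP[/ti]]; by rewrite !inE ?eq_Some.
- split.
  + rewrite codomE enum3; by [].
  + by rewrite codomE enum3.
  + move=> t st nt; have [i it] := miss t st; exists (Some i, Some (ordS i));
    first by apply/cycE; exists i.
    apply/fsubsetP => -[v /(missP t i it)|]; last by rewrite !inE eqxx.
    by rewrite !inE !eq_Some.
  + move=> e /cycE[i ->]; apply: full; first by apply/fset0Pn; exists None; rewrite !inE eqxx.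
    apply/fsubsetPn; exists (ordS (ordS i)); rewrite // in_somes.
    by have := ordS3 i; rewrite !inE !eq_Some.
- move=> t st nt; have [i it] := miss t st; exists i.
  apply/fsubsetP => -[v /(missP t i it)|vt]; last by rewrite vt in nt.
  by rewrite !inE !eq_Some.
Qed.

(** The edge from the last boundary vertex to the first is starred. Its only triangle is the one
    with the apex, so the new vertex enters both the boundary and the link. *)
Lemma cone_discS m : 1 < m -> cone_disc m.+1 -> cone_disc m.+2.
Proof.
move=> m1 [W [P [b [o [Pb fP out]]]]]; have [bi Pe _] := Pb.
have ordSmax : ordS (ord_max : 'I_m.+1) = ord0 by apply: val_inj; rewrite /= modnn.
have ordSmax' : ordS (ord_max : 'I_m.+2) = lift ord_max ord0.
  by apply: val_inj; rewrite /= modnn.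
have val_lift (k : 'I_m.+1) : lift ord_max k = k :> nat.
  by rewrite /= /bump leqNgt ltn_ord.
have ordS_lift (k : 'I_m.+1) : k != ord_max -> ordS (lift ord_max k) = lift ord_max (ordS k).
  move=> km; have klt : k < m.
    rewrite ltn_neqAle -ltnS ltn_ord andbT; apply: contra km => /eqP km.
    by apply/eqP/val_inj.
  apply: ord_inj; rewrite val_lift.
  rewrite -[LHS]/((lift ord_max k).+1 %% m.+2) val_lift /= !modn_small//.
  by rewrite ltnS ltnW.
have ordS_liftmax : ordS (lift ord_max (ord_max : 'I_m.+1)) = ord_max.
  apply: ord_inj; rewrite -[LHS]/((lift ord_max (ord_max : 'I_m.+1)).+1 %% m.+2).
  by rewrite val_lift modn_small.
set y := b ord0; set l := b ord_max.
have yl : y != l by rewrite (inj_eq bi); apply/eqP => /(congr1 val) /= m0; rewrite -m0 in m1.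
pose s := [fset y; l].
have Ps : P s by have := Pe ord_max; rewrite ordSmax -/y -/l fsetUC.
have s1 : 1 < #|` s| by rewrite cardfs2 yl.
have onotin i : b i != o.
  by apply: contraTneq (fan_uniq fP) => bo; rewrite /= -bo codom_f.
have sedge i : y \in [fset b i; b (ordS i)] -> l \in [fset b i; b (ordS i)] -> i = ord_max.
  rewrite !inE !(inj_eq bi) => h1 h2; apply/eqP; apply: contraT => im.
  have ilt : i < m.
    rewrite ltn_neqAle -ltnS ltn_ord andbT; apply: contra im => /eqP im.
    by apply/eqP/val_inj.
  move: h2; rewrite (eq_sym _ i) (negPf im) /= => /eqP /(congr1 val) /=.
  rewrite modn_small// => mi; move: h1 => /orP[]/eqP /(congr1 val) /= i0.
    by move: m1; rewrite mi -i0.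
  by move: i0; rewrite modn_small.
(* The new vertex gets the last index, which places it between [b ord_max] and [b ord0] in the
   cyclic order. *)
pose b' (i : 'I_m.+2) : option W := omap b (unlift ord_max i).
have b'l k : b' (lift ord_max k) = Some (b k) by rewrite /b' liftK.
have b'm : b' ord_max = None by rewrite /b' unlift_none.
have missing t : stellar Ps s1 t -> (Some y \notin t) || (Some l \notin t).
  move=> [_ nst _]; rewrite -negb_and; apply: contra nst => /andP[yt lt].
  by apply/fsubsetP => v; rewrite in_somes !inE => /orP[]/eqP->.
have edges_down t i : stellar Ps s1 t -> collapse s t `<=` [fset b i; b (ordS i)] ->
    exists i', t `<=` [fset b' i'; b' (ordS i')].
  move=> st /fsubsetP ti.
  have tv v : Some v \in t -> v \in [fset b i; b (ordS i)].
    by move=> vt; apply: ti; rewrite in_collapse vt.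
  have [im|im] := eqVneq i ord_max; last first.
    exists (lift ord_max i); rewrite ordS_lift// !b'l; apply/fsubsetP => -[v /tv|nt].
      by rewrite !inE !eq_Some.
    move: im; rewrite (sedge i) ?eqxx//; apply: ti; rewrite in_collapse nt !inE eqxx ?orbT//.
  move: tv; rewrite im ordSmax -/y -/l => tv; have /orP[yt|lt] := missing t st.
    exists (lift ord_max ord_max); rewrite ordS_liftmax b'l b'm -/l.
    apply/fsubsetP => -[v vt|]; last by rewrite !inE eqxx orbT.
    have := tv v vt; rewrite !inE eq_Some => /orP[->//|/eqP vy].
    by rewrite vy (negPf yt) in vt.
  exists ord_max; rewrite ordSmax' b'l b'm -/y.
  apply/fsubsetP => -[v vt|]; last by rewrite !inE eqxx.
  have := tv v vt; rewrite !inE eq_Some => /orP[/eqP vy|->//].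
  by rewrite vy (negPf lt) in vt.
have ySl : y \in s /\ l \in s by rewrite !inE !eqxx orbT.
have b'i : injective b'.
  move=> i k; case: (unliftP ord_max i) => [i' ->|->];
    case: (unliftP ord_max k) => [k' ->|->] //;
  by rewrite ?b'l ?b'm //; move=> [/bi->].
have b'e i : stellar Ps s1 [fset b' i; b' (ordS i)].
  have yl' : l != y by rewrite eq_sym.
  case: (unliftP ord_max i) => [k ->|->].
    have [->|km] := eqVneq k ord_max.
      rewrite ordS_liftmax b'l b'm -/l; split.
      + by apply/fset0Pn; exists None; rewrite !inE eqxx orbT.
      + by apply/fsubsetPn; exists y; rewrite ?in_somes !inE ?eqxx ?eq_Some// (negPf yl).
      + rewrite (_ : collapse _ _ = s)//; apply/fsetP => v.
        by rewrite in_collapse !inE !eq_Some /=; eq_cases v.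
    rewrite ordS_lift// !b'l; split.
    + by apply/fset0Pn; exists (Some (b k)); rewrite !inE eqxx.
    + apply: contra km => /fsubsetP sk; apply/eqP; have [ys ls] := ySl.
      have /(_ _ ys) := sk _; have /(_ _ ls) := sk _.
      rewrite !in_somes !inE !eq_Some => h1 h2.
      by apply: sedge; rewrite !inE.
    + rewrite (_ : collapse _ _ = [fset b k; b (ordS k)])//; apply/fsetP => v.
      by rewrite in_collapse !inE !eq_Some /= orbF.
  rewrite ordSmax' b'l b'm -/y; split.
  + by apply/fset0Pn; exists None; rewrite !inE eqxx.
  + by apply/fsubsetPn; exists l;
    rewrite ?in_somes !inE ?eqxx ?eq_Some ?orbT// orbF (negPf yl').
  + rewrite (_ : collapse _ _ = s)//; apply/fsetP => v.
    by rewrite in_collapse !inE !eq_Some /=; eq_cases v.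
exists (option W), (stellar Ps s1), b', (Some o); split.
- apply: (stellar_disc Pb) => // t st; split=> [[i ti]|[i /fsubsetP ti]].
    exact: edges_down st ti.
  case: (unliftP ord_max i) ti => [k ->|->].
    have [->|km] := eqVneq k ord_max.
      rewrite ordS_liftmax b'l b'm -/l => ti; exists ord_max; rewrite ordSmax -/l -/y.
      apply/fsubsetP => v; rewrite in_collapse => /orP[/ti|/andP[_]].
        by rewrite !inE !eq_Some orbF => ->.
      by rewrite !inE orbC.
    rewrite ordS_lift// !b'l => ti; exists k.
    apply/fsubsetP => v; rewrite in_collapse => /orP[/ti|/andP[/ti]]; by rewrite !inE ?eq_Some.
  rewrite ordSmax' b'l b'm -/y => ti; exists ord_max; rewrite ordSmax -/l -/y.
  apply/fsubsetP => v; rewrite in_collapse => /orP[/ti|/andP[_]].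
    by rewrite !inE !eq_Some /= => ->; rewrite orbT.
  by rewrite !inE orbC.
- have codom_b : codom b = y :: [seq b (lift ord0 i) | i <- enum 'I_m].
    by rewrite codomE enum_ordSl /= -map_comp.
  have last_b : last y [seq b (lift ord0 i) | i <- enum 'I_m] = l.
    rewrite (last_nth y) size_map size_enum_ord -[y :: _]codom_b codomE.
    rewrite (nth_map ord0) ?size_enum_ord// /l; congr b; apply: ord_inj.
    by rewrite nth_enum_ord.
  have -> : codom b' = rot 1 (None :: map Some (codom b)).
    rewrite rot1_cons codomE enum_ordSr map_rcons b'm codomE -!map_comp; congr rcons.
    apply: eq_map => i /=; rewrite -b'l; congr b'; apply: ord_inj.
    by rewrite val_lift.
  apply: fan_rot; move: fP; rewrite codom_b => fP.
  have [ys ls] := ySl.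
  apply: fan_insert; rewrite ?last_b//.
  by apply/fsubsetP => v; rewrite !inE => /orP[->|->]; rewrite ?orbT.
- move=> t st ot; have [_ _ Pt] := st.
  have oc : o \notin collapse s t.
    rewrite in_collapse (negPf ot) !inE !(eq_sym o) (negPf (onotin _)) (negPf (onotin _)).
    by rewrite andbF.
  have [i ti] := out _ Pt oc; exact: edges_down st ti.
Qed.

Lemma cone_disc_all j : 2 < j -> cone_disc j.
Proof.
elim: j => // j IH; rewrite ltnS leq_eqVlt => /predU1P[<-|j2]; first exact: cone_disc3.
by case: j j2 IH => // m j2 IH; apply: cone_discS (IH j2).
Qed.

(** Off the apex the cone consists of boundary vertices and edges, so no triangle is counted yet. *)
Lemma open_filling_start (V : choiceType) (K : simplicial_complex V) j (c : 'I_j -> V) :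
  2 < j -> combinatorial_loop K c -> open_filling R K c (codom c) 0.
Proof.
move=> j2 loop; have [W [P [b [o [Pb fP out]]]]] := cone_disc_all j2.
have [bi Pe _] := Pb.
pose v0 := c (Ordinal (ltnW (ltnW j2))).
pose f w := if [pick i | b i == w] is Some i then c i else v0.
have fb i : f (b i) = c i.
  rewrite /f; case: pickP => [k /eqP/bi->//|/(_ i)].
  by rewrite eqxx.
have Kc i : K [fset c i; c (ordS i)].
  case: (loop i) => [[_]//|->]; rewrite fsetUid; exact: simplex_vertex.
have cards s : P s -> o \notin s -> #|` s| <= 2.
  move=> Ps os; have [i si] := out s Ps os; apply: leq_trans (fsubset_leq_card si) _.
  by rewrite cardfs2; case: eqP.
exists W, P, b, o, (codom b), f, [::]; split; split=> //.
- by rewrite !codomE -map_comp; apply: eq_map => i /=; exact: fb.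
- move=> i; apply: contraTneq (fan_uniq fP) => bo.
  by rewrite /= -bo codom_f.
- move=> s Ps os; have [i /fsubsetP si] := out s Ps os.
  apply: (skeleton_triangle (u := c i) (v := c (ordS i)) (w := c (ordS i))).
  + by rewrite -fsetUA fsetUid.
  + exact: simplex_neq0 Ps.
  + by move=> v /si; rewrite !inE => /orP[]/eqP->; rewrite fb eqxx ?orbT.
- by move=> s Ps os s3; have := cards s Ps os; rewrite s3.
Qed.

End ConeDisc.

Local Open Scope ring_scope.

(** * Contraction of a loop *)

Section Sequences.
Context {T : eqType}.
Implicit Types (x y : T) (p w : seq T) (e : T * T).

Lemma steps_cat x p y q :
  steps x (p ++ y :: q) = steps x p ++ (last x p, y) :: steps y q.
Proof. by elim: p x => //= z p IH x; rewrite IH. Qed.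

Lemma steps_iota (f : nat -> T) a n e : e \in steps (f a) (map f (iota a.+1 n)) ->
  exists2 k, (a <= k < a + n)%N & e = (f k, f k.+1).
Proof.
elim: n a => //= n IH a; rewrite in_cons => /predU1P[->|/IH[k /andP[ak kn] ->]].
  by exists a; rewrite // leqnn addnS ltnS leq_addr.
by exists k; rewrite // (ltnW ak) addnS -addSn.
Qed.

Lemma last_iota (f : nat -> T) a n : last (f a) (map f (iota a.+1 n)) = f (a + n)%N.
Proof. by elim: n a => [|n IH] a /=; rewrite ?addn0// IH addSnnS. Qed.

Lemma steps_flatten (I : eqType) (h : I -> T) (t : I -> seq T) i l e :
  e \in steps (h i) (t i ++ flatten [seq h k :: t k | k <- l]) ->
  (exists k, e \in steps (h k) (t k)) \/
  (exists2 s, s \in steps i l & e = (last (h s.1) (t s.1), h s.2)).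
Proof.
elim: l i => [|k l IH] i /=; first by rewrite cats0 => ei; left; exists i.
rewrite steps_cat mem_cat in_cons => /or3P[ei|/eqP->|/IH[]]; first by left; exists i.
- by right; exists (i, k) => //; rewrite in_cons eqxx.
- by left.
- by case=> s sl ->; right; exists s => //; rewrite in_cons sl orbT.
Qed.

Lemma last_flatten (I : eqType) (h : I -> T) (t : I -> seq T) i l :
  last (h i) (t i ++ flatten [seq h k :: t k | k <- l]) = last (h (last i l)) (t (last i l)).
Proof. by elim: l i => [|k l IH] i /=; rewrite ?cats0// last_cat /= IH. Qed.

Lemma cyc_steps_flatten (I : eqType) (h : I -> T) (t : I -> seq T) l e :
  e \in cyc_steps (flatten [seq h k :: t k | k <- l]) ->
  (exists k, e \in steps (h k) (t k)) \/
  (exists2 s, s \in cyc_steps l & e = (last (h s.1) (t s.1), h s.2)).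
Proof.
case: l => // i l; rewrite [flatten _]/= in_cyc_steps => /orP[/steps_flatten[]|/eqP->].
- by left.
- by case=> s sl ->; right; exists s; rewrite // in_cyc_steps sl.
- right; exists (last i l, i); first by rewrite in_cyc_steps eqxx orbT.
  by rewrite last_flatten.
Qed.

End Sequences.

Lemma cyc_steps_map (T U : eqType) (f : T -> U) w :
  cyc_steps (map f w) = [seq (f e.1, f e.2) | e <- cyc_steps w].
Proof. by case: w => //= x p; rewrite -map_rcons steps_map. Qed.

Lemma cyc_steps_enum j e : e \in cyc_steps (enum 'I_j) -> e.2 = ordS e.1.
Proof.
case: j e => [|j] e ej; first by case: e.1.
have : (val e.1, val e.2) \in cyc_steps (map val (enum 'I_j.+1)).
  by rewrite cyc_steps_map; exact: (map_f (fun e => (val e.1, val e.2))).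
rewrite val_enum_ord [iota _ _]/= in_cyc_steps -(map_id (iota 1 j)).
case/orP=> [/(steps_iota (f := id))[k /andP[_ kj] [e1 e2]]|].
  by apply: ord_inj; rewrite /= e1 e2 modn_small.
by rewrite (last_iota id 0) => /eqP[e1 e2]; apply: ord_inj; rewrite /= e1 e2 modnn.
Qed.

Section Moves.
Variables (R : realType) (V : choiceType) (K : simplicial_complex V).
Variables (j : nat) (c : 'I_j -> V).

Lemma open_filling_rotn k l n : open_filling R K c l n -> open_filling R K c (rot k l) n.
Proof.
elim: k => [|k IH] ol; first by rewrite rot0.
have [kl|lk] := ltnP k (size l); last by rewrite rot_oversize// ltnW.
by rewrite -addn1 addnC rotD ?add1n//; exact/open_filling_rot/IH.
Qed.

(** Labels are replaced one at a time, for two triangles each. A neighbour of the label being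
    replaced may be old or new, whence the four triples. *)
Lemma open_filling_push (I : eqType) (u u' : I -> V) (w : seq I) n :
  (1 < size w)%N ->
  (forall e, e \in cyc_steps w -> [/\ K [fset u' e.1; u e.1; u e.2],
     K [fset u' e.1; u e.1; u' e.2], K [fset u' e.2; u e.2; u e.1] &
     K [fset u' e.2; u e.2; u' e.1]]) ->
  open_filling R K c (map u w) n ->
  open_filling R K c (map u' w) (n + 2 * size w).
Proof.
(* The labels of [A] are still to be pushed, those of [B] are done; a rotation after each
   replacement brings the next label to the front. *)
move=> w1 Kw; suff H A B m : (forall e, e \in cyc_steps (A ++ B) -> e \in cyc_steps w) ->
    (1 < size (A ++ B))%N ->
    open_filling R K c (map u A ++ map u' B) m ->
    open_filling R K c (map u' (B ++ A)) (m + 2 * size A).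
  move=> ow; apply: (H w [::]); rewrite ?cats0//.
elim: A B m => [|x A IH] B m sub; first by rewrite /= cats0 muln0 addn0.
rewrite [size _]/= ltnS => AB oAB.
have nx : (x, head x (A ++ B)) \in cyc_steps w.
  apply: sub; rewrite cat_cons in_cyc_steps; case: (A ++ B) AB => // z q _ /=.
  by rewrite mem_head.
have lx : (last x (A ++ B), x) \in cyc_steps w.
  by apply: sub; rewrite cat_cons in_cyc_steps eqxx orbT.
rewrite (_ : B ++ x :: A = rcons B x ++ A); last by rewrite cat_rcons.
rewrite mulnS addnA; apply: IH.
- move=> e; rewrite -cats1 catA cats1 => eAB; apply: sub.
  by rewrite -cyc_steps_rot rot1_cons.
- by rewrite -cats1 catA size_cat addn1 ltnS.
rewrite map_rcons -cats1 catA cats1 -rot1_cons; apply: open_filling_rot.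
have [v [q [vq vE lE]]] : exists v q, [/\ map u A ++ map u' B = v :: q,
    v = u (head x (A ++ B)) \/ v = u' (head x (A ++ B)) &
    last v q = u (last x (A ++ B)) \/ last v q = u' (last x (A ++ B))].
  case: (A) AB => [|a A'] /= AB.
    case: (B) AB => // b B' _; exists (u' b), (map u' B') => /=.
    by rewrite last_map; split=> //; right.
  exists (u a), (map u A' ++ map u' B); split=> //; first by left.
  rewrite !last_cat last_map; case: (B) => [|b B'] /=; first by left.
  by rewrite last_map; right.
move: oAB; rewrite /= vq => /open_filling_replace; apply.
  by have [h1 h2 _ _] := Kw _ nx; case: vE => ->.
by have [_ _ h3 h4] := Kw _ lx; case: lE => ->.
Qed.

(** All inserted labels are ends of one edge, so every new triangle collapses into this edge. *)
Lemma open_filling_insert_seq v q l n : K [fset v; last v l] ->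
  (forall y, y \in q -> y = v \/ y = last v l) ->
  open_filling R K c (v :: l) n -> open_filling R K c (q ++ v :: l) (n + size q).
Proof.
move=> Kv; elim: q => [|y q IH] qv ol; first by rewrite addn0.
have {}IH := IH (fun z zq => qv z (mem_behead (zq : z \in behead (y :: q)))) ol.
have lastE : last v (q ++ v :: l) = last v l by rewrite last_cat.
rewrite /= -[(size q).+1]addn1 addnA.
have in2 z : z \in q -> z = v \/ z = last v l.
  by move=> zq; apply: qv; rewrite inE zq orbT.
case: q IH lastE in2 {qv} (qv y (mem_head _ _)) => [|z q] /= IH lastE in2 yE.
  apply: open_filling_insert IH _.
  apply: simplex_face Kv _ _; last by apply/fset0Pn; exists y; rewrite !inE eqxx.
  apply/fsubsetP => a; rewrite !inE -orbA; case: yE => ->; by case/or3P=> ->; rewrite ?orbT.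
apply: open_filling_insert IH _; rewrite last_cat /=.
have zE := in2 z (mem_head _ _).
apply: simplex_face Kv _ _; last by apply/fset0Pn; exists y; rewrite !inE eqxx.
by apply/fsubsetP => a; rewrite !inE -orbA; case: yE => ->; case: zE => ->;
  case/or3P=> ->; rewrite ?orbT.
Qed.

(** What is inserted after [u i] repeats [u i] or the next label: the loop gains length without
    leaving its edges. *)
Lemma open_filling_refine (I : eqType) (u : I -> V) (t : I -> seq V) (M : nat)
    (w : seq I) n : (0 < size w)%N -> (forall i, size (t i) = M) ->
  (forall e, e \in cyc_steps w -> K [fset u e.2; u e.1] /\
     forall y, y \in t e.1 -> y = u e.2 \/ y = u e.1) ->
  open_filling R K c (map u w) n ->
  open_filling R K c (flatten [seq u i :: t i | i <- w]) (n + size w * M).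
Proof.
move=> w0 tM Kw; pose S B := flatten [seq u i :: t i | i <- B].
suff H A B m : (forall e, e \in cyc_steps (A ++ B) -> e \in cyc_steps w) ->
    open_filling R K c (map u A ++ S B) m ->
    open_filling R K c (S (B ++ A)) (m + size A * M).
  by move=> ow; apply: (H w [::]); rewrite ?cats0.
elim: A B m => [|x A IH] B m sub; first by rewrite /= cats0 mul0n addn0.
move=> oAB; rewrite (_ : B ++ x :: A = rcons B x ++ A); last by rewrite cat_rcons.
rewrite [size _]/= mulSn addnA; apply: IH.
  move=> e; rewrite -cats1 catA cats1 => eAB; apply: sub.
  by rewrite -cyc_steps_rot rot1_cons.
have nx : (x, head x (A ++ B)) \in cyc_steps w.
  apply: sub; rewrite cat_cons in_cyc_steps; case: (A ++ B) => [|z q] /=.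
    by rewrite eqxx.
  by rewrite mem_head.
have [Kx tx] := Kw _ nx; move: oAB => /open_filling_rot.
rewrite rot1_cons.
have [q qE] : exists q, rcons (map u A ++ S B) (u x) = u (head x (A ++ B)) :: q /\
    last (u (head x (A ++ B))) q = u x.
  have lastE : last (u x) (rcons (map u A ++ S B) (u x)) = u x by rewrite last_rcons.
  case: (A) lastE => [|a A'] /=; last by move=> h; eexists; split.
  case: (B) => [|b B'] /=; first by exists [::].
  by move=> h; eexists; split.
case: qE => qE ql; rewrite qE => oq.
have := @open_filling_insert_seq _ (t x) q m _ _ oq; rewrite ql => /(_ Kx tx).
move=> /(open_filling_rotn (size (t x))); rewrite rot_size_cat -qE tM.
by rewrite /S map_rcons flatten_rcons -cats1 -!catA.
Qed.

End Moves.

(** * Labels of nearby points and the final count *)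

Section Main.
Variables (R : realType) (V : choiceType) (K : simplicial_complex V).
Variable d : bary_point R V -> bary_point R V -> R.
Hypothesis md : is_metric_on (realization K) d.

Lemma chain_dist (e : R) x p : (forall y, y \in x :: p -> realization K y) ->
  (forall s, s \in steps x p -> d s.1 s.2 <= e) -> 0 <= e ->
  forall y, y \in x :: p -> d x y <= (size p)%:R * e.
Proof.
move=> + + e0; elim: p x => [|z p IH] x rp se y.
  have rx := rp x (mem_head _ _).
  by rewrite inE => /eqP->; rewrite mul0r (metric_on_eq0 md rx rx).2.
have rx := rp x (mem_head _ _).
rewrite inE => /predU1P[->|yp].
  by rewrite (metric_on_eq0 md rx rx).2// mulr_ge0.
have rz : realization K z by apply: rp; rewrite !inE eqxx orbT.
have ry : realization K y by apply: rp; rewrite inE yp orbT.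
apply: le_trans (metric_on_triangle md rx rz ry) _.
rewrite [size _]/= -natr1 mulrDl mul1r addrC lerD//.
  apply: IH => // [a az|s sz]; first by apply: rp; rewrite inE az orbT.
  by apply: se; rewrite /= inE sz orbT.
by apply: (se (x, z)); rewrite /= mem_head.
Qed.

(** The labels of two points closer than [e] both lie in the support of one of these points, hence
    span a simplex; flagness fills the triple. *)
Lemma flag_triple (e : R) (sigma : bary_point R V -> V) : flag K ->
  (forall x y, realization K x -> realization K y -> d x y < e -> sigma x \in finsupp y) ->
  forall x y z, realization K x -> realization K y -> realization K z ->
  0 < e -> d x y < e -> d x z < e -> d y z < e ->
  K [fset sigma x; sigma y; sigma z].
Proof.
move=> fK sg x y z rx ry rz e0 xy xz yz.
have refl a : realization K a -> sigma a \in finsupp a.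
  by move=> ra; apply: sg => //; rewrite (metric_on_eq0 md ra ra).2.
have adj a b : realization K a -> realization K b -> d a b < e ->
    K [fset sigma a; sigma b].
  move=> ra rb ab; apply: simplex_face (finsupp_simplex rb) _ _.
    by rewrite fsubUset !fsub1set sg//= refl.
  by apply/fset0Pn; exists (sigma a); rewrite !inE eqxx.
have Kxy := adj x y rx ry xy; have Kxz := adj x z rx rz xz; have Kyz := adj y z ry rz yz.
have Kyx : K [fset sigma y; sigma x] by rewrite fsetUC.
have Kzx : K [fset sigma z; sigma x] by rewrite fsetUC.
have Kzy : K [fset sigma z; sigma y] by rewrite fsetUC.
apply: fK; first by apply/fset0Pn; exists (sigma x); rewrite !inE eqxx.
move=> v w; rewrite !inE -!orbA => /or3P[]/eqP-> /or3P[]/eqP-> vw; split=> //;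
  by rewrite eqxx in vw.
Qed.

End Main.

Theorem theorem1p1 (R : realType) (V : choiceType) (K : simplicial_complex V)
    (d : bary_point R V -> bary_point R V -> R) :
  flag K -> CAT0_metric K d -> finitely_many_shapes K d ->
  quadratic_isoperimetric_inequality R K.
Proof.
move=> fK [cat [cbd cdb]] shapes; have [md geo _] := cat.
have [e e0 star] := star_ball md cbd cdb shapes geo.
have e30 : 0 < e / 3 by lra.
have [M chains] := simplex_chains md cbd shapes e30.
(* With [m = n * M.+1] points on the subdivided loop: [n * M] triangles for the subdivision, [2 * m]
   for each of [m] rings, and [m] for the last star. *)
exists (fun n => n * M + 2 * (n * M.+1) * (n * M.+1) + n * M.+1)%N; last first.
  exists (4 * M.+1 ^ 2)%N, 0%N => n _.
  have h : (n * M + n * M.+1 <= 2 * (n * M.+1) * (n * M.+1))%N.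
    case: n => // n; rewrite -mulnA mul2n -addnn leq_add//.
      by apply: leq_trans (leq_mul (leqnn _) (leqnSn M)) _; rewrite leq_pmulr// muln_gt0.
    by rewrite leq_pmulr// muln_gt0.
  rewrite addnAC; apply: leq_trans (leq_add h (leqnn _)) _.
  by apply: eq_leq; rewrite -!mulnn; ring.
move=> j c j3 loop.
have rv v : realization K (bary_vertex v : bary_point R V) by exact: realization_vertex.
pose v0 := c (Ordinal (ltnW (ltnW j3))).
have /choice[sigma hsigma] (x : bary_point R V) : exists v, realization K x ->
    forall y, realization K y -> d x y < e -> v \in finsupp y.
  have [rx|nrx] := pselect (realization K x); last by exists v0.
  by have [v hv] := star x rx; exists v.
have sg x y : realization K x -> realization K y -> d x y < e -> sigma x \in finsupp y.
  by move=> rx; exact: hsigma.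
have tri := flag_triple md fK sg.
have dxx x : realization K x -> d x x = 0 by move=> rx; apply: (metric_on_eq0 md rx rx).2.
have dC x y : realization K x -> realization K y -> d x y = d y x by exact: metric_on_sym.
have Kc i : K [fset c i; c (ordS i)].
  case: (loop i) => [[_]//|->]; rewrite fsetUid; exact: simplex_vertex.
have sself x : realization K x -> sigma x \in finsupp x by move=> rx; apply: sg => //;
  rewrite dxx.
(* The label of a vertex is forced, its support being a singleton; thus the given loop is recovered
   among the labels. *)
have svertex v : sigma (bary_vertex v) = v.
  by have := sself _ (rv v); rewrite finsupp_vertex inE => /eqP.
have /choice[p hp] (i : 'I_j) : exists p : nat -> bary_point R V,
    [/\ p 0%N = bary_vertex (c i), p M.+1 = bary_vertex (c (ordS i)),
      forall k, (k <= M.+1)%N -> closed_simplex K [fset c i; c (ordS i)] (p k) &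
      forall k, (k < M.+1)%N -> d (p k) (p k.+1) < e / 3].
  by apply: (chains [fset c i; c (ordS i)]) => //; apply: closed_simplex_vertex => //;
    rewrite !inE eqxx ?orbT.
(* The end point [p i M.+1] is left out, since it is the first point of the next block. *)
pose t i := [seq p i k | k <- iota 1 M].
pose X := flatten [seq p i 0%N :: t i | i <- enum 'I_j].
have sizeX : size X = (j * M.+1)%N.
  rewrite /X size_flatten /shape -map_comp (eq_map (g := fun=> M.+1)); last first.
    by move=> i /=; rewrite size_map size_iota.
  by rewrite -[in RHS](size_enum_ord j); elim: (enum 'I_j) => //= i l ->; rewrite mulSn.
have rX x : x \in X -> realization K x.
  case/flattenP=> q /mapP[i _ ->]; have [_ _ cp _] := hp i.
  rewrite inE => /predU1P[->|/mapP[k]]; first by case: (cp 0%N isT).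
  by rewrite mem_iota => /andP[_ kM] ->; case: (cp k); rewrite // -add1n ltnW.
have stepX s : s \in cyc_steps X -> d s.1 s.2 < e / 3.
  case/cyc_steps_flatten=> [[i]|[[i i'] /cyc_steps_enum /= -> ->]].
    by case/steps_iota=> k /andP[_ kM] -> /=; have [_ _ _] := hp i; apply; exact: leqW.
  rewrite /= /t last_iota add0n; have [-> _ _ _] := hp (ordS i).
  by have [_ <- _ hd] := hp i; exact: hd.
have start : open_filling R K c [seq sigma x | x <- X] (j * M).
  have -> : [seq sigma x | x <- X] = flatten [seq c i :: map sigma (t i) | i <- enum 'I_j].
    rewrite /X map_flatten -map_comp; congr flatten; apply: eq_map => i /=.
    by have [-> _ _ _] := hp i; rewrite svertex.
  have := @open_filling_refine R V K j c _ c (fun i => map sigma (t i)) M (enum 'I_j) 0.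
  rewrite size_enum_ord add0n.
  apply.
  - exact: (@leq_trans 3).
  - by move=> i; rewrite !size_map size_iota.
  - move=> s /cyc_steps_enum ->; split; first by rewrite fsetUC.
    move=> y /mapP[x /mapP[k]]; rewrite mem_iota => /andP[_ kM] -> ->.
    have [_ _ cp _] := hp s.1; have [rk sk] := cp k (ltnW kM).
    by have := fsubsetP sk _ (sself _ rk); rewrite !inE => /orP[]/eqP->; [right|left].
  - by rewrite -codomE; exact: open_filling_start.
pose m := (j * M.+1)%N.
have m0 : (0 < m)%N by rewrite muln_gt0 andbT (@leq_trans 3).
case XE : X sizeX => [|x0 X']; first by rewrite /= => m0'; rewrite /m -m0' in m0.
move=> sizeX.
have x0X : x0 \in X by rewrite XE mem_head.
have [cone [cone01 rcone dcone lcone]] := geodesic_cone cat (rX _ x0X).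
(* Hence an [m]-th part of a geodesic from [x0] to a point of the loop is shorter than [e / 3]. *)
have dist0 x : x \in X -> d x0 x < m%:R * (e / 3).
  move=> xX; apply: (@le_lt_trans _ _ ((size X')%:R * (e / 3))).
    apply: (chain_dist md) => //; last by rewrite -XE.
    - by move=> y; rewrite -XE; exact: rX.
    - move=> s sX; apply/ltW/stepX; rewrite XE in_cyc_steps sX//.
    - exact: ltW.
  by rewrite ltr_pM2r// ltr_nat /m -sizeX.
have mX : size X = m by rewrite XE.
have mR : 0 < m%:R :> R by rewrite ltr0n.
(* Ring [m] is the subdivided loop and ring 0 is constant at [x0]; the contraction runs inwards. *)
pose ring k x := cone x (k%:R / m%:R).
have k01 k : (k <= m)%N -> 0 <= (k%:R / m%:R : R) <= 1.
  by move=> km; rewrite divr_ge0//= ler_pdivrMr// mul1r ler_nat.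
have rings k : (k <= m)%N ->
    open_filling R K c [seq sigma (ring (m - k)%N x) | x <- X] (j * M + k * (2 * m)).
  elim: k => [|k IH] km.
    rewrite mul0n addn0 subn0 (_ : map _ X = map sigma X)//.
    apply/eq_in_map => x /rX rx; rewrite /ring divff ?lt0r_neq0//.
    by case: (cone01 x rx) => _ ->.
  rewrite (_ : (j * M + k.+1 * (2 * m) = j * M + k * (2 * m) + 2 * size X)%N); last first.
    by rewrite mX mulSn [(2 * m + _)%N]addnC addnA.
  apply: (open_filling_push _ _ (IH (ltnW km))).
    by rewrite mX; apply: leq_trans (leq_pmulr _ _) => //; exact: ltnW.
  have mkS : (m - k = (m - k.+1).+1)%N by rewrite subnSK.
  set a := (m - k.+1)%N in mkS *; rewrite mkS.
  have aS : (a.+1 <= m)%N by rewrite -mkS leq_subr.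
  have aS' := ltnW aS.
  move=> s sX; have [s1X s2X] : s.1 \in X /\ s.2 \in X.
    move: sX; rewrite XE in_cyc_steps => /orP[/steps_mem[-> h2]|/eqP->] /=.
      by rewrite inE h2 orbT.
    by rewrite mem_last mem_head.
  have r1 := rX _ s1X; have r2 := rX _ s2X.
  have down x : x \in X -> d (ring a x) (ring a.+1 x) < e / 3.
    move=> xX; rewrite dcone ?k01//; last exact: rX.
    rewrite -mulrBl -natr1 opprD addrA subrr sub0r mulN1r normrN.
    by rewrite ger0_norm ?invr_ge0// mulrC ltr_pdivrMr// mulrC; exact: dist0.
  have across b : (b <= m)%N -> d (ring b s.1) (ring b s.2) < e / 3.
    move=> bm; apply: le_lt_trans (lcone _ _ _ r1 r2 (k01 _ bm)) (le_lt_trans _ (stepX _ sX)).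
    have /andP[b0 b1] := k01 _ bm.
    by rewrite -[leRHS]mul1r ler_wpM2r//; exact: (metric_on_ge0 md).
  have rr b x : x \in X -> (b <= m)%N -> realization K (ring b x).
    by move=> xX bm; apply: rcone; [exact: rX|exact: k01].
  have d1 := down _ s1X; have d2 := down _ s2X; have aa := across a aS';
    have aS1 := across a.+1 aS.
  have ra1 := rr a _ s1X aS'; have ra2 := rr a _ s2X aS'.
  have rb1 := rr a.+1 _ s1X aS; have rb2 := rr a.+1 _ s2X aS.
  (* The four sides of a cell between two rings are shorter than [e / 3], so its diagonals are
     shorter than [e] and every triple of its corners is admissible for [tri]. *)
  have t1 := metric_on_triangle md ra1 rb1 rb2.
  have t2 := metric_on_triangle md rb1 ra1 ra2.
  have t3 := metric_on_triangle md ra2 rb2 rb1.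
  have t4 := metric_on_triangle md rb2 ra2 ra1.
  have c1 := dC _ _ ra1 rb1; have c2 := dC _ _ ra2 rb2; have c3 := dC _ _ ra1 ra2.
  have c4 := dC _ _ rb1 rb2.
  by split; apply: tri => //; lra.
have := rings m (leqnn m); rewrite subnn => last_ring.
have labels : [seq sigma (ring 0%N x) | x <- X] = nseq m (sigma x0).
  rewrite -mX -(size_map (fun x => sigma (ring 0%N x))).
  apply/all_pred1P/allP => _ /mapP[x /rX rx ->] /=; rewrite /ring mul0r.
  by case: (cone01 x rx) => ->.
rewrite labels in last_ring.
have := open_filling_close (k := sigma x0) last_ring; rewrite size_nseq.
rewrite (_ : (j * M + m * (2 * m) + m)%N = (j * M + 2 * (j * M.+1) * (j * M.+1) + j *
  M.+1)%N); last first.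
  by rewrite /m [(_ * (2 * _))%N]mulnC.
apply=> s sm; have [-> ->] : s.1 = sigma x0 /\ s.2 = sigma x0.
  have mem a : a \in nseq m (sigma x0) -> a = sigma x0 by rewrite mem_nseq => /andP[_ /eqP].
  move: sm; case: (m) mem => // m' mem; rewrite /= -/(nseq _ _) in_cyc_steps.
  case/orP=> [/steps_mem[h1 h2]|/eqP->] /=.
    by split; apply: mem; rewrite // inE h2 orbT.
  by split=> //; apply: mem; exact: mem_last.
by rewrite -fsetUA !fsetUid; exact: simplex_vertex.
Qed.
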